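(* Let $S$ be infinite and let $p(i,j)$ be such that $$\lim_{t\to\infty}p_t(\xi,\xi')=0$$ for all nonzero finite configurations $\xi,\xi'\in\mathbb N^S$. Then for every $\theta>0$ the product measure $\bigotimes_{i\in S}\nu_\theta(dx_i)$ is ergodic for the process $(x_t)_{t\ge0}$.
   Context: $\mathbb N=\{0,1,2,\dots\}$. $S$ is a countable set of vertices, and $p(i,j)$ is an irreducible symmetric random walk kernel on $S$: $p(i,j)=p(j,i)\ge0$, $\sum_jp(i,j)=1$, and for all $i,j\in S$ there is $n$ with $p^{(n)}(i,j)>0$. All sums over $i,j$ below are over ordered pairs of distinct vertices. Continuous process: $(x_t)_{t\ge0}$ is the Markov process on $\Omega=[0,\infty)^S$ with generator $$Lf(x)=\sum_{i,j}p(i,j)\int_0^1\int_0^1\big(f(x^{ij;uv})-f(x)\big)\,du\,dv,$$ where $x^{ij;uv}_k=x_k$ for $k\notin\{i,j\}$, $x^{ij;uv}_i=x_i(1-u)+x_jv$, $x^{ij;uv}_j=x_j(1-v)+x_iu$. Dual process: a configuration $\xi\in\mathbb N^S$ is finite if $|\xi|=\sum_{i\in S}\xi_i<\infty$. The dual process $(\xi_t)_{t\ge0}$ is the Markov process on configurations with generator $$\mathcal Lf(\xi)=\sum_{i,j}p(i,j)\sum_{K=0}^{\xi_i}\sum_{M=0}^{\xi_j}\frac{1}{(\xi_i+1)(\xi_j+1)}\big(f(\xi^{ij;KM})-f(\xi)\big),$$ where $\xi^{ij;KM}_k=\xi_k$ for $k\notin\{i,j\}$, $\xi^{ij;KM}_i=\xi_i-K+M$,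 $\xi^{ij;KM}_j=\xi_j-M+K$. For finite $\xi,\xi'$, $p_t(\xi,\xi')$ denotes the probability that the dual process started from $\xi$ is at $\xi'$ at time $t$. $\nu_\theta(dz)=\theta^{-2}\,z\,e^{-z/\theta}\,dz$ on $[0,\infty)$ is the Gamma distribution with shape $2$ and scale $\theta$; the product measure $\bigotimes_{i\in S}\nu_\theta(dx_i)$ is invariant for $(x_t)$. An invariant measure is ergodic if the stationary process started from it is ergodic under time shifts. *)

(* Defs.v *)
From HB Require Import structures.
From mathcomp Require Import all_boot all_order all_algebra finmap.
From mathcomp Require Import all_classical all_reals all_analysis.

Set Implicit Arguments.
Unset Strict Implicit.
Unset Printing Implicit Defensive.
Import Order.TTheory GRing.Theory Num.Theory.
Import numFieldNormedType.Exports.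

Local Open Scope classical_set_scope.
Local Open Scope ring_scope.

(* Sum of an absolutely summable real family over an arbitrary index set;
   [esum] itself is only meaningful for nonnegative terms. *)
Definition rsum (R : realType) (I : choiceType) (D : set I) (f : I -> R) : R :=
  fine (esum D (EFin \o f)^\+ - esum D (EFin \o f)^\-)%E.

(* Product sigma-algebra on I -> T, for an arbitrary index type I. *)
Definition cylinders (I : Type) d (T : measurableType d) : set (set (I -> T)) :=
  [set A | exists i (B : set T), measurable B /\ A = [set x | B (x i)]].

Definition prod_space (I : Type) d (T : measurableType d) :=
  g_sigma_algebraType (@cylinders I d T).

HB.instance Definition _ I d (T : measurableType d) :=
  Measurable.on (@prod_space I d T).

Section random_walk.
Context (R : realType) (S : countType) (p : S -> S -> R).

Fixpoint step_prob (n : nat) (i j : S) : \bar R :=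
  if n is m.+1 then (\esum_(k in [set: S]) ((p i k)%:E * step_prob m k j))%E
  else ((i == j)%:R)%:E.

Definition irreducible_symmetric_walk : Prop :=
  [/\ forall i j, 0 <= p i j,
      forall i j, p i j = p j i,
      forall i, \esum_(j in [set: S]) (p i j)%:E = 1%E
    & forall i j, exists n, (0 < step_prob n i j)%E].

Definition distinct_pairs : set (S * S) := [set ij | ij.1 != ij.2].

End random_walk.

Section markov_semigroup.
Context (R : realType) (d : measure_display) (T : measurableType d).
Implicit Type P : R -> R.-pker T ~> T.

(* Only the times t >= 0 and the starting points in D are constrained. *)
Definition markov_semigroup (D : set T) P : Prop :=
  [/\ forall t x, 0 <= t -> D x -> P t x D = 1%E,
      forall x B, D x -> measurable B -> P 0 x B = \d_x B
    & forall s t x B, 0 <= s -> 0 <= t -> D x -> measurable B ->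
        P (s + t) x B = (\int[P s x]_y P t y B)%E].

Definition semigroup_op P (t : R) (f : T -> R) (x : T) : R :=
  \int[P t x]_y f y.

Definition invariant_measure P (mu : set T -> \bar R) : Prop :=
  forall t B, 0 <= t -> measurable B -> (\int[mu]_x P t x B)%E = mu B.

(* A path is indexed by the times t >= 0. *)
Definition path_space := @prod_space {nonneg R} d T.

Definition time_shift (t : {nonneg R}) (w : path_space) : path_space :=
  fun s => w (s%:num + t%:num)%:nng.

(* For l = [:: (h1, B1); ...; (hn, Bn)], the event
   X_(s + h1) \in B1, ..., X_(s + h1 + ... + hn) \in Bn. *)
Fixpoint fdd_event (s : {nonneg R}) (l : seq ({nonneg R} * set T)) :
    set path_space :=
  if l is (h, B) :: l' then
    [set w | B (w (s%:num + h%:num)%:nng)]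
      `&` fdd_event (s%:num + h%:num)%:nng l'
  else setT.

(* The probability of [fdd_event 0 l] for the process started from x. *)
Fixpoint fdd_prob P (l : seq ({nonneg R} * set T)) (x : T) : \bar R :=
  if l is (h, B) :: l' then (\int[P h%:num x]_(y in B) fdd_prob P l' y)%E
  else 1%E.

Definition path_law P (mu : set T -> \bar R) (Q : set path_space -> \bar R) :
    Prop :=
  forall l : seq ({nonneg R} * set T),
    (forall hB, hB \in l -> measurable hB.2) ->
    Q (fdd_event 0%:nng l) = (\int[mu]_x fdd_prob P l x)%E.

(* Shift invariance of an event is understood up to Q-null sets: in the product
   sigma-algebra over uncountably many times, the only events A with
   time_shift t @^-1` A = A for every t are set0 and setT. *)
Definition shift_ergodic (Q : set path_space -> \bar R) : Prop :=
  forall A, measurable A ->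
    (forall t, Q ((time_shift t @^-1` A) `+` A) = 0%E) ->
    Q A = 0%E \/ Q A = 1%E.

Definition ergodic_measure P (mu : set T -> \bar R) : Prop :=
  invariant_measure P mu /\
  forall Q : probability path_space R, path_law P mu Q -> shift_ergodic Q.

End markov_semigroup.

Section continuous_process.
Context (R : realType) (S : countType) (p : S -> S -> R).

(* R^S with the product of the Borel sigma-algebras; the state space of the
   process is its subset [Omega]. *)
Definition config := @prod_space S _ (measurableTypeR R).

Definition Omega : set config := [set x | forall i, 0 <= x i].

Definition exchange (i j : S) (u v : R) (x : config) : config := fun k =>
  if k == i then x i * (1 - u) + x j * v
  else if k == j then x j * (1 - v) + x i * u
  else x k.

Definition generator (f : config -> R) (x : config) : R :=
  rsum (@distinct_pairs S) (fun ij => p ij.1 ij.2 *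
    \int[lebesgue_measure]_(u in `[0, 1])
      \int[lebesgue_measure]_(v in `[0, 1])
        (f (exchange ij.1 ij.2 u v x) - f x)).

Definition local_function (f : config -> R) : Prop :=
  exists A : {fset S},
    forall x y : config, (forall i, i \in A -> x i = y i) -> f x = f y.

(* The generator is the derivative at 0 of the semigroup, in the supremum norm
   over Omega, on bounded measurable functions of finitely many coordinates.
   On such f the generator is a bounded function, and these f determine the
   semigroup. *)
Definition process_semigroup (P : R -> R.-pker config ~> config) : Prop :=
  markov_semigroup Omega P /\
  forall f : config -> R,
    measurable_fun [set: config] f ->
    [bounded f x | x in [set: config]] ->
    local_function f ->
    forall e : R, 0 < e -> \forall t \near 0^'+, forall x, Omega x ->
      `|(semigroup_op P t f x - f x) / t - generator f x| <= e.

(* Gamma distribution with shape 2 and scale theta. *)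
Definition nu (theta : R) (B : set R) : \bar R :=
  (\int[lebesgue_measure]_(z in B `&` `[0%R, +oo[)
     (theta ^- 2 * z * expR (- z / theta))%:E)%E.

Definition is_product_measure (m : set R -> \bar R)
    (mu : set config -> \bar R) : Prop :=
  forall (A : {fset S}) (B : S -> set (measurableTypeR R)),
    (forall i, measurable (B i)) ->
    mu [set x | forall i, i \in A -> B i (x i)] = (\prod_(i <- A) m (B i))%E.

End continuous_process.

(* Finite configurations, with the discrete sigma-algebra. *)
Definition fconfig (S : countType) := {fsfun S -> nat with 0%N}.

HB.instance Definition _ (S : countType) := Countable.on (fconfig S).
HB.instance Definition _ (S : countType) :=
  isPointed.Build (fconfig S) [fsfun].
HB.instance Definition _ (S : countType) :=
  @isMeasurable.Build default_measure_display (fconfig S)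
    discrete_measurable discrete_measurable0
    discrete_measurableC discrete_measurableU.

Section dual_process.
Context (R : realType) (S : countType) (p : S -> S -> R).

Definition dual_exchange (i j : S) (K M : nat) (xi : fconfig S) : fconfig S :=
  [fsfun xi with i |-> (xi i - K + M)%N, j |-> (xi j - M + K)%N].

Definition dual_generator (f : fconfig S -> R) (xi : fconfig S) : R :=
  rsum (@distinct_pairs S) (fun ij => p ij.1 ij.2 *
    \sum_(K < (xi ij.1).+1) \sum_(M < (xi ij.2).+1)
      ((xi ij.1).+1%:R * (xi ij.2).+1%:R)^-1 *
      (f (dual_exchange ij.1 ij.2 K M xi) - f xi)).

(* Each set {|xi| = n} is closed and has bounded total jump rates, so that the
   pointwise derivative at 0 determines the semigroup. *)
Definition dual_semigroup (P : R -> R.-pker (fconfig S) ~> (fconfig S)) :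
    Prop :=
  markov_semigroup setT P /\
  forall f : fconfig S -> R, [bounded f xi | xi in [set: fconfig S]] ->
    forall xi,
    (semigroup_op P t f xi - f xi) / t @[t --> 0^'+] --> dual_generator f xi.

End dual_process.

(* Main.v *)
(* Write E_ij for the average over an exchange between i and j, and f_A for the
   conditional expectation of f given the sites in A under the product measure.

   Invariance. E_ij preserves the product measure: a Gamma mass of shape 2 cut
   at a uniform point consists of two independent exponential masses, so that
   an exchange permutes four independent exponential masses. Iterating the
   generator k times on a function of n sites bounds the defect of invariance
   at time t by 2 (4 t)^k C(n + k - 1, k), which tends to 0 with k for small t.

   Invariant functions. Let f be bounded, with <P_t g, f> = <g, f> for all g
   and t. Differentiating at g = f_A gives
   sum_ij p(i,j) <f_A - E_ij f_A, f> = 0. Each bracket is at least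
   <f_A - E_ij f_A, f_A> / 2 - |d_i|^2 - |d_j|^2, where d_k is the difference
   of the conditional expectations given A and k and given A, and by Bessel's
   inequality the |d_k|^2 sum to at most |f - f_A|^2. As A grows, this yields
   E_ij f = f when p(i,j) > 0, so that f is invariant under the transposition of
   the sites i and j and, by irreducibility, under all transpositions. Then
   |d_k|^2 is the same for all k outside A, hence 0 since S is infinite, and f is
   constant.

   Ergodicity. For a shift-invariant event A put f(X_0) = P(A | X_0). By the
   Markov property, P(C and A) = E(1_C f(X_T)) for cylinders C and T large;
   approximating A itself by cylinders, P(A) = E(f(X_0)^2). Hence
   1_A = f(X_0) almost surely, f is invariant in the above sense, and so it is
   constant. *)

Require Import Defs.
From HB Require Import structures.
From mathcomp Require Import all_boot all_order all_algebra finmap.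
From mathcomp Require Import all_classical all_reals all_analysis.
From mathcomp Require Import measurable_realfun ring lra.
Set Implicit Arguments.
Unset Strict Implicit.
Unset Printing Implicit Defensive.
Import Order.TTheory GRing.Theory Num.Theory.
Import numFieldNormedType.Exports.
Local Open Scope classical_set_scope.
Local Open Scope ring_scope.
(** * Bounded measurable functions *)

(** The semigroup is known only through its derivative at 0 on local functions, while neither P_t g
    nor an invariant f is local. For invariance, only g is differentiated: mu (P_(t+h) g) is read as
    mu P_t applied to P_h g, where P_t enters through linearity and its norm. For an invariant f,
    the function differentiated is f_A. The bracket f_A - E_ij f_A vanishes when i and j lie outside
    A and otherwise depends on A and at most one further site k, so that pairing it with f rather
    than f_A costs d_k alone; as rows and columns of p sum to 1, Bessel's inequality bounds the
    total cost. The factor 1/2 in each bound comes from E_ij being a contraction of L^2, by Jensen's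
    inequality and invariance of mu. E_ij f = f yields invariance under the transposition because
    swapping the sites before an exchange with cuts (u, v) amounts to the cuts (1 - v, 1 - u): E_ij
    f is symmetric in the two sites at every point. Functions are bounded and defined everywhere;
    almost sure equality is written as a vanishing integral of a squared difference. Conditional
    expectations given A are partial integrals, since mu is a product. *)

Section bounded_measurable.
Context (R : realType) d (T : measurableType d).
Implicit Types (f g : T -> R) (m : {measure set T -> \bar R}) (B : set T).

(** The bound holds everywhere, not almost everywhere, so that sums, products, sections and kernel
    images stay in the class, and integrability against finite measures is automatic. *)
Definition bmf f := measurable_fun [set: T] f /\ exists M : R, forall x, `|f x| <= M.

Lemma bmf_cst (c : R) : bmf (fun=> c).
Proof. by split; [exact: measurable_cst|exists `|c|]. Qed.

Lemma bmfD f g : bmf f -> bmf g -> bmf (fun x => f x + g x).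
Proof.
move=> [mf [M fM]] [mg [N gN]]; split; first exact: measurable_funD.
by exists (M + N) => x; apply: le_trans (ler_normD _ _) _; rewrite lerD.
Qed.

Lemma bmfN f : bmf f -> bmf (fun x => - f x).
Proof.
move=> [mf [M fM]]; split; first exact: measurableT_comp.
by exists M => x; rewrite normrN.
Qed.

Lemma bmfB f g : bmf f -> bmf g -> bmf (fun x => f x - g x).
Proof. by move=> bf bg; apply: bmfD => //; exact: bmfN. Qed.

Lemma bmfM f g : bmf f -> bmf g -> bmf (fun x => f x * g x).
Proof.
move=> [mf [M fM]] [mg [N gN]]; split; first exact: measurable_funM.
by exists (M * N) => x; rewrite normrM ler_pM.
Qed.

Lemma bmfZ (c : R) f : bmf f -> bmf (fun x => c * f x).
Proof. by move=> bf; apply: bmfM => //; exact: bmf_cst. Qed.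

Lemma bmfX f n : bmf f -> bmf (fun x => f x ^+ n).
Proof.
move=> bf; elim: n => [|n IH]; first exact: bmf_cst.
rewrite [X in bmf X](_ : _ = fun x => f x * f x ^+ n); first exact: bmfM.
by apply/funext => x; rewrite exprS.
Qed.

Lemma bmf_sum (I : Type) (s : seq I) (P : pred I) (F : I -> T -> R) :
  (forall i, bmf (F i)) -> bmf (fun x => \sum_(i <- s | P i) F i x).
Proof.
move=> bF; elim: s => [|i s IH].
  rewrite [X in bmf X](_ : _ = fun=> 0); first exact: bmf_cst.
  by apply/funext => x; rewrite big_nil.
rewrite [X in bmf X](_ : _ = fun x => (if P i then F i x else 0) +
    \sum_(j <- s | P j) F j x); last first.
  by apply/funext => x; rewrite big_cons; case: ifP; rewrite ?add0r.
by apply: bmfD => //; case: (P i) => //; exact: bmf_cst.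
Qed.

Lemma bmf_indic B : measurable B -> bmf \1_B.
Proof.
move=> mB; split; first exact: measurable_indic.
by exists 1 => x; rewrite indicE; case: (_ \in _); rewrite ?normr1 ?normr0.
Qed.

Lemma bmf_comp d' (T' : measurableType d') (phi : T' -> T) f :
  measurable_fun [set: T'] phi -> bmf f ->
  measurable_fun [set: T'] (fun y => f (phi y)) /\
  exists M, forall y, `|f (phi y)| <= M.
Proof.
move=> mphi [mf [M fM]]; split; last by exists M.
exact: (measurableT_comp mf mphi).
Qed.

Lemma bmf_bounded f : bmf f -> [bounded f x | x in [set: T]].
Proof.
move=> [_ [M fM]]; exists M; split; first exact: num_real.
by move=> x Mx y _ /=; rewrite (le_trans (fM y))// ltW.
Qed.

End bounded_measurable.

Hint Resolve bmf_cst bmfD bmfN bmfB bmfM bmfZ bmfX bmf_indic : core.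

(** * Integrals of bounded functions against a finite measure *)

Section integral_bmf.
Context (R : realType) d (T : measurableType d).
Variable m : {measure set T -> \bar R}.
Hypothesis mfin : (m setT < +oo)%E.
Implicit Types (f g : T -> R) (B : set T).

Lemma bmf_integrable B f : measurable B -> bmf f -> m.-integrable B (EFin \o f).
Proof.
move=> mB [mf bf]; apply: measurable_bounded_integrable => //.
- by apply: le_lt_trans mfin; apply: le_measure => //; rewrite inE.
- exact: measurable_funTS.
- have [M [Mr MM]] : [bounded f x | x in [set: T]] by exact: bmf_bounded.
  by exists M; split=> // x Mx y _; exact: MM.
Qed.

Local Notation I f := (\int[m]_x f x)%R.

Lemma int_fineK f : bmf f -> (I f)%:E = (\int[m]_x (f x)%:E)%E.
Proof. by move=> bf; rewrite fineK//; apply: integrable_fin_num => //; exact: bmf_integrable. Qed.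

Lemma intD f g : bmf f -> bmf g -> \int[m]_x (f x + g x) = I f + I g.
Proof. by move=> bf bg; rewrite RintegralD//; exact: bmf_integrable. Qed.

Lemma intB f g : bmf f -> bmf g -> \int[m]_x (f x - g x) = I f - I g.
Proof. by move=> bf bg; rewrite RintegralB//; exact: bmf_integrable. Qed.

Lemma intZ c f : bmf f -> \int[m]_x (c * f x) = c * I f.
Proof. by move=> bf; rewrite RintegralZl//; exact: bmf_integrable. Qed.

Lemma intN f : bmf f -> \int[m]_x (- f x) = - I f.
Proof.
move=> bf; rewrite -mulN1r -intZ//.
by apply: eq_Rintegral => x _; rewrite mulN1r.
Qed.

Lemma int_cst (c : R) : \int[m]_x c = c * fine (m setT).
Proof. exact: Rintegral_cst. Qed.

Lemma int_sum (J : Type) (s : seq J) (P : pred J) (F : J -> T -> R) :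
  (forall i, bmf (F i)) ->
  \int[m]_x (\sum_(i <- s | P i) F i x) = \sum_(i <- s | P i) I (F i).
Proof.
move=> bF; elim: s => [|i s IH].
  rewrite big_nil; transitivity (\int[m]_x (0 : R)).
    by apply: eq_Rintegral => x _; rewrite big_nil.
  by rewrite int_cst mul0r.
rewrite big_cons -IH.
transitivity (\int[m]_x ((if P i then F i x else 0) + \sum_(j <- s | P j) F j x)).
  by apply: eq_Rintegral => x _; rewrite big_cons; case: ifP; rewrite ?add0r.
case: (P i); first by rewrite intD//; exact: bmf_sum.
by apply: eq_Rintegral => x _; rewrite add0r.
Qed.

Lemma int_le f g : bmf f -> bmf g -> (forall x, f x <= g x) -> I f <= I g.
Proof. by move=> bf bg fg; apply: le_Rintegral => //; exact: bmf_integrable. Qed.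

Lemma int_ge0 f : (forall x, 0 <= f x) -> 0 <= I f.
Proof. by move=> f0; apply: Rintegral_ge0. Qed.

Lemma int_norm_le f M : bmf f -> (forall x, `|f x| <= M) ->
  `|I f| <= M * fine (m setT).
Proof.
move=> bf fM; rewrite -int_cst ler_norml -intN//; apply/andP; split.
  by apply: int_le => // x; have := fM x; rewrite ler_norml => /andP[].
by apply: int_le => // x; have := fM x; rewrite ler_norml => /andP[].
Qed.

Lemma int_norm_le1 f M : m setT = 1%E -> bmf f -> (forall x, `|f x| <= M) ->
  `|I f| <= M.
Proof. by move=> m1 bf fM; have := int_norm_le bf fM; rewrite m1 mulr1. Qed.

Lemma int_cst1 (c : R) : m setT = 1%E -> \int[m]_x c = c.
Proof. by move=> m1; rewrite int_cst m1 mulr1. Qed.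

Lemma int_indic B : measurable B -> I \1_B = fine (m B).
Proof. by move=> mB; rewrite /Rintegral integral_indic// setIT. Qed.

End integral_bmf.

(** Discriminant argument: at s = -a/(b+1), where b+1 replaces b to cover b = 0, the form equals
    -a^2 (b+2)/(b+1)^2. *)
Lemma quadratic_eq0 (R : realFieldType) (a b : R) : 0 <= b ->
  (forall s, 0 <= 2 * s * a + s ^+ 2 * b) -> a = 0.
Proof.
move=> b0 H; have b1 : 0 < b + 1 by lra.
have := H (- a / (b + 1)).
have -> : 2 * (- a / (b + 1)) * a + (- a / (b + 1)) ^+ 2 * b =
  - (a ^+ 2 * (b + 2)) / (b + 1) ^+ 2 by field; rewrite gt_eqF.
rewrite pmulr_lge0 ?invr_gt0 ?exprn_gt0// oppr_ge0 pmulr_lle0; last lra.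
by move=> h; apply/eqP; rewrite -sqrf_eq0 eq_le h sqr_ge0.
Qed.

(** Degenerate case of the Cauchy-Schwarz inequality, from the integrals of (g + s h)^2 for all s.
    It discards almost everywhere null functions from integrals. *)
Lemma int_null_mul (R : realType) d (T : measurableType d)
  (m : {measure set T -> \bar R}) (g h : T -> R) : (m setT < +oo)%E ->
  bmf g -> bmf h -> \int[m]_x (g x ^+ 2) = 0 -> \int[m]_x (g x * h x) = 0.
Proof.
move=> mfin bg bh g0; apply: (@quadratic_eq0 _ _ (\int[m]_x (h x ^+ 2))).
  by apply: int_ge0 => x; exact: sqr_ge0.
move=> s; have : 0 <= \int[m]_x ((g x + s * h x) ^+ 2).
  by apply: int_ge0 => x; exact: sqr_ge0.
have -> : \int[m]_x ((g x + s * h x) ^+ 2) = \int[m]_x (g x ^+ 2) +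
    (2 * s * \int[m]_x (g x * h x) + s ^+ 2 * \int[m]_x (h x ^+ 2)).
  rewrite -!intZ; auto; rewrite -intD; auto; rewrite -intD; auto.
  by apply: eq_Rintegral => x _; ring.
by rewrite g0 add0r.
Qed.

(** * Functionals continuous for the supremum norm *)

Section functionals.
Context (R : realType) d (T : measurableType d).
Implicit Types (f g : T -> R) (F G : (T -> R) -> R).

(** Linear functionals bounded in the supremum norm: exactly what lets an identity on indicators
    pass to uniform limits of simple functions. *)
Definition blf F :=
  (forall (a : R) f g, bmf f -> bmf g ->
     F (fun x => a * f x + g x) = a * F f + F g) /\
  exists C : R, forall f (M : R), bmf f -> (forall x, `|f x| <= M) -> `|F f| <= C * M.

Lemma blf_int (m : {measure set T -> \bar R}) h : (m setT < +oo)%E -> bmf h ->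
  blf (fun f => \int[m]_x (f x * h x)).
Proof.
move=> mfin bh; split.
  move=> a f g bf bg; rewrite -intZ// -?intD; auto.
  by apply: eq_Rintegral => x _; ring.
have [N hN] := bh.2; exists (N * fine (m setT)) => f M bf fM.
rewrite mulrAC; apply: int_norm_le; auto => x.
by rewrite mulrC normrM ler_pM.
Qed.

Lemma blf_int1 (m : {measure set T -> \bar R}) : (m setT < +oo)%E ->
  blf (fun f => \int[m]_x (f x)).
Proof.
move=> mfin; have := blf_int mfin (bmf_cst T (1 : R)).
rewrite [X in blf X -> _](_ : _ = (fun f => \int[m]_x f x))//.
by apply/funext => f; apply: eq_Rintegral => x _; rewrite mulr1.
Qed.

(* A [0, 1]-valued function is within 1/n of (1/n) times the sum over
   1 <= k <= n of the indicators of its superlevel sets {f >= k/n}. *)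
Lemma floor_approx (x : R) (n : nat) : 0 <= x <= 1 ->
  `|x - n.+1%:R^-1 * \sum_(k < n.+1) (k.+1%:R / n.+1%:R <= x)%R%:R| <= n.+1%:R^-1.
Proof.
move=> /andP[x0 x1].
have n0 : 0 < n.+1%:R :> R by rewrite ltr0n.
pose t := Num.truncn (x * n.+1%:R).
have /andP[t1 t2] : t%:R <= x * n.+1%:R < t.+1%:R.
  by apply: truncn_itv; rewrite mulr_ge0.
have tn : (t <= n.+1)%N.
  by rewrite -(ler_nat R) (le_trans t1)// ler_piMl// ltW.
have -> : \sum_(k < n.+1) (k.+1%:R / n.+1%:R <= x)%R%:R = t%:R :> R.
  have kt (k : nat) : (k.+1%:R / n.+1%:R <= x)%R = (k < t)%N.
    rewrite ler_pdivrMr//; apply/idP/idP => h.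
      by rewrite -ltnS -(ltr_nat R) (le_lt_trans h).
    by rewrite (le_trans _ t1)// ler_nat.
  under eq_bigr do rewrite kt.
  rewrite -natr_sum -(big_mkord xpredT (fun k => (k < t)%N : nat)).
  rewrite (big_cat_nat (n := t))//= [X in (X + _)%N](_ : _ = t).
    rewrite big_nat_cond big1 ?addn0// => i /andP[/andP[ti _] _].
    by rewrite ltnNge ti.
  rewrite big_nat_cond (eq_bigr (fun=> 1%N)); last by move=> i /andP[/andP[_ ->]].
  by rewrite -big_nat_cond sum_nat_const_nat muln1 subn0.
have -> : x - n.+1%:R^-1 * t%:R = n.+1%:R^-1 * (x * n.+1%:R - t%:R).
  by field; rewrite gt_eqF.
rewrite normrM gtr0_norm ?invr_gt0// ler_piMr ?invr_ge0 ?ltW//.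
rewrite ger0_norm ?subr_ge0//.
by rewrite ltrBlDr addrC natr1.
Qed.

Lemma simple_approx f (e : R) : bmf f -> 0 < e ->
  exists (n : nat) (c : nat -> R) (B : nat -> set T), (forall k, measurable (B k)) /\
    forall x, `|f x - \sum_(k < n) c k * \1_(B k) x| <= e.
Proof.
move=> bf e0; have [_ [M fM]] := bf; pose N := `|M| + 1.
have N0 : 0 < N by rewrite ltr_wpDl.
pose g x := (2 * N)^-1 * f x + 2^-1.
have g01 x : 0 <= g x <= 1.
  have : `|f x| <= N.
    by rewrite (le_trans (fM x))// (le_trans (ler_norm M))// lerDl.
  rewrite ler_norml => /andP[f1 f2].
  have -> : g x = (f x + N) / (2 * N) by rewrite /g; field; rewrite gt_eqF.
  rewrite divr_ge0; [|lra|lra]; rewrite ler_pdivrMr; lra.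
have bg : bmf g by rewrite /g; auto.
pose n := Num.truncn (2 * N / e).
have nlt : 2 * N / e < n.+1%:R.
  by have /andP[] : n%:R <= 2 * N / e < n.+1%:R
    by apply: truncn_itv; rewrite divr_ge0 ?mulr_ge0 ?(ltW N0) ?(ltW e0).
pose A (k : nat) := [set x | k.+1%:R / n.+1%:R <= g x].
have mA k : measurable (A k).
  rewrite (_ : A k = g @^-1` `[k.+1%:R / n.+1%:R, +oo[); last first.
    by apply/seteqP; split=> x /=; rewrite in_itv/= ?andbT.
  by rewrite -[_ @^-1` _]setTI; apply: bg.1.
(* The first [n.+1] terms approximate 2N g; the last one, -N on the whole space, undoes the shift
   that brought f into [0, 1]. *)
exists n.+2, (fun k => if (k < n.+1)%N then 2 * N * n.+1%:R^-1 else - N),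
  (fun k => if (k < n.+1)%N then A k else setT).
split=> [k|x]; first by case: ifP.
rewrite big_ord_recr/= ltnn indicT mulr1.
rewrite (eq_bigr (fun k : 'I_n.+1 => 2 * N * n.+1%:R^-1 *
    (k.+1%:R / n.+1%:R <= g x)%R%:R)); last first.
  move=> k _; rewrite ltn_ord indicE; congr (_ * (nat_of_bool _)%:R).
  by apply/idP/idP => [/set_mem//|h]; exact: mem_set.
rewrite -mulr_sumr; have := floor_approx n (g01 x).
set s := \sum_(k < _) _ => h.
have -> : f x - (2 * N / n.+1%:R * s + - N) = 2 * N * (g x - n.+1%:R^-1 * s).
  by rewrite /g; field; rewrite !gt_eqF ?ltr0n.
have N20 : 0 < 2 * N by rewrite mulr_gt0.
rewrite normrM gtr0_norm// -ler_pdivlMl//; apply: le_trans h _.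
by rewrite -[leRHS]invrK lef_pV2 ?posrE ?invr_gt0 ?mulr_gt0 ?ltr0n ?invr_gt0// invfM
  invrK ltW.
Qed.

(** Simple functions are uniformly dense, so two bounded functionals equal on indicators coincide.
    Most integral identities below are reduced to events in this way. *)
Lemma blf_ext F G : blf F -> blf G ->
  (forall B, measurable B -> F \1_B = G \1_B) -> forall f, bmf f -> F f = G f.
Proof.
move=> bF bG FG f bf.
have lin0 K : blf K -> K (fun=> 0) = 0.
  move=> [linK _].
  have := linK 1 (fun=> 0) (fun=> 0) (bmf_cst _ _) (bmf_cst _ _).
  under eq_fun do rewrite mulr0 addr0; lra.
have linS K : blf K -> forall n (c : nat -> R) (B : nat -> set T),
    (forall k, measurable (B k)) ->
    K (fun x => \sum_(k < n) c k * \1_(B k) x) = \sum_(k < n) c k * K \1_(B k).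
  move=> bK n c B mB; elim: n => [|n IH].
    rewrite big_ord0 -[RHS](lin0 _ bK); congr K.
    by apply/funext => x; rewrite big_ord0.
  rewrite big_ord_recr/= -IH addrC -bK.1; last 2 first.
  - exact: bmf_indic.
  - by apply: bmf_sum => k; apply: bmfZ; exact: bmf_indic.
  by congr K; apply/funext => x; rewrite big_ord_recr/= addrC.
have [_ [C FC]] := bF; have [_ [D GD]] := bG.
apply/eqP; rewrite -subr_eq0 -normr_le0; apply/ler_addgt0Pr => e e0; rewrite add0r.
pose CD := `|C| + `|D| + 1.
have CD0 : 0 < CD by rewrite ltr_wpDl// addr_ge0.
have eCD : 0 < e / CD by rewrite divr_gt0.
have [n [c [B [mB fB]]]] := simple_approx bf eCD.
pose s x := \sum_(k < n) c k * \1_(B k) x.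
have bs : bmf s by apply: bmf_sum => k; apply: bmfZ; exact: bmf_indic.
have FGs : F s = G s.
  by rewrite (linS _ bF)// (linS _ bG)//; apply: eq_bigr => k _; rewrite FG.
have bfs : bmf (fun x => (-1) * s x + f x) by auto.
have fs x : `|(-1) * s x + f x| <= e / CD by rewrite mulN1r addrC.
have -> : F f - G f = F (fun x => (-1) * s x + f x) - G (fun x => (-1) * s x + f x).
  by rewrite bF.1// bG.1// FGs; ring.
apply: le_trans (ler_normB _ _) _.
have := FC _ _ bfs fs; have := GD _ _ bfs fs.
set u := `|F _|; set v := `|G _| => hv hu.
have hu' : u <= `|C| * (e / CD).
  by rewrite (le_trans hu)// ler_wpM2r ?(ltW eCD)// ler_norm.
have hv' : v <= `|D| * (e / CD).
  by rewrite (le_trans hv)// ler_wpM2r ?(ltW eCD)// ler_norm.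
have -> : e = CD * (e / CD) by field; rewrite gt_eqF.
by move: eCD hu' hv'; rewrite /CD; set w := e / _; lra.
Qed.

End functionals.

Lemma prob_fin (R : realType) d (T : measurableType d) (m : probability T R) :
  ((m : {measure set T -> \bar R}) setT < +oo)%E.
Proof.
have -> : (m : {measure set T -> \bar R}) setT = 1%E := probability_setT m.
exact: ltry.
Qed.

Lemma kernel_fin (R : realType) d (T : measurableType d) d' (T' : measurableType d')
  (k : R.-pker T ~> T') x : (k x setT < +oo)%E.
Proof. by rewrite prob_kernel ltry. Qed.

Hint Resolve prob_fin kernel_fin : core.

(** * Image measures, kernels and Fubini's theorem for bounded functions *)

Section integral_maps.
Context (R : realType) d (T : measurableType d) d' (T' : measurableType d').

Lemma int_eq_measure (m1 m2 : {measure set T -> \bar R}) (f : T -> R) :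
  (forall B, measurable B -> m1 B = m2 B) ->
  \int[m1]_x f x = \int[m2]_x f x.
Proof.
by move=> m12; congr fine; apply: eq_measure_integral => B mB _; exact: m12.
Qed.

(** The image measure [m'] is a separate argument, known through its values, so that it can be [m]
    itself when the map preserves [m]. *)
Lemma int_pushforward (m : {measure set T -> \bar R}) (phi : T -> T')
  (m' : {measure set T' -> \bar R}) (f : T' -> R) :
  (m setT < +oo)%E -> measurable_fun [set: T] phi ->
  (forall B, measurable B -> m' B = m (phi @^-1` B)) -> bmf f ->
  \int[m']_y f y = \int[m]_x f (phi x).
Proof.
move=> mfin mphi mm' bf.
have m'fin : (m' setT < +oo)%E by rewrite mm'// preimage_setT.
have bphi (g : T' -> R) : bmf g -> bmf (fun x => g (phi x)) by move=> /(bmf_comp mphi).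
apply: (blf_ext (F := fun g => \int[m']_y g y)
  (G := fun g => \int[m]_x g (phi x))) bf; first exact: blf_int1.
- have [l [C b]] := blf_int1 mfin; split=> [a g h bg bh|].
    by rewrite (l _ _ _ (bphi _ bg) (bphi _ bh)).
  by exists C => g M bg gM; apply: b => //; exact: bphi.
- move=> B mB; rewrite int_indic// mm'// -int_indic//.
  by rewrite -[phi @^-1` B]setTI; exact: mphi.
Qed.

Lemma bmf_kernel (k : R.-pker T ~> T') (f : T' -> R) : bmf f ->
  bmf (fun x => \int[k x]_y f y).
Proof.
move=> [mf [M fM]]; have bf : bmf f by split => //; exists M.
have kfin x : (k x setT < +oo)%E by rewrite prob_kernel ltry.
split; last first.
  by exists M => x; have := int_norm_le (kfin x) bf fM; rewrite prob_kernel mulr1.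
(* Adding the bound M makes the integrand nonnegative; as the kernel has mass one, M is subtracted
   again afterwards. *)
have mg : measurable_fun [set: T] (fun x => \int[k x]_y (f y + M)%:E)%E.
  apply: measurable_fun_integral_kernel => //.
  - by move=> U mU; exact: measurable_kernel.
  - by move=> z; rewrite lee_fin -lerBlDr sub0r; have := fM z;
      rewrite ler_norml => /andP[].
  - by apply/measurable_EFinP; exact: measurable_funD.
rewrite (_ : (fun x => _) = (fun x => fine (\int[k x]_y (f y + M)%:E)%E - M)).
  by apply: measurable_funB => //; exact: (measurableT_comp (@fine_measurable R _ measurableT)).
apply/funext => x; rewrite -/(Rintegral _ _ _).
have -> : \int[k x]_y (f y + M) = \int[k x]_y f y + \int[k x]_y M by rewrite intD.
by rewrite int_cst prob_kernel mulr1 addrK.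
Qed.

Section fubini_bmf.
Variables (m : probability T R) (m' : probability T' R).
Variable F : T * T' -> R.
Hypothesis bF : bmf F.

Let mfin : (m setT < +oo)%E. Proof. by rewrite probability_setT ltry. Qed.
Let mfin' : (m' setT < +oo)%E. Proof. by rewrite probability_setT ltry. Qed.

Lemma prod_prob_setT : (m \x m')%E setT = 1%E.
Proof.
have -> : (m \x m')%E setT = (m setT * m' setT)%E.
  by rewrite -setXTT product_measure1E.
by rewrite (probability_setT m) (probability_setT m') mule1.
Qed.

Let mmfin : ((m \x m')%E setT < +oo)%E. Proof. by rewrite prod_prob_setT ltry. Qed.

Let iF : (m \x m')%E.-integrable setT (EFin \o F).
Proof. exact: bmf_integrable. Qed.

Lemma bmf_xsec x : bmf (fun y => F (x, y)).
Proof.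
apply: (bmf_comp (phi := fun y => (x, y))) bF.
exact: measurable_pair1.
Qed.

Lemma bmf_ysec y : bmf (fun x => F (x, y)).
Proof.
apply: (bmf_comp (phi := fun x => (x, y))) bF.
exact: measurable_pair2.
Qed.

Lemma bmf_fubini1 : bmf (fun x => \int[m']_y F (x, y)).
Proof.
have [_ [M FM]] := bF; split; last first.
  exists M => x; apply: int_norm_le1 => //; last exact: bmf_xsec.
  exact: probability_setT.
apply: (measurableT_comp (@fine_measurable R _ measurableT)).
exact: (measurable_fubini_F iF).
Qed.

Lemma int_fubini1 : \int[m]_x \int[m']_y F (x, y) = \int[(m \x m')%E]_z F z.
Proof.
rewrite {3}/Rintegral -(integral12_prod_meas1 iF); congr fine.
by apply: eq_integral => x _; rewrite int_fineK//; exact: bmf_xsec.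
Qed.

Lemma int_fubini2 : \int[m']_y \int[m]_x F (x, y) = \int[(m \x m')%E]_z F z.
Proof.
rewrite {3}/Rintegral -(integral21_prod_meas1 iF); congr fine.
by apply: eq_integral => x _; rewrite int_fineK//; exact: bmf_ysec.
Qed.

End fubini_bmf.

(** A Dirac mass at [point] serves as the measure on the first factor. *)
Lemma bmf_fubini (m' : probability T' R) (F : T * T' -> R) :
  bmf F -> bmf (fun x => \int[m']_y F (x, y)).
Proof. exact: (bmf_fubini1 (dirac point) m'). Qed.

End integral_maps.

(** * Product spaces *)

Section product_space.
Context (R : realType) (I : choiceType) d (T : measurableType d).
Local Notation X := (@prod_space I d T).

Lemma measurable_coord (i : I) : measurable_fun [set: X] (fun x : X => x i).
Proof.
move=> _ B mB; rewrite setTI; apply: sub_sigma_algebra.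
by exists i, B.
Qed.

Lemma measurable_coords d' (Y : measurableType d') (g : Y -> X) :
  (forall i, measurable_fun [set: Y] (fun y => g y i)) ->
  measurable_fun [set: Y] g.
Proof.
move=> mg; apply: (@measurability _ _ Y X setT g (@cylinders I d T) erefl).
move=> _ [_ [i [B [mB ->]]] <-].
by have := mg i measurableT B mB.
Qed.

Definition rect (A : {fset I}) (B : I -> set T) : set X :=
  [set x | forall i, i \in A -> B i (x i)].

Lemma measurable_rect A B : (forall i, measurable (B i)) -> measurable (rect A B).
Proof.
move=> mB; rewrite (_ : rect A B = \bigcap_(i in [set` A]) [set x : X | B i (x i)]).
  apply: fin_bigcap_measurable => // i _.
  by have := measurable_coord i measurableT (mB i); rewrite setTI.
by apply/seteqP; split=> x /=.
Qed.

Definition rects : set (set X) :=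
  [set C | exists A B, (forall i, measurable (B i)) /\ C = rect A B].

Lemma rects_setI : setI_closed rects.
Proof.
move=> _ _ [A [B [mB ->]]] [A' [B' [mB' ->]]].
exists (A `|` A')%fset,
  (fun i => (if i \in A then B i else setT) `&` (if i \in A' then B' i else setT)).
split.
  by move=> i; apply: measurableI; case: ifP.
apply/seteqP; split=> x /=.
  move=> [xB xB'] i _; split; case: ifP => // iA; [exact: xB|exact: xB'].
move=> h; split=> i iA.
  by have := h i; rewrite inE iA/= => /(_ isT)[].
by have := h i; rewrite inE iA orbT => /(_ isT)[].
Qed.

Lemma rects_generate : measurable = <<s rects >> :> set (set X).
Proof.
apply/seteqP; split.
  apply: smallest_sub; first exact: smallest_sigma_algebra.
  move=> _ [i [B [mB ->]]]; apply: sub_sigma_algebra.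
  exists [fset i]%fset, (fun=> B); split => //.
  apply/seteqP; split=> x /= => [Bx j|]; first by rewrite inE => /eqP ->.
  by apply; rewrite inE.
apply: smallest_sub; first exact: sigma_algebra_measurable.
by move=> _ [A [B [mB ->]]]; exact: measurable_rect.
Qed.

Lemma rectT : rects setT.
Proof.
exists fset0, (fun=> setT); split=> //.
by apply/seteqP; split=> x.
Qed.

(** Rectangles over finitely many coordinates are stable under intersection, generate the
    sigma-algebra and include the whole space. *)
Lemma prod_measure_unique (m1 m2 : {measure set X -> \bar R}) :
  (m1 setT < +oo)%E ->
  (forall A B, (forall i, measurable (B i)) -> m1 (rect A B) = m2 (rect A B)) ->
  forall C, measurable C -> m1 C = m2 C.
Proof.
move=> m1fin m12 C mC.
apply: (measure_unique rects (fun=> setT)) => //.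
- exact: rects_generate.
- exact: rects_setI.
- by move=> _; exact: rectT.
- by rewrite bigcup_const.
- by move=> _ [A [B [mB ->]]]; exact: m12.
Qed.

End product_space.

(** * Density of cylinder functions in mean square *)

Section rect_approximation.
Context (R : realType) (I : choiceType) d (T : measurableType d).
Local Notation X := (@prod_space I d T).
Variables (m : probability X R) (V : (X -> R) -> Prop).
Hypothesis V_rect : forall A B, (forall i, measurable (B i)) -> V \1_(rect A B).
Hypothesis V_lin : forall (c : R) f g, bmf f -> bmf g -> V f -> V g ->
  V (fun x => c * f x + g x).
Hypothesis V_closed : forall f, bmf f ->
  (forall e : R, 0 < e -> exists g, [/\ bmf g, V g & \int[m]_x ((f x - g x) ^+ 2) <= e]) ->
  V f.

Let V1 : V (fun=> 1).
Proof.
have := @V_rect fset0 (fun=> setT) (fun=> measurableT).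
rewrite (_ : rect _ _ = setT) ?indicT//.
by apply/seteqP; split.
Qed.

Let V0 : V (fun=> 0).
Proof.
rewrite (_ : (fun=> 0) = (fun x => (-1) * (fun=> 1) x + (fun=> 1) x)); first exact: V_lin.
by apply/funext => x; rewrite mulr1 addNr.
Qed.

Let V_sum (F : nat -> X -> R) (n : nat) : (forall k, bmf (F k)) ->
  (forall k, V (F k)) -> V (fun x => \sum_(k < n) F k x).
Proof.
move=> bF VF; elim: n => [|n IH].
  rewrite (_ : (fun x => _) = (fun=> 0))//.
  by apply/funext => x; rewrite big_ord0.
rewrite (_ : (fun x => _) = (fun x => 1 * F n x + \sum_(k < n) F k x)).
  by apply: V_lin => //; exact: bmf_sum.
by apply/funext => x; rewrite big_ord_recr/= mul1r addrC.
Qed.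

(** The difference is the indicator of the tail of the disjoint union, hence its own square:
    countable additivity becomes convergence in mean square. *)
Lemma partial_union_sqr (F : nat -> set X) N x : trivIset setT F ->
  (\1_(\bigcup_n F n) x - \sum_(n < N) \1_(F n) x) ^+ 2 =
  \1_(\bigcup_n F n) x - \sum_(n < N) \1_(F n) x :> R.
Proof.
move=> tF; rewrite [\1__ x]indicE; have [/set_mem [n _ Fnx]|nF] := boolP (x \in _).
  have E k : \1_(F k) x = (k == n)%:R :> R.
    rewrite indicE; congr (nat_of_bool _)%:R; apply/idP/eqP => [/set_mem Fkx|->].
      by apply: contrapT => /eqP kn; move/trivIsetP : tF => /(_ k n Logic.I Logic.I kn);
        apply/eqP/set0P; exists x.
    exact: mem_set.
  under eq_bigr do rewrite E.
  case: (ltnP n N) => nN.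
    rewrite (bigD1 (Ordinal nN))//= eqxx big1 ?addr0 ?subrr ?expr0n//.
    by move=> k; rewrite -val_eqE/= => /negbTE ->.
  rewrite big1 ?subr0 ?expr1n// => k _.
  by rewrite (_ : _ == _ = false)//; apply/negbTE; rewrite neq_ltn (leq_trans _ nN).
rewrite big1 ?subrr ?expr0n// => k _; rewrite indicE (_ : _ \in _ = false)//.
apply/negbTE; apply: contra nF => /set_mem Fkx; apply: mem_set.
by exists k.
Qed.

(** Dynkin's argument: complements come from linearity, disjoint unions from mean-square closure. *)
Let V_indic (B : set X) : measurable B -> V \1_B.
Proof.
rewrite rects_generate -setI_closed_g_dynkin_g_sigma_algebra; last exact: rects_setI.
pose H := [set B : set X | measurable B /\ V \1_B].
suff /(_ B) HB : <<d @rects I _ T >> `<=` H by move=> /HB[].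
apply: smallest_sub; last first.
  by move=> _ [A [C [mC ->]]]; split; [exact: measurable_rect|exact: V_rect].
split.
- by split=> //; rewrite indicT.
- move=> C [mC VC]; split; first exact: measurableC.
  rewrite (_ : \1_(~` C) = (fun x => (-1) * \1_C x + (fun=> 1) x)); first by apply: V_lin; auto.
  apply/funext => x; rewrite !indicE in_setC mulN1r.
  by case: (x \in C); rewrite ?addNr ?oppr0 ?add0r.
- move=> F tF HF; have mF n : measurable (F n) by have [] := HF n.
  have mU : measurable (\bigcup_n F n) by exact: bigcupT_measurable.
  split=> //; apply: V_closed => [|e e0]; first exact: bmf_indic.
  have fF n : m (F n) \is a fin_num by exact: fin_num_measure.
  have : (\sum_(0 <= k < n) m (F k))%E @[n --> \oo] --> (fine (m (\bigcup_n F n)))%:E.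
    rewrite fineK; last exact: (fin_num_measure m _ mU).
    exact: (@measure_semi_sigma_additive _ _ _ m F mF tF mU).
  move=> /fine_cvg /cvgrPdist_le /(_ e e0)[N _ /(_ N (leqnn _))] /= hN.
  have bU : bmf (\1_(\bigcup_n F n) : X -> R) by exact: bmf_indic.
  have bF n : bmf (\1_(F n) : X -> R) by exact: bmf_indic.
  exists (fun x => \sum_(n < N) \1_(F n) x); split.
  + exact: bmf_sum.
  + by apply: (V_sum (F := fun n => \1_(F n))) => // n; have [] := HF n.
  under eq_Rintegral do rewrite (partial_union_sqr _ _ tF).
  rewrite intB//; last exact: bmf_sum.
  rewrite int_sum// int_indic//.
  under eq_bigr do rewrite int_indic//.
  apply: le_trans (ler_norm _) _; apply: le_trans hN.
  rewrite le_eqVlt; apply/orP; left; apply/eqP; congr (`|_ - _|).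
  by rewrite big_mkord sum_fine// => k _; exact: fF.
Qed.

(** An induction principle for bounded functions. The predicate V is abstract because it is used
    twice: for approximation by local functions, and for asymptotic decorrelation along a path. *)
Lemma rect_approximation f : bmf f -> V f.
Proof.
move=> bf; apply: V_closed => // e e0.
(* An error below both 1 and e has a square below e. *)
have e1 : 0 < Num.min 1 e by rewrite lt_min ltr01.
have [n [c [B [mB fB]]]] := simple_approx bf e1.
have bk k : bmf (fun x => c k * \1_(B k) x) by apply: bmfZ; exact: bmf_indic.
exists (fun x => \sum_(k < n) c k * \1_(B k) x); split.
- exact: bmf_sum.
- apply: (V_sum (F := fun k x => c k * \1_(B k) x)) => // k.
  rewrite (_ : (fun x => _) = (fun x => c k * \1_(B k) x + (fun=> 0) x)).
    by apply: V_lin => //; [exact: bmf_indic|exact: V_indic].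
  by apply/funext => x; rewrite addr0.
- apply: (@le_trans _ _ (\int[m]_x e)).
    apply: int_le => //; first by apply: bmfX; apply: bmfB => //; exact: bmf_sum.
    move=> x; have := fB x; rewrite le_min => /andP[h1 h2].
    by rewrite -real_normK ?num_real// (le_trans _ h2)// expr2 ler_piMr.
  by rewrite int_cst1//; exact: (probability_setT m).
Qed.

End rect_approximation.

(** * The Gamma distribution and the exchange mechanism *)

Section measures.
Context (R : realType) d (T : measurableType d) d' (T' : measurableType d').

(** Stated as an existence so that later arguments see only the values of the measure; restrictions,
    mixtures and densities are treated likewise. *)
Lemma pushforward_exists (m : {measure set T -> \bar R}) (phi : T -> T') :
  measurable_fun [set: T] phi ->
  exists m' : {measure set T' -> \bar R}, forall B, m' B = m (phi @^-1` B).
Proof.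
move=> mphi.
by exists (measure_function_pushforward__canonical__measure_function_Measure m mphi).
Qed.

Lemma restr_exists (m : {measure set T -> \bar R}) (N : set T) : measurable N ->
  exists m' : {measure set T -> \bar R}, forall B, m' B = m (B `&` N).
Proof. by move=> mN; exists (mrestr m mN). Qed.

(** As a functional of g the right-hand side is bounded by the mass of rho on D times the supremum
    of g; on indicators the claim is the hypothesis on m. *)
Lemma int_density (la : {measure set T -> \bar R}) (m : {measure set T -> \bar R})
    (D : set T) (rho g : T -> R) :
  measurable D -> measurable_fun [set: T] rho -> (forall x, D x -> 0 <= rho x) ->
  (m setT < +oo)%E ->
  (forall B, measurable B -> m B = \int[la]_(x in B `&` D) (rho x)%:E)%E ->
  bmf g -> \int[m]_x g x = \int[la]_(x in D) (g x * rho x).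
Proof.
move=> mD mrho rho0 mfin mE bg.
have irho : la.-integrable D (EFin \o rho).
  apply/integrableP; split; first by apply/measurable_EFinP; exact: measurable_funTS.
  rewrite (eq_integral (fun x => (rho x)%:E)).
    by have := mE setT measurableT; rewrite setTI => <-.
  by move=> x /[!inE] Dx /=; rewrite ger0_norm// rho0.
have igrho h : bmf h -> la.-integrable D (EFin \o (fun x => h x * rho x)).
  move=> [mh [M hM]]; apply: (@le_integrable _ _ _ _ _ mD _ (fun x => (M * rho x)%:E)).
  - by apply/measurable_EFinP; apply: measurable_funTS; exact: measurable_funM.
  - move=> x Dx /=; rewrite lee_fin normrM [leRHS]normrM ler_wpM2r//.
    by rewrite (le_trans (hM x))// ler_norm.
  - rewrite (_ : (fun x => _) = (fun x => M%:E * (rho x)%:E)%E)//.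
    exact: integrableZl.
apply: (blf_ext (F := fun g => \int[m]_x g x)
  (G := fun g => \int[la]_(x in D) (g x * rho x))) bg; first exact: blf_int1.
- split=> [a f h bf bh|].
    rewrite -RintegralZl//; last exact: igrho.
    rewrite -RintegralD//; [| |exact: igrho].
      by apply: eq_Rintegral => x _; ring.
    rewrite (_ : _ \o _ = EFin \o (fun x => a * f x * rho x)).
      exact: (igrho _ (bmfZ a bf)).
    by apply/funext => x /=; rewrite mulrA.
  exists (\int[la]_(x in D) rho x) => f M bf fM.
  apply: le_trans (le_normr_Rintegral mD (igrho _ bf)) _.
  rewrite mulrC -RintegralZl//; apply: le_Rintegral => //.
  + apply: (@le_integrable _ _ _ _ _ mD _ _ _ _ (igrho _ bf)).
      apply/measurable_EFinP; apply: measurable_funTS; apply: measurableT_comp => //.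
      by apply: measurable_funM => //; exact: bf.1.
    by move=> x Dx; rewrite /= normr_id.
  + rewrite (_ : _ \o _ = (fun x => M%:E * (rho x)%:E)%E)//.
    exact: integrableZl.
  + by move=> x Dx; rewrite normrM (ger0_norm (rho0 _ Dx)) ler_wpM2r// rho0.
- move=> B mB; rewrite int_indic// mE//; congr fine.
  rewrite setIC integral_mkcondr; apply: eq_integral => x _.
  by rewrite patchE indicE; case: (x \in B); rewrite ?mul1r ?mul0r.
Qed.

End measures.

Section gamma.
Context (R : realType).
Local Notation RR := (measurableTypeR R).
Local Notation la := (@lebesgue_measure R).

(** Lebesgue measure is |a| times its image under x -> a x + c, as seen on half-open intervals. The
    three uses are the reflection 1 - u, the translation a - w and the scaling w = a u. *)
Lemma ge0_integral_affine (a c : R) (f : RR -> \bar R) : a != 0 ->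
  measurable_fun [set: RR] f -> (forall x, 0 <= f x)%E ->
  (\int[la]_x f x = `|a|%:E * \int[la]_x f (a * x + c)%R)%E.
Proof.
move=> a0 mf f0.
pose phi (x : RR) : RR := a * x + c.
have mphi : measurable_fun [set: RR] phi.
  by apply: measurable_funD => //; exact: measurable_funM.
have [m mE0] := pushforward_exists la mphi.
have mE B : m B = la (phi @^-1` B) := mE0 B.
pose ap : {nonneg R} := NngNum (normr_ge0 a).
have laE B : measurable B -> la B = mscale ap m B.
  apply: lebesgue_measure_unique => _ [[s t] /= st <-].
  rewrite /mscale /= mE.
  case: (ltrgtP a 0) a0 => // a0 _.
    have -> : phi @^-1` `]s, t] = `[(t - c) / a, (s - c) / a[%classic.
      apply/seteqP; split=> x /=; rewrite /phi !in_itv/= ltr_ndivlMr// ler_ndivrMr//;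
        by rewrite ltrBlDr lerBrDr mulrC andbC.
    rewrite !lebesgue_measure_itv/= !lte_fin ltr_nM2r ?invr_lt0// ltrD2r.
    case: ifPn => _; last by rewrite mule0.
    rewrite -!EFinB -EFinM ltr0_norm//; congr (_%:E); field.
    by rewrite lt_eqF.
  have -> : phi @^-1` `]s, t] = `](s - c) / a, (t - c) / a]%classic.
    apply/seteqP; split=> x /=; rewrite /phi !in_itv/= ltr_pdivrMr// ler_pdivlMr//;
      by rewrite ltrBlDr lerBrDr mulrC.
  rewrite !lebesgue_measure_itv/= !lte_fin ltr_pM2r ?invr_gt0// ltrD2r.
  case: ifPn => _; last by rewrite mule0.
  by rewrite -!EFinB -EFinM gtr0_norm//; congr (_%:E); field; rewrite gt_eqF.
rewrite (eq_measure_integral (mscale ap m)); last by move=> B mB _; exact: laE.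
rewrite ge0_integral_mscale//=; congr (_ * _)%E.
transitivity (\int[pushforward la phi]_x f x)%E.
  by apply: eq_measure_integral => B mB _; rewrite mE.
by rewrite ge0_integral_pushforward.
Qed.

Variable theta : R.
Hypothesis theta0 : 0 < theta.

Definition unif : probability RR R := uniform_prob (@ltr01 R).

Lemma integral_unif (f : RR -> \bar R) :
  measurable_fun [set: RR] f -> (forall x, 0 <= f x)%E ->
  (\int[unif]_x f x = \int[la]_(x in `[0%R, 1%R]) f x)%E.
Proof.
move=> mf f0; rewrite [LHS](integral_uniform (@ltr01 R) mf f0).
by rewrite subr0 invr1 mul1e.
Qed.

Lemma int_unif_reflect (g : RR -> R) : bmf g ->
  \int[unif]_u g (1 - u) = \int[unif]_u g u.
Proof.
have mr : measurable_fun [set: RR] (fun u : RR => 1 - u : RR) by exact: measurable_funB.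
move=> bg; rewrite -[LHS](int_pushforward (m' := unif) _ mr _ bg)// => B mB.
have mB' : measurable ((fun u : RR => 1 - u : RR) @^-1` B).
  by rewrite -[_ @^-1` _]setTI; exact: mr.
have unifE C : measurable C -> (unif C = \int[la]_u (\1_(C `&` `[0%R, 1%R]) u)%:E)%E.
  move=> mC; transitivity (\int[unif]_u (\1_C u)%:E)%E.
    by rewrite integral_indic// setIT.
  rewrite integral_unif//.
    rewrite [LHS]integral_mkcond; apply: eq_integral => u _.
    by rewrite patchE indicI/= !indicE; case: (u \in `[0, 1]%classic); rewrite ?mulr1 ?mulr0.
  by apply/measurable_EFinP; exact: measurable_indic.
rewrite [LHS](unifE _ mB) [RHS](unifE _ mB').
rewrite (ge0_integral_affine 1 (a := -1)) ?oppr_eq0 ?oner_eq0//.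
- rewrite normrN1 mul1e; apply: eq_integral => u _; congr (_%:E).
  rewrite !indicI/= !indicE; congr (_ * _); congr (nat_of_bool _)%:R.
    by rewrite mulN1r addrC; apply/idP/idP => /set_mem uB; exact: mem_set.
  rewrite !mem_setE !in_itv/= mulN1r addrC; lra.
- by apply/measurable_EFinP; apply: measurable_indic; exact: measurableI.
Qed.

Let rate0 : 0 < theta^-1. Proof. by rewrite invr_gt0. Qed.

Lemma exponential_exists : exists eta : probability RR R, forall B,
  eta B = (\int[la]_(x in B) (exponential_pdf theta^-1 x)%:E)%E.
Proof.
by exists (exponential_distribution_exponential_prob__canonical__probability_measure_Probability rate0).
Qed.

(** Substitute w = a u. The factor a of the Gamma density is the Jacobian, and theta^-2 e^(-a/theta)
    is the product of the exponential densities at a - w and w; both are nonzero only for 0 <= w <=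
    a. *)
Lemma gamma_split (ga eta : probability RR R) (B1 B2 : set RR) :
  (forall B, measurable B -> ga B = nu theta B) ->
  (forall B, eta B = (\int[la]_(x in B) (exponential_pdf theta^-1 x)%:E)%E) ->
  measurable B1 -> measurable B2 ->
  \int[ga]_a \int[unif]_u (\1_B1 (a * (1 - u)) * \1_B2 (a * u)) =
  fine (eta B1) * fine (eta B2).
Proof.
move=> gaE etaE mB1 mB2.
pose h (B : set RR) x : R := \1_B x * exponential_pdf theta^-1 x.
have mpdf : measurable_fun [set: RR] (exponential_pdf theta^-1).
  exact: measurable_exponential_pdf.
have mh B : measurable B -> measurable_fun [set: RR] (h B).
  by move=> mB; apply: measurable_funM => //; exact: measurable_indic.
have h0 B x : 0 <= h B x by rewrite mulr_ge0// exponential_pdf_ge0// ltW.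
have hE B : measurable B -> (\int[la]_x (h B x)%:E = eta B)%E.
  move=> mB; rewrite etaE [RHS]integral_mkcond; apply: eq_integral => x _.
  by rewrite patchE /h indicE; case: (x \in B); rewrite ?mul1r ?mul0r.
(* Joint density in the coordinates (a, w). Its integral factors by Tonelli, integrating a first for
   fixed w; integrating w first for fixed a gives [psi a * rho a]. *)
pose G (aw : RR * RR) := ((h B1 (aw.1 - aw.2)) * h B2 aw.2)%:E.
have mG : measurable_fun [set: RR * RR] G.
  apply/measurable_EFinP; apply: measurable_funM.
    apply: (measurableT_comp (mh _ mB1)).
    by apply: measurable_funB; [exact: measurable_fst|exact: measurable_snd].
  exact: (measurableT_comp (mh _ mB2) measurable_snd).
have G0 aw : (0 <= G aw)%E by rewrite lee_fin mulr_ge0.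
have tonelli : (\int[la]_a \int[la]_w G (a, w) = eta B1 * eta B2)%E.
  have inner w : (\int[la]_a G (a, w) = (h B2 w)%:E * eta B1)%E.
    transitivity (\int[la]_a ((h B2 w)%:E * (h B1 (1 * a - w))%:E))%E.
      by apply: eq_integral => a _; rewrite /G /= mulrC EFinM mul1r.
    rewrite ge0_integralZl//; last 3 first.
    - apply/measurable_EFinP; apply: (measurableT_comp (mh _ mB1)).
      by apply: measurable_funB => //; exact: measurable_funM.
    - by move=> a _; rewrite lee_fin.
    - by rewrite lee_fin.
    have mhE : measurable_fun [set: RR] (fun x => (h B1 x)%:E).
      by apply/measurable_EFinP; exact: mh.
    have hE0 x : (0 <= (h B1 x)%:E)%E by rewrite lee_fin.
    have := ge0_integral_affine (- w) (oner_neq0 _) mhE hE0.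
    by rewrite normr1 mul1e hE// => <-.
  transitivity (\int[la]_w \int[la]_a G (a, w))%E.
    by apply: fubini_tonelli.
  transitivity (\int[la]_w ((h B2 w)%:E * eta B1))%E.
    by apply: eq_integral => w _; exact: inner.
  rewrite ge0_integralZr//; last 2 first.
  - by apply/measurable_EFinP; exact: mh.
  - by move=> x _; rewrite lee_fin.
  by rewrite hE// muleC.
pose psi (a : RR) := \int[unif]_u (\1_B1 (a * (1 - u)) * \1_B2 (a * u)).
have bpsi : bmf psi.
  apply: (bmf_fubini1 ga unif
    (F := fun au : RR * RR => \1_B1 (au.1 * (1 - au.2)) * \1_B2 (au.1 * au.2))).
  apply: bmfM.
    apply: (bmf_comp (phi := fun au : RR * RR => au.1 * (1 - au.2))); last exact: bmf_indic.
    by apply: measurable_funM => //; exact: measurable_funB.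
  apply: (bmf_comp (phi := fun au : RR * RR => au.1 * au.2)); last exact: bmf_indic.
  exact: measurable_funM.
pose rho (z : RR) : R := theta ^- 2 * z * expR (- z / theta).
have mrho : measurable_fun [set: RR] rho.
  apply: measurable_funM; first exact: measurable_funM.
  by apply: measurableT_comp => //; apply: measurable_funM.
have rho0 (z : RR) : `[0, +oo[%classic z -> 0 <= rho z.
  rewrite /= in_itv/= andbT => z0.
  by rewrite !mulr_ge0 ?expR_ge0// invr_ge0 exprn_ge0// ltW.
have pdfE (z : R) : exponential_pdf theta^-1 z =
    if 0 <= z then theta^-1 * expR (- z / theta) else 0.
  rewrite /exponential_pdf patchE mem_setE in_itv/= andbT; case: ifP => // _.
  by congr (_ * expR _); ring.
rewrite (int_density (la := la) (D := `[0, +oo[%classic) _ mrho rho0 _ gaE bpsi)//.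
suff -> : \int[la]_(x in `[0, +oo[%classic) (psi x * rho x) =
    fine (\int[la]_a \int[la]_w G (a, w))%E.
  by rewrite tonelli fineM// fin_num_measure.
rewrite Rintegral_mkcond; congr fine; apply: eq_integral => a _.
rewrite patchE mem_setE in_itv/= andbT.
case: (ltrgtP a 0) => [a0|a0|->].
- rewrite integral0_eq// => w _; rewrite /G /h/= !pdfE.
  case: (leP 0 w) => w0; last by rewrite !mulr0.
  by rewrite leNgt (_ : a - w < 0) ?mulr0 ?mul0r//; lra.
- have mGa : measurable_fun [set: RR] (fun w => G (a, w)).
    by apply: (measurableT_comp mG); exact: measurable_pair1.
  have Ga0 w : (0 <= G (a, w))%E by exact: G0.
  have a0' : a != 0 by rewrite gt_eqF.
  rewrite (ge0_integral_affine 0 a0' mGa Ga0) gtr0_norm//.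
  pose F (u : RR) : R := \1_B1 (a * (1 - u)) * \1_B2 (a * u).
  have bF : bmf F.
    apply: bmfM.
      apply: (bmf_comp (phi := fun u : RR => a * (1 - u))); last exact: bmf_indic.
      by apply: measurable_funM => //; exact: measurable_funB.
    apply: (bmf_comp (phi := fun u : RR => a * u)); last exact: bmf_indic.
    exact: measurable_funM.
  have psiE : ((psi a)%:E = \int[la]_(u in `[0%R, 1%R]) (F u)%:E)%E.
    rewrite int_fineK//.
    apply: integral_unif; first by apply/measurable_EFinP; exact: bF.1.
    by move=> u; rewrite lee_fin mulr_ge0.
  rewrite mulrC EFinM psiE /rho (mulrC (theta ^- 2)) -mulrA EFinM -muleA.
  congr (_ * _)%E.
  rewrite -ge0_integralZl//; last 3 first.
  + by apply/measurable_EFinP; apply: measurable_funTS; exact: bF.1.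
  + by move=> u _; rewrite lee_fin mulr_ge0.
  + by rewrite lee_fin mulr_ge0 ?expR_ge0// invr_ge0 exprn_ge0// ltW.
  rewrite [LHS]integral_mkcond; apply: eq_integral => u _.
  rewrite patchE mem_setE in_itv/= /G /h/= !pdfE addr0.
  have -> : (0 <= a - a * u) = (u <= 1).
    by rewrite -[X in X - _]mulr1 -mulrBr pmulr_rge0// subr_ge0.
  rewrite pmulr_rge0//; case: (leP 0 u) => u0 /=; last by rewrite !mulr0.
  case: (leP u 1) => u1 /=; last by rewrite mulr0 mul0r.
  rewrite -EFinM; congr (_%:E); rewrite /F mulrBr mulr1.
  have -> : expR (- a / theta) = expR (- (a - a * u) / theta) * expR (- (a * u) / theta).
    by rewrite -expRD; congr expR; ring.
  by field; rewrite gt_eqF.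
(* At a = 0 the integrand in w is supported on the single point 0. *)
- rewrite /rho mulr0 mul0r mulr0.
  rewrite (_ : (fun w => G (0, w)) = (fun w => G (0, w)) \_ [set 0]).
    by rewrite -integral_mkcond integral_set1.
  apply/funext => w; rewrite patchE; case: ifPn => //.
  rewrite notin_setE/= /G /h/= !pdfE sub0r oppr_ge0 => w0.
  case: (ltrgtP w 0) => [_|_|//]; rewrite ?mulr0 ?mul0r//.
Qed.

Section exchange_law.
Variable ga : probability RR R.
Hypothesis gaE : forall B, measurable B -> ga B = nu theta B.

(* [eta] is the exponential distribution: [a * (1 - u)] and [a * u] are
   independent exponential variables when [a] is Gamma of shape 2 and [u]
   uniform. *)
Lemma gamma_split_law : exists eta : probability RR R,
  forall G : RR * RR -> R, bmf G ->
  \int[ga]_a \int[unif]_u G (a * (1 - u), a * u) =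
  \int[eta]_e \int[eta]_w G (e, w).
Proof.
have [eta etaE] := exponential_exists; exists eta => G bG.
pose phi (au : RR * RR) : RR * RR := (au.1 * (1 - au.2), au.1 * au.2).
have mphi : measurable_fun [set: RR * RR] phi.
  apply/measurable_fun_pair; last exact: measurable_funM.
  by apply: measurable_funM => //; exact: measurable_funB.
have bmf_phi (H : RR * RR -> R) : bmf H -> bmf (fun au => H (phi au)).
  by move=> bH; exact: bmf_comp mphi bH.
have [m mE] := pushforward_exists (ga \x unif)%E mphi.
have mmfin : ((ga \x unif)%E setT < +oo)%E.
  by rewrite (prod_prob_setT ga unif) ltry.
have mprod C : measurable C -> (eta \x eta)%E C = m C.
  apply: product_measure_unique => B1 B2 mB1 mB2.
  have := gamma_split gaE etaE mB1 mB2.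
  pose F (au : RR * RR) : R := \1_B1 (au.1 * (1 - au.2)) * \1_B2 (au.1 * au.2).
  have FE : F = \1_(phi @^-1` (B1 `*` B2)).
    apply/funext => au; rewrite /F !indicE -natrM mulnb; congr (nat_of_bool _)%:R.
    by apply/andP/idP => [[/[!inE]]//|/[!inE]-[/=]]; rewrite ?inE.
  have mphiB : measurable (phi @^-1` (B1 `*` B2)).
    by rewrite -[_ @^-1` _]setTI; apply: mphi => //; exact: measurableX.
  have bF : bmf F by rewrite FE; exact: bmf_indic.
  rewrite [X in X = _ -> _](int_fubini1 ga unif bF) FE int_indic// => h.
  have mf : m (B1 `*` B2) \is a fin_num.
    rewrite (ge0_fin_numE (measure_ge0 m _)).
    have : (m (B1 `*` B2) <= m setT)%E.
      by apply: le_measure; rewrite ?inE//; exact: measurableX.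
    by move/le_lt_trans; apply; rewrite mE.
  rewrite -(fineK mf) mE h EFinM !fineK//; exact: fin_num_measure.
rewrite (int_fubini1 eta eta bG) (int_eq_measure _ mprod).
rewrite (int_pushforward mmfin mphi (fun B _ => mE B) bG).
by rewrite -(int_fubini1 ga unif (bmf_phi _ bG)).
Qed.

(** The four pieces a(1-u), au, b(1-v), bv are independent exponential masses, and the new masses
    are sums over another pairing of them, hence again independent Gamma masses. *)
Lemma gamma_exchange (Bi Bj : set RR) : measurable Bi -> measurable Bj ->
  \int[ga]_a \int[ga]_b \int[unif]_u \int[unif]_v
    (\1_Bi (a * (1 - u) + b * v) * \1_Bj (b * (1 - v) + a * u)) =
  fine (ga Bi) * fine (ga Bj).
Proof.
move=> mBi mBj; have [eta split] := gamma_split_law.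
have bsum (B : set RR) : measurable B -> bmf (fun e : RR * RR => \1_B (e.1 + e.2) : R).
  move=> mB; apply: (bmf_comp (phi := fun e : RR * RR => e.1 + e.2)); last exact: bmf_indic.
  exact: measurable_funD.
have baff (B : set RR) (c : R) : measurable B -> bmf (fun e : RR => \1_B (c + e) : R).
  move=> mB; apply: (bmf_comp (phi := fun e : RR => c + e)); last exact: bmf_indic.
  exact: measurable_funD.
(* The probability that e1 plus an independent exponential mass falls in B; its exponential average
   is [ga B]. *)
pose A (B : set RR) e1 := \int[eta]_e3 (\1_B (e1 + e3) : R).
have bA B : measurable B -> bmf (A B).
  by move=> mB; apply: (bmf_fubini1 eta eta (bsum B mB)).
have IA B : measurable B -> \int[eta]_e A B e = fine (ga B).
  move=> mB; rewrite /A -(split _ (bsum B mB)) -int_indic//.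
  apply: eq_Rintegral => a _; rewrite -[RHS](int_cst1 (m := unif)); last exact: probability_setT.
  by apply: eq_Rintegral => u _; congr (\1_B _); rewrite /=; ring.
have step1 (s t : R) : \int[ga]_b \int[unif]_v (\1_Bi (s + b * v) * \1_Bj (b * (1 - v) + t)) =
    A Bi s * A Bj t.
  pose G (e : RR * RR) : R := \1_Bi (s + e.2) * \1_Bj (t + e.1).
  have bG : bmf G.
    apply: bmfM.
      exact: (bmf_comp measurable_snd (baff Bi s mBi)).
    exact: (bmf_comp measurable_fst (baff Bj t mBj)).
  transitivity (\int[ga]_b \int[unif]_v G (b * (1 - v), b * v)).
    apply: eq_Rintegral => b _; apply: eq_Rintegral => v _.
    by rewrite /G/= (addrC (b * (1 - v))).
  rewrite split// /G /= /A -intZ//; last exact: baff.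
  apply: eq_Rintegral => e _; rewrite mulrC -intZ//; last exact: baff.
  by apply: eq_Rintegral => w _; rewrite mulrC.
pose AA (e : RR * RR) := A Bi e.1 * A Bj e.2.
have bAA : bmf AA.
  apply: bmfM; first exact: (bmf_comp measurable_fst (bA Bi mBi)).
  exact: (bmf_comp measurable_snd (bA Bj mBj)).
transitivity (\int[ga]_a \int[unif]_u AA (a * (1 - u), a * u)); last first.
  rewrite split// -!IA// mulrC -intZ//; last exact: bA.
  by apply: eq_Rintegral => e _; rewrite mulrC -intZ//; exact: bA.
apply: eq_Rintegral => a _.
pose K (buv : (RR * RR) * RR) : R := \1_Bi (a * (1 - buv.1.2) + buv.1.1 * buv.2) *
  \1_Bj (buv.1.1 * (1 - buv.2) + a * buv.1.2).
have m11 : measurable_fun [set: (RR * RR) * RR] (fun z => z.1.1).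
  exact: (measurableT_comp measurable_fst measurable_fst).
have m12 : measurable_fun [set: (RR * RR) * RR] (fun z => z.1.2).
  exact: (measurableT_comp measurable_snd measurable_fst).
have bK : bmf K.
  apply: bmfM.
    apply: (bmf_comp (phi := fun buv : (RR * RR) * RR =>
      a * (1 - buv.1.2) + buv.1.1 * buv.2)); last exact: bmf_indic.
    apply: measurable_funD; apply: measurable_funM => //.
    exact: measurable_funB.
  apply: (bmf_comp (phi := fun buv : (RR * RR) * RR =>
    buv.1.1 * (1 - buv.2) + a * buv.1.2)); last exact: bmf_indic.
  apply: measurable_funD; apply: measurable_funM => //.
  exact: measurable_funB.
have bK1 : bmf (fun bu => \int[unif]_v K (bu, v)) by exact: bmf_fubini.
(* The integrals over b and u are interchanged, which puts b next to its cut point v as [step1]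
   requires. *)
rewrite [LHS](int_fubini1 ga unif bK1) -(int_fubini2 ga unif bK1).
apply: eq_Rintegral => u _; rewrite /AA /= -step1.
by apply: eq_Rintegral => b _; apply: eq_Rintegral => v _.
Qed.

End exchange_law.

End gamma.

(** * The product of Gamma distributions *)

Section config_maps.
Context (R : realType) (S : countType).
Local Notation RR := (measurableTypeR R).
Local Notation X := (config R S).
Implicit Types (i j k : S) (A C : {fset S}) (x y : X) (f g : X -> R).

Lemma measurable_site i : measurable_fun [set: X] (fun x : X => (x i : RR)).
Proof. exact: measurable_coord. Qed.

Definition transp i j k : S := if k == i then j else if k == j then i else k.

Lemma transpK i j : involutive (transp i j).
Proof.
move=> k; rewrite /transp; case: (eqVneq k i) => [->|ki].
  by rewrite eqxx; case: eqVneq.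
by case: (eqVneq k j) => [->|kj]; rewrite ?eqxx// (negbTE ki) (negbTE kj).
Qed.

Definition swap i j x : X := fun k => x (transp i j k).

Lemma measurable_swap i j : measurable_fun [set: X] (swap i j).
Proof. by apply: measurable_coords => k; exact: measurable_site. Qed.

Definition splice A x y : X := fun k => if k \in A then x k else y k.

Lemma measurable_splice A : measurable_fun [set: X * X] (fun z => splice A z.1 z.2).
Proof.
apply: measurable_coords => k; rewrite /splice; case: (k \in A).
  exact: (measurableT_comp (measurable_site k) measurable_fst).
exact: (measurableT_comp (measurable_site k) measurable_snd).
Qed.

Lemma measurable_exchange i j :
  measurable_fun [set: (X * RR) * RR] (fun z => exchange i j z.1.2 z.2 z.1.1).
Proof.
have m1 : measurable_fun [set: (X * RR) * RR] (fun z : (X * RR) * RR => z.1).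
  exact: measurable_fst.
have mx k : measurable_fun [set: (X * RR) * RR] (fun z => (z.1.1 k : RR)).
  have mk : measurable_fun [set: X * RR] (fun z : X * RR => (z.1 k : RR)).
    exact: (measurableT_comp (measurable_site k) measurable_fst).
  exact: (measurableT_comp mk m1).
have mu : measurable_fun [set: (X * RR) * RR] (fun z => (z.1.2 : RR)).
  have m2 : measurable_fun [set: X * RR] (fun z : X * RR => z.2) by exact: measurable_snd.
  exact: (measurableT_comp m2 m1).
have mv : measurable_fun [set: (X * RR) * RR] (fun z => (z.2 : RR)).
  exact: measurable_snd.
have m1u : measurable_fun [set: (X * RR) * RR] (fun z => (1 - z.1.2 : RR)).
  exact: measurable_funB.
have m1v : measurable_fun [set: (X * RR) * RR] (fun z => (1 - z.2 : RR)).
  exact: measurable_funB.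
apply: measurable_coords => k; rewrite /exchange.
case: (k == i); [|case: (k == j)]; last exact: mx.
- exact: (measurable_funD (measurable_funM (mx i) m1u) (measurable_funM (mx j) mv)).
- exact: (measurable_funD (measurable_funM (mx j) m1v) (measurable_funM (mx i) mu)).
Qed.

(** After the swap, site i receives x_j (1-u) + x_i v, which is the exchange of x with cuts 1-v at i
    and 1-u at j. *)
Lemma exchange_swap i j u v x :
  exchange i j u v (swap i j x) = exchange i j (1 - v) (1 - u) x.
Proof.
apply/funext => k; rewrite /exchange /swap /transp !eqxx.
case: (eqVneq k i) => [_|ki]; case: (eqVneq k j) => [_|kj] //; case: (eqVneq j i) => [->|ji];
  rewrite ?subKr//; by [ring|rewrite addrC].
Qed.

Definition local_on A f := forall x y, (forall i, i \in A -> x i = y i) -> f x = f y.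

Lemma local_on_sub A C f : (A `<=` C)%fset -> local_on A f -> local_on C f.
Proof. by move=> /fsubsetP AC lf x y xy; apply: lf => i /AC; exact: xy. Qed.

Definition exch i j f x : R :=
  \int[@unif R]_u \int[@unif R]_v f (exchange i j u v x).

Section exch_theory.
Variables (i j : S).

Lemma bmf_exchange f : bmf f ->
  bmf (fun z : (X * RR) * RR => f (exchange i j z.1.2 z.2 z.1.1)).
Proof. exact: bmf_comp (measurable_exchange i j). Qed.

Lemma bmf_exchange1 f : bmf f ->
  bmf (fun z : X * RR => \int[@unif R]_v f (exchange i j z.2 v z.1)).
Proof. by move=> bf; exact: (bmf_fubini _ (bmf_exchange bf)). Qed.

Lemma bmf_exch f : bmf f -> bmf (exch i j f).
Proof. by move=> bf; exact: (bmf_fubini _ (bmf_exchange1 bf)). Qed.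

Lemma bmf_exchange_v f u x : bmf f -> bmf (fun v : RR => f (exchange i j u v x)).
Proof. by move=> bf; exact: (bmf_xsec (bmf_exchange bf) (x, u)). Qed.

Lemma bmf_exchange_u f x : bmf f ->
  bmf (fun u : RR => \int[@unif R]_v f (exchange i j u v x)).
Proof. by move=> bf; exact: (bmf_xsec (bmf_exchange1 bf) x). Qed.

Lemma exchD f g x : bmf f -> bmf g ->
  exch i j (fun y => f y + g y) x = exch i j f x + exch i j g x.
Proof.
move=> bf bg; rewrite /exch -intD//; try exact: bmf_exchange_u.
by apply: eq_Rintegral => u _; rewrite -intD//; exact: bmf_exchange_v.
Qed.

Lemma exchZ c f x : bmf f -> exch i j (fun y => c * f y) x = c * exch i j f x.
Proof.
move=> bf; rewrite /exch -intZ//; last exact: bmf_exchange_u.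
by apply: eq_Rintegral => u _; rewrite -intZ//; exact: bmf_exchange_v.
Qed.

Lemma exch_cst c x : exch i j (fun=> c) x = c.
Proof.
rewrite /exch; transitivity (\int[@unif R]_u c).
  by apply: eq_Rintegral => u _; rewrite int_cst1//; exact: probability_setT.
by rewrite int_cst1//; exact: probability_setT.
Qed.

Lemma exch_ge0 f x : (forall y, 0 <= f y) -> 0 <= exch i j f x.
Proof. by move=> f0; apply: int_ge0 => u; exact: int_ge0. Qed.

Lemma exchB f g x : bmf f -> bmf g ->
  exch i j (fun y => f y - g y) x = exch i j f x - exch i j g x.
Proof.
move=> bf bg; have bNg : bmf (fun y => (-1) * g y) by exact: bmfZ.
have -> : (fun y => f y - g y) = (fun y => f y + (-1) * g y).
  by apply/funext => y; rewrite mulN1r.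
by rewrite (exchD x bf bNg) (exchZ (-1) x bg) mulN1r.
Qed.

Lemma exch_norm_le f M x : bmf f -> (forall y, `|f y| <= M) -> `|exch i j f x| <= M.
Proof.
move=> bf fM; apply: int_norm_le1 => //; [exact: probability_setT|exact: bmf_exchange_u|].
move=> u; apply: int_norm_le1 => //; [exact: probability_setT|exact: bmf_exchange_v].
Qed.

(** Jensen's inequality for the average over u and v, from the average of (f - c)^2 with c the
    mean. *)
Lemma exch_sqr_le f x : bmf f -> exch i j f x ^+ 2 <= exch i j (fun y => f y ^+ 2) x.
Proof.
move=> bf; set c := exch i j f x.
have : 0 <= exch i j (fun y => (f y - c) ^+ 2) x by apply: exch_ge0 => y; exact: sqr_ge0.
rewrite (_ : (fun y => _) = (fun y => (f y ^+ 2 + (- (2 * c)) * f y) + c ^+ 2)); last first.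
  by apply/funext => y; ring.
rewrite !exchD ?exchZ ?exch_cst; auto.
by rewrite -/c; lra.
Qed.

Lemma exch_local A f : i \in A -> j \in A -> local_on A f -> local_on A (exch i j f).
Proof.
move=> iA jA lf x y xy; apply: eq_Rintegral => u _; apply: eq_Rintegral => v _.
by apply: lf => k kA; rewrite /exchange !xy.
Qed.

Lemma exch_out A f x : i \notin A -> j \notin A -> local_on A f -> exch i j f x = f x.
Proof.
move=> iA jA lf; rewrite -[RHS](exch_cst (f x) x).
apply: eq_Rintegral => u _; apply: eq_Rintegral => v _.
apply: lf => k kA; rewrite /exchange.
have /negbTE -> : k != i by apply: contraNneq iA => <-.
by have /negbTE -> : k != j by apply: contraNneq jA => <-.
Qed.

(** The cuts become (1-v, 1-u); Fubini's theorem and two reflections of the uniform law restore (u,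
    v). This symmetry at every point is what turns E_ij f = f into invariance under a
    transposition. *)
Lemma exch_swap f x : bmf f -> exch i j f (swap i j x) = exch i j f x.
Proof.
move=> bf; rewrite /exch.
transitivity (\int[@unif R]_u \int[@unif R]_v f (exchange i j (1 - v) (1 - u) x)).
  by apply: eq_Rintegral => u _; apply: eq_Rintegral => v _; rewrite exchange_swap.
have bF : bmf (fun uv : RR * RR => f (exchange i j (1 - uv.2) (1 - uv.1) x)).
  apply: (bmf_comp (phi := fun uv : RR * RR =>
    exchange i j (1 - uv.2) (1 - uv.1) x)) bf.
  apply: (measurableT_comp (f := fun z => exchange i j z.1.2 z.2 z.1.1)
    (g := fun uv : RR * RR => ((x, 1 - uv.2 : RR), 1 - uv.1 : RR))).
    exact: measurable_exchange.
  apply/measurable_fun_pair; last exact: measurable_funB.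
  by apply/measurable_fun_pair => //; exact: measurable_funB.
rewrite (int_fubini1 _ _ bF) -(int_fubini2 _ _ bF).
rewrite (int_unif_reflect (g := fun v => \int[@unif R]_u f (exchange i j v (1 - u) x))).
  apply: eq_Rintegral => u _.
  by rewrite (int_unif_reflect (bmf_exchange_v u x bf)).
have bG : bmf (fun uv : RR * RR => f (exchange i j uv.1 (1 - uv.2) x)).
  apply: (bmf_comp (phi := fun uv : RR * RR => exchange i j uv.1 (1 - uv.2) x)) bf.
  apply: (measurableT_comp (f := fun z => exchange i j z.1.2 z.2 z.1.1)
    (g := fun uv : RR * RR => ((x, uv.1 : RR), 1 - uv.2 : RR))).
    exact: measurable_exchange.
  apply/measurable_fun_pair; last exact: measurable_funB.
  by apply/measurable_fun_pair.
exact: (bmf_fubini _ bG).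
Qed.

End exch_theory.
End config_maps.

Section probability_exists.
Context (R : realType) d (T : measurableType d) (m : {measure set T -> \bar R}).
Hypothesis m1 : m setT = 1%E.

Let mp : set T -> \bar R := m.
HB.instance Definition _ := Measure.on mp.
HB.instance Definition _ := @Measure_isProbability.Build _ _ R mp m1.

Lemma probability_exists : exists m' : probability T R, forall B, m' B = m B.
Proof. by exists (mp : probability T R). Qed.

End probability_exists.

(** * Symmetries of the product measure *)

Section product_measure.
Context (R : realType) (S : countType).
Local Notation RR := (measurableTypeR R).
Local Notation X := (config R S).
Implicit Types (i j k : S) (A C : {fset S}) (x y : X) (f g : X -> R).
Variables (theta : R) (mu : probability X R).
Hypothesis mu_product : is_product_measure (nu theta) mu.

Lemma mu_rect A (B : S -> set RR) : (forall i, measurable (B i)) ->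
  mu (rect A B) = (\prod_(i <- A) nu theta (B i))%E.
Proof. exact: mu_product. Qed.

Lemma mu_unique (m : {measure set X -> \bar R}) :
  (forall A (B : S -> set RR), (forall i, measurable (B i)) ->
     m (rect A B) = \prod_(i <- A) nu theta (B i))%E ->
  forall D, measurable D -> mu D = m D.
Proof.
move=> mE D mD; apply: prod_measure_unique mD; first exact: prob_fin.
by move=> A B mB; rewrite mE// -mu_rect.
Qed.

Lemma swap_inv i j D : measurable D -> mu D = mu (swap i j @^-1` D).
Proof.
move=> mD; have [m mE] := pushforward_exists mu (@measurable_swap R S i j).
rewrite -mE; apply: mu_unique mD => A B mB; rewrite mE.
have -> : swap i j @^-1` rect A B =
    rect (transp i j @` A)%fset (fun k => B (transp i j k)).
  apply/seteqP; split=> x /= xB.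
    by move=> _ /imfsetP[k /= kA ->]; rewrite transpK; exact: xB.
  move=> k kA; have := xB (transp i j k); rewrite transpK; apply.
  exact: in_imfset.
rewrite mu_rect// big_imfset/=; last first.
  by move=> k l _ _; exact: (inv_inj (transpK i j)).
by apply: eq_bigr => k _; rewrite transpK.
Qed.

Lemma int_swap i j f : bmf f -> \int[mu]_x f (swap i j x) = \int[mu]_x f x.
Proof.
move=> bf; rewrite -(int_pushforward (m' := mu) _ (@measurable_swap R S i j) _ bf)//.
by move=> B mB; exact: swap_inv.
Qed.

(** Taking the coordinates outside A from an independent copy preserves the law, since a rectangle
    factors into its sides in A and outside A. Independence and the projection property of [cond]
    both follow. *)
Lemma int_splice A f : bmf f ->
  \int[mu]_x \int[mu]_y f (splice A x y) = \int[mu]_x f x.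
Proof.
move=> bf; have ms := @measurable_splice R S A.
have bF : bmf (fun z : X * X => f (splice A z.1 z.2)) by exact: bmf_comp ms bf.
rewrite (int_fubini1 mu mu bF).
rewrite -(int_pushforward (m' := mu) (prob_fin (mu \x mu)%E) ms _ bf)// => D mD.
have [m mE] := pushforward_exists (mu \x mu)%E ms.
rewrite -mE; apply: mu_unique mD => C B mB; rewrite mE.
have -> : (fun z : X * X => splice A z.1 z.2) @^-1` rect C B =
    rect [fset i in C | i \in A]%fset B `*` rect [fset i in C | i \notin A]%fset B.
  apply/seteqP; split=> -[x y] /=; rewrite /rect/= /splice.
    move=> xyB; split=> i; rewrite !inE => /andP[iC iA]; have := xyB i iC.
      by rewrite iA.
    by rewrite (negbTE iA).
  move=> [xB yB] i iC; case: ifPn => iA.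
    by apply: xB; rewrite !inE iC.
  by apply: yB; rewrite !inE iC.
rewrite [LHS]product_measure1E; [|exact: measurable_rect..].
by rewrite [RHS](big_fsetID _ (mem A)); apply: (f_equal2 (@mule R)); exact: mu_rect.
Qed.

Lemma int_indep A f g : bmf f -> bmf g -> local_on A f ->
  (forall x y, (forall k, k \notin A -> x k = y k) -> g x = g y) ->
  \int[mu]_x (f x * g x) = (\int[mu]_x f x) * \int[mu]_x g x.
Proof.
move=> bf bg lf lg; rewrite -(int_splice A); auto.
rewrite mulrC -intZ//; apply: eq_Rintegral => x _.
rewrite mulrC -intZ//; apply: eq_Rintegral => y _; congr (_ * _).
  by apply: lf => k kA; rewrite /splice kA.
by apply: lg => k kA; rewrite /splice (negbTE kA).
Qed.

Variable ga : probability RR R.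
Hypothesis gaE : forall B, measurable B -> ga B = nu theta B.

Lemma site_law i B : measurable B -> ga B = mu ((fun x => x i) @^-1` B).
Proof.
move=> mB; rewrite gaE//.
have := mu_rect [fset i]%fset (B := fun=> B) (fun=> mB).
rewrite big_seq_fset1 => <-; congr (mu _).
apply/seteqP; split=> x /=; first by apply; rewrite inE.
by move=> Bx j; rewrite inE => /eqP ->.
Qed.

Lemma int_site i (h : RR -> R) : bmf h -> \int[mu]_x h (x i) = \int[ga]_a h a.
Proof.
move=> bh; rewrite -(int_pushforward (m' := ga) _ (@measurable_site R S i) _ bh)//.
by move=> B mB; exact: site_law.
Qed.

Lemma int_site2 i j (h : RR * RR -> R) : i != j -> bmf h ->
  \int[mu]_x h (x i, x j) = \int[ga]_a \int[ga]_b h (a, b).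
Proof.
move=> ij bh.
have bij : bmf (fun x : X => h (x i, x j)).
  apply: (bmf_comp (phi := fun x : X => (x i : RR, x j : RR))) bh.
  by apply/measurable_fun_pair; exact: measurable_site.
rewrite -(int_splice [fset i]%fset bij).
rewrite -(int_site i (h := fun a => \int[ga]_b h (a, b))); last exact: (bmf_fubini ga bh).
apply: eq_Rintegral => x _.
rewrite -(int_site j (h := fun b => h (x i, b))); last exact: bmf_xsec.
apply: eq_Rintegral => y _; rewrite /splice !inE eqxx.
by rewrite eq_sym (negbTE ij).
Qed.

Hypothesis theta0 : 0 < theta.

(** The averaged indicator factors into the sides outside {i, j} and a function [psi] of (x_i, x_j).
    The two are independent, and [gamma_exchange] integrates the latter. *)
Lemma int_exch_rect i j A (B : S -> set RR) : i != j ->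
  i \in A -> j \in A -> (forall k, measurable (B k)) ->
  \int[mu]_x exch i j \1_(rect A B) x = fine (mu (rect A B)).
Proof.
move=> ij iA jA mB.
pose A' := (A `\ i `\ j)%fset.
have kA' k : (k \in A') = [&& k != i, k != j & k \in A].
  by rewrite !inE andbCA.
pose psi (ab : RR * RR) := \int[@unif R]_u \int[@unif R]_v
  (\1_(B i) (ab.1 * (1 - u) + ab.2 * v) * \1_(B j) (ab.2 * (1 - v) + ab.1 * u)).
have m11 : measurable_fun [set: ((RR * RR) * RR) * RR] (fun z : ((RR * RR) * RR) * RR => z.1).
  exact: measurable_fst.
have mu' : measurable_fun [set: ((RR * RR) * RR) * RR] (fun z => (z.1.2 : RR)).
  have m2 : measurable_fun [set: (RR * RR) * RR] (fun z : (RR * RR) * RR => z.2).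
    exact: measurable_snd.
  exact: (measurableT_comp m2 m11).
have mab : measurable_fun [set: ((RR * RR) * RR) * RR] (fun z => z.1.1).
  have m1 : measurable_fun [set: (RR * RR) * RR] (fun z : (RR * RR) * RR => z.1).
    exact: measurable_fst.
  exact: (measurableT_comp m1 m11).
have ma : measurable_fun [set: ((RR * RR) * RR) * RR] (fun z => (z.1.1.1 : RR)).
  have m1 : measurable_fun [set: RR * RR] (fun z : RR * RR => z.1).
    exact: measurable_fst.
  exact: (measurableT_comp m1 mab).
have mb : measurable_fun [set: ((RR * RR) * RR) * RR] (fun z => (z.1.1.2 : RR)).
  have m2 : measurable_fun [set: RR * RR] (fun z : RR * RR => z.2).
    exact: measurable_snd.
  exact: (measurableT_comp m2 mab).
have mv : measurable_fun [set: ((RR * RR) * RR) * RR] (fun z => (z.2 : RR)).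
  exact: measurable_snd.
have m1u : measurable_fun [set: ((RR * RR) * RR) * RR] (fun z => (1 - z.1.2 : RR)).
  exact: measurable_funB.
have m1v : measurable_fun [set: ((RR * RR) * RR) * RR] (fun z => (1 - z.2 : RR)).
  exact: measurable_funB.
have bpsi : bmf psi.
  have bF : bmf (fun z : ((RR * RR) * RR) * RR =>
      \1_(B i) (z.1.1.1 * (1 - z.1.2) + z.1.1.2 * z.2) *
      \1_(B j) (z.1.1.2 * (1 - z.2) + z.1.1.1 * z.1.2) : R).
    have mi := measurable_funD (measurable_funM ma m1u) (measurable_funM mb mv).
    have mj := measurable_funD (measurable_funM mb m1v) (measurable_funM ma mu').
    apply: bmfM; first exact: (bmf_comp mi (bmf_indic R (mB i))).
    exact: (bmf_comp mj (bmf_indic R (mB j))).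
  exact: (bmf_fubini _ (bmf_fubini _ bF)).
have E x : exch i j \1_(rect A B) x = \1_(rect A' B) x * psi (x i, x j).
  rewrite /exch /psi.
  have rectE u v : \1_(rect A B) (exchange i j u v x) =
      \1_(rect A' B) x * (\1_(B i) (x i * (1 - u) + x j * v) *
        \1_(B j) (x j * (1 - v) + x i * u)) :> R.
    rewrite !indicE -!natrM !mulnb; congr (nat_of_bool _)%:R.
    have ei : exchange i j u v x i = x i * (1 - u) + x j * v by rewrite /exchange eqxx.
    have ej : exchange i j u v x j = x j * (1 - v) + x i * u.
      by rewrite /exchange eq_sym (negbTE ij) eqxx.
    have ek k : k != i -> k != j -> exchange i j u v x k = x k.
      by rewrite /exchange => /negbTE -> /negbTE ->.
    apply/idP/and3P => [/set_mem h|[/set_mem h1 /set_mem h2 /set_mem h3]].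
      split; apply: mem_set.
      - by move=> k; rewrite kA' => /and3P[ki kj kA]; rewrite -ek//; exact: h.
      - by rewrite -ei; exact: h.
      - by rewrite -ej; exact: h.
    apply: mem_set => k kA.
    case: (eqVneq k i) => [->|ki]; first by rewrite ei.
    case: (eqVneq k j) => [->|kj]; first by rewrite ej.
    by rewrite ek//; apply: h1; rewrite kA' ki kj.
  have c01 : \1_(rect A' B) x = 0 :> R \/ \1_(rect A' B) x = 1 :> R.
    by rewrite indicE; case: (_ \in _); [right|left].
  case: c01 => c; under eq_Rintegral do under eq_Rintegral do rewrite rectE c.
    rewrite c mul0r -[RHS](exch_cst i j 0 x).
    by apply: eq_Rintegral => u _; apply: eq_Rintegral => v _; rewrite mul0r.
  rewrite c mul1r.
  by apply: eq_Rintegral => u _; apply: eq_Rintegral => v _; rewrite mul1r.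
transitivity (\int[mu]_x (psi (x i, x j) * \1_(rect A' B) x)).
  by apply: eq_Rintegral => x _; rewrite E mulrC.
rewrite (int_indep (A := [fset i; j]%fset) (f := fun x => psi (x i, x j))).
- rewrite int_site2// (gamma_exchange theta0 gaE)// int_indic; last exact: measurable_rect.
  have mr : measurable (rect A' B) by exact: measurable_rect.
  have fr : mu (rect A' B) \is a fin_num by exact: fin_num_measure.
  have fg k : ga (B k) \is a fin_num by exact: fin_num_measure.
  rewrite -(fineM (fg i) (fg j)) -fineM ?fin_numM//.
  have muE C : mu (rect C B) = (\prod_(k <- C) nu theta (B k))%E by exact: mu_rect.
  congr fine; rewrite !muE !gaE//.
  rewrite [in RHS](big_fsetD1 i)//= -muleA; congr (_ * _)%E.
  by rewrite [in RHS](big_fsetD1 j)// !inE eq_sym ij jA.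
- apply: (bmf_comp (phi := fun x : X => (x i : RR, x j : RR))) bpsi.
  by apply/measurable_fun_pair; exact: measurable_site.
- by apply: bmf_indic; exact: measurable_rect.
- by move=> x y xy; rewrite !xy// !inE eqxx ?orbT.
- move=> x y xy; rewrite !indicE; congr (nat_of_bool _)%:R.
  by apply/idP/idP => /set_mem h; apply: mem_set => k kA;
    have := h k kA; move: kA; rewrite kA' => /and3P[ki kj _];
    rewrite ?xy// -?xy// !inE negb_or ki.
Qed.

Lemma int_exch i j f : i != j -> bmf f ->
  \int[mu]_x exch i j f x = \int[mu]_x f x.
Proof.
move=> ij bf; have mex := @measurable_exchange R S i j.
rewrite (int_fubini1 mu (@unif R) (bmf_exchange1 i j bf)).
rewrite (int_fubini1 (mu \x @unif R)%E (@unif R) (bmf_exchange i j bf)).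
have [m mE] := pushforward_exists ((mu \x @unif R) \x @unif R)%E mex.
rewrite -(int_pushforward (m' := m) (prob_fin ((mu \x @unif R) \x @unif R)%E) mex _ bf)//.
apply: int_eq_measure => D mD; apply/esym; apply: mu_unique mD => A B mB.
(* Trivial sides at i and j bring any rectangle into the form required by [int_exch_rect]. *)
pose C := (i |` (j |` A))%fset.
pose B' k := if k \in A then B k else setT.
have mB' k : measurable (B' k) by rewrite /B'; case: ifP.
have rE : rect A B = rect C B'.
  apply/seteqP; split=> x xB k.
    by move=> _; rewrite /B'; case: ifPn => // kA; exact: xB.
  by move=> kA; have := xB k; rewrite /B' kA !inE kA !orbT; apply.
rewrite -mu_rect// rE.
have mr : measurable (rect C B') by exact: measurable_rect.
have := int_exch_rect ij (_ : i \in C) (_ : j \in C) mB'.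
rewrite !inE !eqxx orbT => /(_ isT isT).
have br := bmf_indic R mr.
rewrite (int_fubini1 mu (@unif R) (bmf_exchange1 i j br)).
rewrite (int_fubini1 (mu \x @unif R)%E (@unif R) (bmf_exchange i j br)).
rewrite -(int_pushforward (m' := m) (prob_fin ((mu \x @unif R) \x @unif R)%E) mex _ br)//.
have mfin : (m setT < +oo)%E by rewrite mE preimage_setT; exact: (prob_fin ((mu \x @unif R) \x @unif R)%E).
rewrite int_indic// => h.
have mf : m (rect C B') \is a fin_num.
  rewrite (ge0_fin_numE (measure_ge0 m _)); apply: le_lt_trans mfin.
  by apply: le_measure; rewrite ?inE.
rewrite -(fineK mf) h fineK//; exact: fin_num_measure.
Qed.

End product_measure.

(** * Conditional expectations given finitely many coordinates *)

Section conditional_expectation.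
Context (R : realType) (S : countType).
Local Notation X := (config R S).
Implicit Types (i j k : S) (A C : {fset S}) (x y : X) (f g h : X -> R).
Variables (theta : R) (mu : probability X R).
Hypothesis mu_product : is_product_measure (nu theta) mu.

Local Notation I f := (\int[mu]_x f x)%R.

(** The conditional expectation f_A given the sites in A, as a function defined everywhere and local
    on A, to which the generator can therefore be applied. *)
Definition cond A f x : R := \int[mu]_y f (splice A x y).

Lemma bmf_splice A f : bmf f -> bmf (fun z : X * X => f (splice A z.1 z.2)).
Proof. exact: bmf_comp (@measurable_splice R S A). Qed.

Lemma bmf_cond A f : bmf f -> bmf (cond A f).
Proof. by move=> bf; exact: (bmf_fubini _ (bmf_splice A bf)). Qed.

Lemma bmf_splicer A f x : bmf f -> bmf (fun y => f (splice A x y)).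
Proof. by move=> bf; exact: (bmf_xsec (bmf_splice A bf) x). Qed.

Lemma cond_local A f : local_on A (cond A f).
Proof.
move=> x y xy; apply: eq_Rintegral => z _; congr f; apply/funext => k.
by rewrite /splice; case: ifPn => // kA; rewrite xy.
Qed.

Lemma cond_proj A f h : bmf f -> bmf h -> local_on A h ->
  I (fun x => h x * f x) = I (fun x => h x * cond A f x).
Proof.
move=> bf bh lh; rewrite -(int_splice mu_product A); last exact: bmfM.
apply: eq_Rintegral => x _; rewrite -intZ//; last exact: bmf_splicer.
apply: eq_Rintegral => y _; congr (_ * _).
by apply: lh => k kA; rewrite /splice kA.
Qed.

(** Resampling outside A and outside C independently resamples outside the intersection. This
    commutation is the source of the orthogonality of increments. *)
Lemma cond_cond A C f x : bmf f ->
  cond C (cond A f) x = cond (A `&` C)%fset f x.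
Proof.
move=> bf; rewrite /cond.
rewrite -(int_splice mu_product A (bmf_splicer (A `&` C)%fset x bf)).
apply: eq_Rintegral => y _; apply: eq_Rintegral => z _; congr f; apply/funext => k.
by rewrite /splice inE; case: (k \in A); case: (k \in C).
Qed.

Lemma int_mulC f g : I (fun x => f x * g x) = I (fun x => g x * f x).
Proof. by apply: eq_Rintegral => x _; rewrite mulrC. Qed.

Lemma cond_cross A C f : bmf f ->
  I (fun x => cond A f x * cond C f x) = I (fun x => cond (A `&` C)%fset f x ^+ 2).
Proof.
move=> bf; have bc D := bmf_cond D bf.
rewrite int_mulC (cond_proj (bc A) (bc C) (@cond_local C f)).
transitivity (I (fun x => cond (A `&` C)%fset f x * cond C f x)).
  by apply: eq_Rintegral => x _; rewrite mulrC cond_cond.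
rewrite (cond_proj (bc C) (bc (A `&` C)%fset) (@cond_local (A `&` C)%fset f)).
apply: eq_Rintegral => x _; rewrite cond_cond// expr2.
by rewrite (_ : C `&` _ = A `&` C)%fset// fsetIC -fsetIA fsetIid.
Qed.

Lemma cond_self A f : bmf f ->
  I (fun x => f x * cond A f x) = I (fun x => cond A f x ^+ 2).
Proof.
move=> bf; rewrite int_mulC (cond_proj bf (bmf_cond A bf) (@cond_local A f)).
by apply: eq_Rintegral => x _; rewrite expr2.
Qed.

Lemma int_sqrB f g : bmf f -> bmf g -> I (fun x => (f x - g x) ^+ 2) =
  I (fun x => f x ^+ 2) - 2 * I (fun x => f x * g x) + I (fun x => g x ^+ 2).
Proof.
move=> bf bg; rewrite -intZ; auto; rewrite -intB; auto; rewrite -intD; auto.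
by apply: eq_Rintegral => x _; ring.
Qed.

Lemma cond_dist A f : bmf f -> I (fun x => (f x - cond A f x) ^+ 2) =
  I (fun x => f x ^+ 2) - I (fun x => cond A f x ^+ 2).
Proof.
move=> bf; rewrite int_sqrB//; last exact: bmf_cond.
rewrite cond_self//.
have alg (a b : R) : a - 2 * b + b = a - b by ring.
exact: alg.
Qed.

Lemma cond_sqr_le A f : bmf f -> I (fun x => cond A f x ^+ 2) <= I (fun x => f x ^+ 2).
Proof.
by move=> bf; rewrite -subr_ge0 -cond_dist//; apply: int_ge0 => x; exact: sqr_ge0.
Qed.

Lemma cond_best A f h : bmf f -> bmf h -> local_on A h ->
  I (fun x => (f x - cond A f x) ^+ 2) <= I (fun x => (f x - h x) ^+ 2).
Proof.
move=> bf bh lh; have bc := bmf_cond A bf.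
rewrite cond_dist// int_sqrB// int_mulC (cond_proj bf bh lh) int_mulC.
rewrite -subr_ge0.
have -> : forall a b c d : R, a - 2 * b + c - (a - d) = d - 2 * b + c by move=> *; ring.
by rewrite -int_sqrB//; apply: int_ge0 => x; exact: sqr_ge0.
Qed.

Local Opaque cond.

Section bessel.
Variables (A : {fset S}) (f : X -> R).
Hypothesis bf : bmf f.

(** The difference d_k; it vanishes for k in A. *)
Definition incr k x : R := cond (k |` A)%fset f x - cond A f x.

Let bc C : bmf (cond C f) := bmf_cond C bf.

Lemma bmf_incr k : bmf (incr k).
Proof. by apply: bmfB; exact: bc. Qed.

Let cond_sub_sqr C : (A `&` C = A)%fset ->
  I (fun x => (cond C f x - cond A f x) ^+ 2) =
  I (fun x => cond C f x ^+ 2) - I (fun x => cond A f x ^+ 2).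
Proof.
move=> hAC; rewrite (int_sqrB (bc C) (bc A)) (int_mulC (cond C f) (cond A f)).
rewrite (cond_cross A C bf) hAC.
have alg (a b : R) : a - 2 * b + b = a - b by ring.
exact: alg.
Qed.

Let int_mulBB (a b c d : X -> R) : bmf a -> bmf b -> bmf c -> bmf d ->
  I (fun x => (a x - b x) * (c x - d x)) =
  I (fun x => a x * c x) - I (fun x => a x * d x) -
  (I (fun x => b x * c x) - I (fun x => b x * d x)).
Proof.
move=> ba bb bc' bd; rewrite -!intB; auto.
by apply: eq_Rintegral => x _; ring.
Qed.

Let cond_sub_orth C D : (A `&` C = A)%fset -> (A `&` D = A)%fset ->
  (C `&` D = A)%fset ->
  I (fun x => (cond C f x - cond A f x) * (cond D f x - cond A f x)) = 0.
Proof.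
move=> hAC AD CD; rewrite int_mulBB// (cond_cross C D bf) (int_mulC (cond C f) (cond A f)).
rewrite (cond_cross A C bf) (cond_cross A D bf) (cond_cross A A bf) hAC AD CD fsetIid.
have alg (a : R) : a - a - (a - a) = 0 by ring.
exact: alg.
Qed.

Let cond_sub_self C : (A `&` C = A)%fset ->
  I (fun x => (f x - cond A f x) * (cond C f x - cond A f x)) =
  I (fun x => (cond C f x - cond A f x) ^+ 2).
Proof.
move=> hAC; rewrite int_mulBB// (cond_sub_sqr hAC) (cond_self C bf) (cond_self A bf).
rewrite (cond_cross A C bf) (cond_cross A A bf) hAC fsetIid.
have alg (a b : R) : a - b - (b - b) = a - b by ring.
exact: alg.
Qed.

Let AkA k : (A `&` (k |` A) = A)%fset.
Proof. by apply/fsetP => l; rewrite !inE; case: (l \in A); rewrite ?orbT ?andbF. Qed.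

Lemma incr_sqr k : I (fun x => incr k x ^+ 2) =
  I (fun x => cond (k |` A)%fset f x ^+ 2) - I (fun x => cond A f x ^+ 2).
Proof. by apply: cond_sub_sqr; exact: AkA. Qed.

Lemma incr_orth j k : j != k -> I (fun x => incr j x * incr k x) = 0.
Proof.
move=> jk; apply: cond_sub_orth; [exact: AkA|exact: AkA|].
apply/fsetP => l; rewrite !inE; case: (l \in A); rewrite ?orbT ?orbF//.
by apply/negP => /andP[/eqP -> ]; rewrite (negbTE jk).
Qed.

Lemma incr_self k :
  I (fun x => (f x - cond A f x) * incr k x) = I (fun x => incr k x ^+ 2).
Proof. by apply: cond_sub_self; exact: AkA. Qed.

(** The residual f - f_A - sum of d_k over s has the difference of the two sides as its squared
    norm: adding j to s lowers it by |d_j|^2, since d_j is orthogonal to the other d_k and <f - f_A,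
    d_j> = |d_j|^2. *)
Lemma bessel (s : seq S) : uniq s ->
  \sum_(k <- s) I (fun x => incr k x ^+ 2) <= I (fun x => (f x - cond A f x) ^+ 2).
Proof.
pose r s x := f x - cond A f x - \sum_(k <- s) incr k x.
have br t : bmf (r t).
  by apply: bmfB; [exact: bmfB|apply: bmf_sum => k; exact: bmf_incr].
suff H : uniq s -> I (fun x => r s x ^+ 2) =
    I (fun x => (f x - cond A f x) ^+ 2) - \sum_(k <- s) I (fun x => incr k x ^+ 2).
  by move=> us; rewrite -subr_ge0 -H//; apply: int_ge0 => x; exact: sqr_ge0.
elim: s => [|j s IH] /=.
  move=> _; rewrite big_nil subr0; apply: eq_Rintegral => x _.
  by rewrite /r big_nil subr0.
move=> /andP[js us]; rewrite big_cons.
transitivity (I (fun x => (r s x - incr j x) ^+ 2)).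
  by apply: eq_Rintegral => x _; rewrite /r big_cons; congr (_ ^+ 2); ring.
rewrite (int_sqrB (br s) (bmf_incr j)) IH//.
suff -> : I (fun x => r s x * incr j x) = I (fun x => incr j x ^+ 2).
  have alg (a b c : R) : a - b - 2 * c + c = a - (c + b) by ring.
  exact: alg.
rewrite -incr_self -[RHS]subr0.
transitivity (I (fun x => (f x - cond A f x) * incr j x)
    - I (fun x => \sum_(k <- s) incr k x * incr j x)).
  rewrite -intB//; last 2 first.
  - by apply: bmfM; [exact: bmfB|exact: bmf_incr].
  - by apply: bmf_sum => k; apply: bmfM; exact: bmf_incr.
  by apply: eq_Rintegral => x _; rewrite /r -mulr_suml; ring.
congr (_ - _); rewrite int_sum//; last first.
  by move=> k; apply: bmfM; exact: bmf_incr.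
rewrite big_seq big1// => k ks; apply: incr_orth.
by apply: contraNneq js => <-.
Qed.

End bessel.

Definition approximable f := forall e : R, 0 < e -> exists A h,
  [/\ bmf h, local_on A h & I (fun x => (f x - h x) ^+ 2) <= e].

Lemma int_sqrD_le f g : bmf f -> bmf g -> I (fun x => (f x + g x) ^+ 2) <=
  2 * I (fun x => f x ^+ 2) + 2 * I (fun x => g x ^+ 2).
Proof.
move=> bf bg; rewrite -!intZ; auto; rewrite -intD; auto.
apply: int_le; auto => x; rewrite -subr_ge0.
rewrite [leRHS](_ : _ = (f x - g x) ^+ 2) ?sqr_ge0//; ring.
Qed.

Lemma approximable_close f : bmf f ->
  (forall e : R, 0 < e -> exists g, [/\ bmf g, approximable g &
     I (fun x => (f x - g x) ^+ 2) <= e]) -> approximable f.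
Proof.
move=> bf H e e0; have e4 : 0 < e / 4 by rewrite divr_gt0.
have [g [bg ag fg]] := H _ e4; have [A [h [bh lh gh]]] := ag _ e4.
exists A, h; split=> //.
have := int_sqrD_le (bmfB bf bg) (bmfB bg bh).
rewrite [X in X <= _ -> _](_ : _ = I (fun x => (f x - h x) ^+ 2)); first by lra.
by apply: eq_Rintegral => x _; congr (_ ^+ 2); ring.
Qed.

Lemma approximableD f g : bmf f -> bmf g -> approximable f -> approximable g ->
  approximable (fun x => f x + g x).
Proof.
(* A quarter of e for each term, because (a + b)^2 <= 2 a^2 + 2 b^2. *)
move=> bf bg af ag e e0; have e4 : 0 < e / 4 by rewrite divr_gt0.
have [A [h [bh lh fh]]] := af _ e4; have [C [k [bk lk gk]]] := ag _ e4.
exists (A `|` C)%fset, (fun x => h x + k x); split; auto.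
  move=> x y xy; rewrite (lh x y); last by move=> i iA; apply: xy; rewrite inE iA.
  by rewrite (lk x y)// => i iC; apply: xy; rewrite inE iC orbT.
have := int_sqrD_le (bmfB bf bh) (bmfB bg bk).
rewrite [X in X <= _ -> _](_ : _ = I (fun x => (f x + g x - (h x + k x)) ^+ 2)); first by lra.
by apply: eq_Rintegral => x _; congr (_ ^+ 2); ring.
Qed.

Lemma approximableZ (c : R) f : bmf f -> approximable f ->
  approximable (fun x => c * f x).
Proof.
move=> bf af e e0; have ec : 0 < e / (c ^+ 2 + 1).
  by rewrite divr_gt0// ltr_wpDl// sqr_ge0.
have [A [h [bh lh fh]]] := af _ ec.
exists A, (fun x => c * h x); split; auto.
  by move=> x y xy; rewrite (lh x y).
rewrite [leLHS](_ : _ = c ^+ 2 * I (fun x => (f x - h x) ^+ 2)); last first.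
  by rewrite -intZ; auto; apply: eq_Rintegral => x _; ring.
apply: (@le_trans _ _ (c ^+ 2 * (e / (c ^+ 2 + 1)))).
  by rewrite ler_wpM2l ?sqr_ge0.
rewrite mulrA ler_pdivrMr; last by rewrite ltr_wpDl// sqr_ge0.
by have := sqr_ge0 c; nra.
Qed.

(** Indicators of rectangles are local. As f_A is the best approximation by functions local on A,
    f_A can be brought arbitrarily close to f. *)
Lemma approximable_bmf f : bmf f -> approximable f.
Proof.
apply: (rect_approximation (m := mu)) => [A C mC e e0|c {}f g bf bg af ag|]; last first.
- exact: approximable_close.
- by apply: approximableD => //; [exact: bmfZ|exact: approximableZ].
exists A, \1_(rect A C); split.
- by apply: bmf_indic; exact: measurable_rect.
- move=> x y xy; rewrite !indicE; congr (nat_of_bool _)%:R.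
  by apply/idP/idP => /set_mem h; apply: mem_set => k kA; have := h k kA; rewrite xy.
- rewrite [leLHS](_ : _ = 0) ?ltW//.
  rewrite (_ : (fun x => _) = (fun=> 0)); first by rewrite int_cst mul0r.
  by apply/funext => x; rewrite subrr expr0n.
Qed.

End conditional_expectation.

(** * Harmonic functions are invariant under exchanges *)

(** Grouping pairs by first site leaves delta_i times a partial row sum of p. Repetitions among the
    first sites are removed so that Bessel's inequality applies to the resulting list. *)
Lemma sum_rows_le (R : realDomainType) (S : eqType) (p : S -> S -> R)
    (delta : S -> R) (s : seq (S * S)) :
  (forall i t, uniq t -> \sum_(j <- t) p i j <= 1) -> (forall i, 0 <= delta i) ->
  uniq s ->
  \sum_(ij <- s) p ij.1 ij.2 * delta ij.1 <=
  \sum_(i <- undup [seq ij.1 | ij <- s]) delta i.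
Proof.
move=> p1 d0 us; set J := undup _.
have -> : \sum_(ij <- s) p ij.1 ij.2 * delta ij.1 =
    \sum_(i <- J) \sum_(ij <- s | ij.1 == i) p i ij.2 * delta i.
  transitivity (\sum_(ij <- s) \sum_(i <- J | ij.1 == i) p i ij.2 * delta i).
    rewrite big_seq [RHS]big_seq; apply: eq_bigr => ij ijs.
    rewrite big_mkcond (bigD1_seq ij.1)/= ?undup_uniq ?mem_undup ?map_f// eqxx.
    by rewrite big1 ?addr0// => k /negbTE; rewrite eq_sym => ->.
  rewrite (exchange_big_dep xpredT)//=.
apply: ler_sum => i _; rewrite -mulr_suml -[leRHS]mul1r; apply: ler_wpM2r => //.
rewrite -big_filter -(big_map (fun ij => ij.2) xpredT (p i)).
apply: p1; rewrite map_inj_in_uniq ?filter_uniq//.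
move=> [a b] [c e]; rewrite !mem_filter/= => /andP[/eqP -> _] /andP[/eqP -> _].
by move=> ->.
Qed.

Local Opaque cond exch.

Lemma subr_telescope4 (R : comPzRingType) (u v c d : R) :
  c - d + (u - c - (v - d)) = u - v.
Proof. ring. Qed.

(** For g = f_A and E = E_ab: gw is <g - E g, g>, gg is |g - E g|^2, gd is the same for f - g, and
    tot is |f - E f|^2. Then gw <= 6e/r, gg <= 12e/r and gd <= 4e, whence 24/r + 8. *)
Lemma exch_arith (R : realFieldType) (r e dist gw gd gg tot : R) : 0 < r ->
  dist <= e -> r * gw <= 2 * e + 4 * dist -> gd <= 4 * dist -> gg <= 2 * gw ->
  tot <= 2 * gg + 2 * gd -> tot <= (24 / r + 8) * e.
Proof.
move=> r0 h1 h2 h3 h4 h5.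
have h6 : gw <= 6 * e / r by rewrite ler_pdivlMr// mulrC; lra.
have -> : (24 / r + 8) * e = 4 * (6 * e / r) + 8 * e by field; rewrite gt_eqF.
lra.
Qed.

Lemma dirichlet_arith (R : realFieldType) (r e u v c d q : R) :
  r * (2^-1 * u) <= v + (c + d) -> v <= e -> c <= q -> d <= q ->
  r * u <= 2 * e + 4 * q.
Proof. lra. Qed.

Section harmonic.
Context (R : realType) (S : countType).
Local Notation X := (config R S).
Implicit Types (i j k : S) (A C : {fset S}) (x y : X) (f g h w : X -> R).
Variables (theta : R) (mu : probability X R).
Hypothesis theta0 : 0 < theta.
Hypothesis mu_product : is_product_measure (nu theta) mu.
Local Notation RR := (measurableTypeR R).

Local Notation I f := (\int[mu]_x f x)%R.

(** The one-site law is taken as the marginal of mu at i, which makes [nu theta] a probability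
    without computing its mass. *)
Lemma int_exch_inv i j f : i != j -> bmf f -> I (exch i j f) = I f.
Proof.
move=> ij bf.
have [m mE] := pushforward_exists mu (@measurable_site R S i).
have m1 : m setT = 1%E by rewrite mE preimage_setT; exact: (probability_setT mu).
have [ga gaE] := probability_exists m1.
apply: (int_exch mu_product (ga := ga)) => // B mB.
have := mu_rect mu_product [fset i]%fset (B := fun=> B) (fun=> mB).
rewrite big_seq_fset1 gaE mE => <-; congr (mu _); apply/seteqP; split=> x /=; last by apply; rewrite inE.
by move=> Bx j'; rewrite inE => /eqP ->.
Qed.

Lemma int_exch_sqr_le i j f : i != j -> bmf f ->
  I (fun x => exch i j f x ^+ 2) <= I (fun x => f x ^+ 2).
Proof.
move=> ij bf; rewrite -[leRHS](int_exch_inv ij (bmfX 2 bf)).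
apply: int_le => //; first by apply: bmfX; exact: bmf_exch.
  by apply: bmf_exch; exact: bmfX.
by move=> x; exact: exch_sqr_le.
Qed.

(** Expand the square and bound |E g|^2 by |g|^2. *)
Lemma exch_gap i j g : i != j -> bmf g ->
  I (fun x => (g x - exch i j g x) ^+ 2) <= 2 * I (fun x => (g x - exch i j g x) * g x).
Proof.
move=> ij bg; have be := bmf_exch i j bg.
rewrite (int_sqrB mu bg be).
have -> : I (fun x => (g x - exch i j g x) * g x) =
    I (fun x => g x ^+ 2) - I (fun x => g x * exch i j g x).
  rewrite -intB; auto; apply: eq_Rintegral => x _; ring.
have := int_exch_sqr_le ij bg.
move: (I (fun x => exch i j g x ^+ 2)) (I (fun x => g x ^+ 2)) (I (fun x => g x * _)).
move=> a b c; lra.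
Qed.

Lemma exch_gap_le i j g : i != j -> bmf g ->
  I (fun x => (g x - exch i j g x) ^+ 2) <= 4 * I (fun x => g x ^+ 2).
Proof.
move=> ij bg; have be := bmf_exch i j bg.
have := int_sqrD_le mu bg (bmfN be).
have -> : I (fun x => (- exch i j g x) ^+ 2) = I (fun x => exch i j g x ^+ 2).
  by apply: eq_Rintegral => x _; rewrite sqrrN.
have := int_exch_sqr_le ij bg.
move: (I (fun x => exch i j g x ^+ 2)) (I (fun x => g x ^+ 2)) (I (fun x => _ ^+ 2)).
move=> a b c; lra.
Qed.

Section fixed_set.
Variables (A : {fset S}) (f : X -> R).
Hypothesis bf : bmf f.
Local Notation g := (cond mu A f).
Local Notation delta k := (I (fun x => incr mu A f k x ^+ 2)).

Let bg : bmf g := bmf_cond mu A bf.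

(** As w sees A and k only, <w, f> = <w, g> + <w, d_k>, and <w, d_k> >= -|w|^2/4 - |d_k|^2. The
    assumption on w absorbs |w|^2/4 into half of <w, g>. *)
Lemma int_local_lower k w : bmf w -> local_on (k |` A)%fset w ->
  I (fun x => w x ^+ 2) <= 2 * I (fun x => w x * g x) ->
  2^-1 * I (fun x => w x * g x) - delta k <= I (fun x => w x * f x).
Proof.
move=> bw lw; rewrite (cond_proj mu_product bf bw lw).
have bc := bmf_cond mu (k |` A)%fset bf.
have bi : bmf (incr mu A f k) by exact: bmf_incr.
have -> : I (fun x => w x * cond mu (k |` A)%fset f x) =
    I (fun x => w x * g x) + I (fun x => w x * incr mu A f k x).
  rewrite -intD; auto; apply: eq_Rintegral => x _.
  by rewrite /incr; ring.
have : 0 <= I (fun x => (2^-1 * w x + incr mu A f k x) ^+ 2).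
  by apply: int_ge0 => x; exact: sqr_ge0.
have -> : I (fun x => (2^-1 * w x + incr mu A f k x) ^+ 2) =
    4^-1 * I (fun x => w x ^+ 2) + I (fun x => w x * incr mu A f k x) + delta k.
  rewrite -intZ; auto; rewrite -intD; auto; rewrite -intD; auto.
  by apply: eq_Rintegral => x _; field.
move: (I (fun x => w x ^+ 2)) (I (fun x => w x * _)) (I (fun x => w x * _)) (delta k).
move=> a b c d; lra.
Qed.

Lemma delta_ge0 k : 0 <= delta k.
Proof. by apply: int_ge0 => x; exact: sqr_ge0. Qed.

(** If i or j lies in A, the bracket depends on A and the other site, and one increment suffices; if
    neither does, the bracket is zero. Subtracting both increments covers all cases. *)
Lemma exch_lower i j : i != j ->
  2^-1 * I (fun x => (g x - exch i j g x) * g x) - delta i - delta j <=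
  I (fun x => (g x - exch i j g x) * f x).
Proof.
move=> ij; have be := bmf_exch i j bg.
have bw : bmf (fun x => g x - exch i j g x) by exact: bmfB.
have lg C : (A `<=` C)%fset -> local_on C g.
  by move=> AsC; apply: local_on_sub AsC _; exact: cond_local.
have lw k : i \in (k |` A)%fset -> j \in (k |` A)%fset ->
    local_on (k |` A)%fset (fun x => g x - exch i j g x).
  move=> ik jk x y xy; have lgk := lg (k |` A)%fset (fsubsetUr _ _).
  exact: (f_equal2 (fun u v : R => u - v) (lgk x y xy) (exch_local ik jk lgk xy)).
have gap := exch_gap ij bg.
have di := delta_ge0 i; have dj := delta_ge0 j.
have [iA|iA] := boolP (i \in A).
  have := int_local_lower bw (lw j _ _) gap.
  rewrite !inE iA eqxx orbT => /(_ isT isT).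
  move: di dj; move: (delta i) (delta j) (I (fun x => _ * g x)) (I (fun x => _ * f x)).
  move=> a b c d; lra.
have [jA|jA] := boolP (j \in A).
  have := int_local_lower bw (lw i _ _) gap.
  rewrite !inE jA eqxx orbT => /(_ isT isT).
  move: di dj; move: (delta i) (delta j) (I (fun x => _ * g x)) (I (fun x => _ * f x)).
  move=> a b c d; lra.
have w0 h : I (fun x => (g x - exch i j g x) * h x) = 0.
  rewrite -[RHS](mul0r (fine (mu setT))) -int_cst; apply: eq_Rintegral => x _.
  by rewrite (exch_out x iA jA (lg _ (fsubset_refl _))) subrr mul0r.
rewrite !w0 mulr0; move: di dj; move: (delta i) (delta j) => a b; lra.
Qed.

End fixed_set.

Variable p : S -> S -> R.
Hypothesis p_ge0 : forall i j, 0 <= p i j.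
Hypothesis p_sym : forall i j, p i j = p j i.
Hypothesis p_le1 : forall i t, uniq t -> \sum_(j <- t) p i j <= 1.

Variable f : X -> R.
Hypothesis bf : bmf f.
(** Finite form of the identity sum_ij p(i,j) <E_ij g - g, f> = 0. The list can be made to contain
    any prescribed pair, whose term is isolated below. *)
Hypothesis harmonic : forall A g (e : R) a b, bmf g -> local_on A g -> 0 < e -> a != b ->
  exists s : seq (S * S), [/\ uniq s, (a, b) \in s, (forall ij, ij \in s -> ij.1 != ij.2) &
    `|\sum_(ij <- s) p ij.1 ij.2 * I (fun x => (exch ij.1 ij.2 g x - g x) * f x)| <= e].

(** All terms <g - E_ij g, g> are nonnegative, so the one at (a, b) is at most their weighted sum.
    The increments cost |f - g|^2 once for each member of a pair, and doubling clears the factor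
    1/2. *)
Lemma harmonic_gap A a b (e : R) : a != b -> 0 < e ->
  p a b * I (fun x => (cond mu A f x - exch a b (cond mu A f) x) * cond mu A f x) <=
  2 * e + 4 * I (fun x => (f x - cond mu A f x) ^+ 2).
Proof.
move=> ab e0; set g := cond mu A f.
have bg : bmf g by exact: bmf_cond.
have [s [us abs ds hs]] := harmonic bg (@cond_local _ _ mu A f) e0 ab.
pose D ij := I (fun x => (g x - exch ij.1 ij.2 g x) * g x).
pose W ij := I (fun x => (g x - exch ij.1 ij.2 g x) * f x).
pose delta k := I (fun x => incr mu A f k x ^+ 2).
have d0 k : 0 <= delta k by exact: delta_ge0.
have D0 ij : ij.1 != ij.2 -> 0 <= D ij.
  move=> dij; have := exch_gap dij bg; rewrite -/(D ij).
  have : 0 <= I (fun x => (g x - exch ij.1 ij.2 g x) ^+ 2).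
    by apply: int_ge0 => x; exact: sqr_ge0.
  by move=> h1 h2; have := le_trans h1 h2; rewrite pmulr_rge0.
have Wle : \sum_(ij <- s) p ij.1 ij.2 * W ij <= e.
  apply: le_trans hs; rewrite -[leRHS]normrN; apply: le_trans (ler_norm _).
  rewrite -sumrN le_eqVlt; apply/orP; left; apply/eqP; apply: eq_bigr => ij _.
  have be := bmf_exch ij.1 ij.2 bg.
  rewrite -mulrN -intN; auto; congr (_ * _).
  by apply: eq_Rintegral => x _; ring.
have low ij : ij \in s -> p ij.1 ij.2 * (2^-1 * D ij) <=
    p ij.1 ij.2 * W ij + (p ij.1 ij.2 * delta ij.1 + p ij.1 ij.2 * delta ij.2).
  move=> /ds dij; rewrite -!mulrDr ler_wpM2l//.
  have := exch_lower A bf dij; rewrite -/g -/(D ij) -/(W ij) -/(delta _) -/(delta _).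
  by move: (D ij) (W ij) (delta ij.1) (delta ij.2) => u v c d; lra.
have bess t : uniq t -> \sum_(k <- t) delta k <= I (fun x => (f x - g x) ^+ 2).
  by move=> ut; exact: (bessel mu_product A bf ut).
have rows1 : \sum_(ij <- s) p ij.1 ij.2 * delta ij.1 <= I (fun x => (f x - g x) ^+ 2).
  apply: le_trans (sum_rows_le p_le1 d0 us) _.
  by apply: bess; exact: undup_uniq.
(* Sums over second sites become sums over first sites of the reversed pairs, by symmetry of p. *)
have rows2 : \sum_(ij <- s) p ij.1 ij.2 * delta ij.2 <= I (fun x => (f x - g x) ^+ 2).
  have uswap : uniq [seq (ij.2, ij.1) | ij <- s].
    by rewrite map_inj_uniq// => -[u v] [c d] [-> ->].
  have := sum_rows_le p_le1 d0 uswap; rewrite big_map/=.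
  rewrite (eq_bigr (fun ij => p ij.1 ij.2 * delta ij.2)); last first.
    by move=> ij _; rewrite p_sym.
  by move=> /le_trans; apply; apply: bess; exact: undup_uniq.
have : p a b * (2^-1 * D (a, b)) <= \sum_(ij <- s) p ij.1 ij.2 * (2^-1 * D ij).
  rewrite (bigD1_seq (a, b))//= lerDl big_seq_cond; apply: sumr_ge0 => ij /andP[ijs _].
  by rewrite !mulr_ge0// D0// ds.
move=> h; have {h} : p a b * (2^-1 * D (a, b)) <= \sum_(ij <- s)
    (p ij.1 ij.2 * W ij + (p ij.1 ij.2 * delta ij.1 + p ij.1 ij.2 * delta ij.2)).
  by apply: le_trans h _; rewrite big_seq [leRHS]big_seq; exact: ler_sum.
rewrite !big_split/= => h.
exact: dirichlet_arith h Wle rows1 rows2.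
Qed.

Lemma harmonic_exch a b : a != b -> 0 < p a b ->
  I (fun x => (f x - exch a b f x) ^+ 2) = 0.
Proof.
move=> ab pab; apply/eqP; rewrite eq_le; apply/andP; split; last first.
  by apply: int_ge0 => x; exact: sqr_ge0.
apply/ler_addgt0Pr => e e0; rewrite add0r.
pose c := 24 / p a b + 8; have c0 : 0 < c by rewrite addr_gt0// divr_gt0.
have ec : 0 < e / c by rewrite divr_gt0.
have [A [h [bh lh fh]]] := approximable_bmf mu bf ec.
have := harmonic_gap A ab ec.
have := cond_best mu_product bf bh lh.
set g := cond mu A f; have bg : bmf g by exact: bmf_cond.
have bfg : bmf (fun x => f x - g x) by exact: bmfB.
move=> /le_trans /(_ fh) dist.
have be (k : X -> R) : bmf k -> bmf (fun x => k x - exch a b k x).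
  by move=> bk; apply: bmfB => //; exact: bmf_exch.
have := exch_gap ab bg; have := exch_gap_le ab bfg.
have := int_sqrD_le mu (be _ bg) (be _ bfg).
rewrite [X in X <= _ -> _](_ : _ = I (fun x => (f x - exch a b f x) ^+ 2)); last first.
  apply: eq_Rintegral => x _; rewrite (exchB _ _ _ bf bg); congr (_ ^+ 2).
  exact: subr_telescope4.
move=> h1 h2 h3 h4; have := exch_arith pab dist h4 h2 h3 h1.
by rewrite -/c (mulrC c) divfK ?gt_eqF.
Qed.

(** With s the swap, f - f o s = (f - E f) - (f - E f) o s because E f is s-invariant; both terms
    are null. *)
Lemma harmonic_swap a b : a != b -> 0 < p a b ->
  I (fun x => (f x - f (swap a b x)) ^+ 2) = 0.
Proof.
move=> ab pab; have e0 := harmonic_exch ab pab.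
have bs h : bmf h -> bmf (fun x => h (swap a b x)).
  exact: bmf_comp (@measurable_swap R S a b).
have be := bmf_exch a b bf.
have bfe : bmf (fun x => f x - exch a b f x) by exact: bmfB.
apply/eqP; rewrite eq_le; apply/andP; split; last first.
  by apply: int_ge0 => x; exact: sqr_ge0.
have bneg : bmf (fun x => - (f (swap a b x) - exch a b f (swap a b x))).
  by apply: bmfN; apply: (bs (fun x => f x - exch a b f x)).
have := int_sqrD_le mu bfe bneg.
rewrite [X in X <= _ -> _](_ : _ = I (fun x => (f x - f (swap a b x)) ^+ 2)); last first.
  by apply: eq_Rintegral => x _; rewrite exch_swap//; congr (_ ^+ 2); ring.
rewrite [X in _ <= _ * X + _ -> _]e0.
rewrite [X in _ <= _ + _ * X -> _](_ : _ = 0); first by rewrite !mulr0 addr0.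
rewrite -[RHS]e0 -(int_swap mu_product a b (bmfX 2 bfe)).
by apply: eq_Rintegral => x _; rewrite sqrrN.
Qed.

End harmonic.

Local Opaque cond exch.

(** * Functions invariant under all transpositions *)

Section constant.
Context (R : realType) (S : countType).
Local Notation X := (config R S).
Implicit Types (i j k : S) (A C : {fset S}) (x y : X) (g h : X -> R).
Variables (theta : R) (mu : probability X R).
Hypothesis theta0 : 0 < theta.
Hypothesis mu_product : is_product_measure (nu theta) mu.
Local Notation I f := (\int[mu]_x f x)%R.

Definition null2 g := I (fun x => g x ^+ 2) = 0.

Lemma null2D g h : bmf g -> bmf h -> null2 g -> null2 h -> null2 (fun x => g x + h x).
Proof.
move=> bg bh g0 h0; apply/eqP; rewrite eq_le; apply/andP; split; last first.
  by apply: int_ge0 => x; exact: sqr_ge0.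
apply: le_trans (int_sqrD_le mu bg bh) _.
by rewrite [X in 2 * X + _]g0 [X in _ + 2 * X]h0 !mulr0 addr0.
Qed.

Lemma bmf_swap i j g : bmf g -> bmf (fun x => g (swap i j x)).
Proof. exact: bmf_comp (@measurable_swap R S i j). Qed.

Lemma null2_swap i j g : bmf g -> null2 g -> null2 (fun x => g (swap i j x)).
Proof.
by move=> bg g0; rewrite /null2 (int_swap mu_product i j (bmfX 2 bg)).
Qed.

Lemma null2_mul g h : bmf g -> bmf h -> null2 g -> I (fun x => g x * h x) = 0.
Proof. by move=> bg bh g0; exact: int_null_mul. Qed.

Lemma null2_sqr g h : bmf g -> bmf h -> null2 (fun x => g x - h x) ->
  I (fun x => g x ^+ 2) = I (fun x => h x ^+ 2).
Proof.
move=> bg bh gh; apply/eqP; rewrite -subr_eq0 -intB; auto.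
rewrite -(null2_mul (bmfB bg bh) (bmfD bg bh) gh); apply/eqP.
by apply: eq_Rintegral => x _; rewrite subr_sqr.
Qed.

Lemma condB A g h x : bmf g -> bmf h ->
  cond mu A (fun y => g y - h y) x = cond mu A g x - cond mu A h x.
Proof.
move=> bg bh; rewrite [RHS](_ : _ = \int[mu]_y (g (splice A x y) - h (splice A x y))) //.
by rewrite intB//; exact: bmf_splicer.
Qed.

(** The resampled configuration may be swapped too, as its law is invariant. Since k and l lie
    outside A, the swap carries k |[A to l |] A. *)
Lemma cond_swap A k l g x : k \notin A -> l \notin A -> bmf g ->
  cond mu (k |` A)%fset g (swap k l x) =
  cond mu (l |` A)%fset (fun y => g (swap k l y)) x.
Proof.
move=> kA lA bg.
transitivity (\int[mu]_y g (splice (k |` A)%fset (swap k l x) (swap k l y))).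
  by rewrite (int_swap mu_product k l (bmf_splicer (k |` A)%fset (swap k l x) bg)).
apply: eq_Rintegral => y _; congr g; apply/funext => m.
rewrite /splice /swap !inE.
suff -> : (m == k) || (m \in A) = (transp k l m == l) || (transp k l m \in A) by [].
rewrite /transp; case: (eqVneq m k) => [_|mk]; first by rewrite eqxx.
case: (eqVneq m l) mk => [->|ml] mk; last by rewrite (negbTE ml).
by rewrite (negbTE lA) (negbTE kA) eq_sym (negbTE mk).
Qed.

Variable f : X -> R.
Hypothesis bf : bmf f.
Hypothesis swap_null : forall a b, a != b -> null2 (fun x => f x - f (swap a b x)).
Hypothesis S_infinite : infinite_set [set: S].

Local Notation N A := (I (fun x => cond mu A f x ^+ 2)).

Lemma cond_sqr_swap A k l : k \notin A -> l \notin A -> k != l ->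
  N (k |` A)%fset = N (l |` A)%fset.
Proof.
move=> kA lA kl; have bs := bmf_swap k l bf.
have bc C := bmf_cond mu C bf; have bcs C := bmf_cond mu C bs.
rewrite -(int_swap mu_product k l (bmfX 2 (bc (k |` A)%fset))).
transitivity (I (fun x => cond mu (l |` A)%fset (fun y => f (swap k l y)) x ^+ 2)).
  by apply: eq_Rintegral => x _; rewrite cond_swap.
apply/esym/null2_sqr => //.
apply/eqP; rewrite eq_le; apply/andP; split; last first.
  by apply: int_ge0 => x; exact: sqr_ge0.
rewrite -[leRHS](swap_null kl).
apply: le_trans (cond_sqr_le mu_product (l |` A)%fset (bmfB bf bs)).
rewrite le_eqVlt; apply/orP; left; apply/eqP.
by apply: eq_Rintegral => x _; rewrite condB.
Qed.

(** By symmetry every site outside A has the same increment norm d. Infinitely many orthogonal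
    increments fit under the finite norm of f - f_A, so n d is bounded over all n and d = 0. *)
Lemma cond_sqr_fsetU1 A k : N (k |` A)%fset = N A.
Proof.
have [kA|kA] := boolP (k \in A).
  by rewrite (_ : k |` A = A)%fset//; apply/fsetUidPr; rewrite fsub1set.
apply/eqP; rewrite -subr_eq0 -(incr_sqr mu_product A bf k).
set d := (X in X == 0); rewrite eq_le; apply/andP; split; last first.
  by apply: int_ge0 => x; exact: sqr_ge0.
set B := I (fun x => (f x - cond mu A f x) ^+ 2).
have nd n : n%:R * d <= B.
  (* At least n sites remain after removing those of A. *)
  have [C _ Cn] := infinite_set_fset (n + #|` A|) S_infinite.
  pose s := take n (C `\` A)%fset.
  have us : uniq s by rewrite take_uniq// fset_uniq.
  have ss : size s = n.
    rewrite size_take; case: ltnP => // h; apply/eqP; rewrite eqn_leq h /=.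
    rewrite cardfsD -(leq_add2r #|` (C `&` A)%fset|) subnK.
      by apply: leq_trans Cn; rewrite leq_add2l; exact: fsubset_leq_card (fsubsetIr C A).
    exact: fsubset_leq_card (fsubsetIl C A).
  have := bessel mu_product A bf us.
  rewrite -/B big_seq (eq_bigr (fun=> d)).
    by rewrite -big_seq big_const_seq count_predT iter_addr_0 ss mulr_natl.
  move=> l /mem_take; rewrite !inE => /andP[lA _].
  rewrite /d !(incr_sqr mu_product A bf).
  case: (eqVneq l k) => [->//|lk].
  by rewrite (cond_sqr_swap lA kA lk).
rewrite leNgt; apply/negP => d0.
have := nd (Num.truncn (B / d)).+1.
rewrite -ler_pdivlMr// leNgt; case/negP.
have B0 : 0 <= B by apply: int_ge0 => x; exact: sqr_ge0.
by have /andP[] : (Num.truncn (B / d))%:R <= B / d < (Num.truncn (B / d)).+1%:R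
  by apply: truncn_itv; rewrite divr_ge0// ltW.
Qed.

(** The norm of f_A does not depend on A, so |f - f_A| equals |f - I f|, its value for empty A,
    while a suitable A makes it arbitrarily small. *)
Lemma swap_null_const : null2 (fun x => f x - I f).
Proof.
have c0 x : cond mu fset0 f x = I f.
  by apply: eq_Rintegral => y _; congr f; apply/funext => k; rewrite /splice inE.
have N0 A : N A = N fset0.
  elim/finSet_rect: A => A IH; have [->//|[k kA]] := fset_0Vmem A.
  rewrite -(fsetD1K kA) cond_sqr_fsetU1; apply: IH.
  by apply: fproperD1.
rewrite /null2; apply/eqP; rewrite eq_le; apply/andP; split; last first.
  by apply: int_ge0 => x; exact: sqr_ge0.
apply/ler_addgt0Pr => e e0; rewrite add0r.
have [A [h [bh lh fh]]] := approximable_bmf mu bf e0.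
have := le_trans (cond_best mu_product bf bh lh) fh.
rewrite (cond_dist mu_product A bf) N0 -(cond_dist mu_product fset0 bf).
apply: le_trans; rewrite le_eqVlt; apply/orP; left; apply/eqP.
by apply: eq_Rintegral => x _; rewrite c0.
Qed.

End constant.

(** * From neighbouring sites to all pairs *)

Section irreducible.
Context (R : realType) (S : countType).
Local Notation X := (config R S).
Variables (theta : R) (mu : probability X R).
Hypothesis mu_product : is_product_measure (nu theta) mu.
Variables (p : S -> S -> R) (f : X -> R).
Hypothesis p_walk : irreducible_symmetric_walk p.
Hypothesis bf : bmf f.
Hypothesis swap_null : forall a b, a != b -> 0 < p a b ->
  null2 mu (fun x => f x - f (swap a b x)).

Let conn a b := a = b \/ null2 mu (fun x => f x - f (swap a b x)).

(** Conjugation: (a c) = (a b)(b c)(a b), and f - f o (a c) telescopes into three null differences.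
    Equality is part of [conn] because walks may stay in place or return. *)
Let conn_trans a b c : conn a b -> conn b c -> conn a c.
Proof.
move=> [->//|nab] [<-|nbc]; first by right.
have [->|ac] := eqVneq a c; first by left.
have [ab|ab] := eqVneq a b; first by rewrite ab; right.
have [bc|bc] := eqVneq b c; first by rewrite -bc; right.
right.
have sE x : swap a c x = swap a b (swap b c (swap a b x)).
  apply/funext => k; rewrite /swap; congr x; rewrite /transp.
  have [_|ka] := eqVneq k a.
    by rewrite eqxx (eq_sym c a) (negbTE ac) (eq_sym c b) (negbTE bc).
  have [->|kb] := eqVneq k b.
    by rewrite (negbTE bc) (negbTE ab) (negbTE ac) eqxx.
  have [_|kc] := eqVneq k c; rewrite (negbTE kb).
    by rewrite (eq_sym b a) (negbTE ab) eqxx.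
  by rewrite (negbTE ka) (negbTE kb).
pose u x := f x - f (swap a b x); pose v x := f x - f (swap b c x).
have bu : bmf u by apply: bmfB => //; exact: bmf_swap.
have bv : bmf v by apply: bmfB => //; exact: bmf_swap.
rewrite (_ : (fun x => _) =
  fun x => u x + v (swap a b x) + u (swap b c (swap a b x))); last first.
  by apply/funext => x; rewrite sE /u /v; ring.
have bvs := bmf_swap a b bv; have bus := bmf_swap b c bu.
have buss := bmf_swap a b bus.
apply: null2D => //; first exact: bmfD.
  by apply: null2D => //; exact: (null2_swap mu_product).
apply: (null2_swap mu_product a b bus).
exact: (null2_swap mu_product).
Qed.

Let step_prob_ge0 n a b : (0 <= step_prob p n a b)%E.
Proof.
have [p0 _ _ _] := p_walk; elim: n a b => [|n IH] a b /=.
  by rewrite lee_fin ler0n.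
by apply: esum_ge0 => k _; rewrite mule_ge0// lee_fin.
Qed.

(** A positive n-step probability contains a positive first step followed by a positive (n-1)-step
    probability, so the walk provides a chain of neighbours to which transitivity applies. *)
Lemma irreducible_swap_null a b : a != b -> null2 mu (fun x => f x - f (swap a b x)).
Proof.
move=> ab; have [p0 _ _ irr] := p_walk; have [n] := irr a b.
suff H c e : (0 < step_prob p n c e)%E -> conn c e.
  by move=> /H[|//] ab'; move: ab; rewrite ab' eqxx.
elim: n c => [|n IH] c /=; first by case: eqVneq => [->|]; [left|rewrite ltxx].
move=> h; have [k hk] : exists k, (0 < (p c k)%:E * step_prob p n k e)%E.
  apply/not_existsP => H; move: h.
  rewrite esum1 ?ltxx// => k _; apply/eqP; rewrite eq_le; apply/andP; split.
    by rewrite leNgt; apply/negP; exact: H.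
  by rewrite mule_ge0// lee_fin.
have pk : 0 < p c k.
  rewrite lt_neqAle p0 andbT eq_sym; apply: contraPneq hk => ->.
  by rewrite mul0e ltxx.
apply: (conn_trans (b := k)).
  by have [->|ck] := eqVneq c k; [left|right; exact: swap_null].
by apply: IH; move: hk; rewrite pmule_rgt0.
Qed.

End irreducible.

Local Transparent exch.

(** * Finite approximations of the generator *)

Section rsum_approx.
Context (R : realType) (I : choiceType) (D : set I).

Lemma esum_seq_le (b : I -> R) (s : seq I) : (forall k, 0 <= b k) -> uniq s ->
  (forall k, k \in s -> D k) ->
  ((\sum_(k <- s) b k)%:E <= \esum_(k in D) (b k)%:E)%E.
Proof.
move=> b0 us sD; apply: esum_ge; exists [set` s].
  by split; [exact: finite_seq|move=> k /=; exact: sD].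
by rewrite -fsbig_seq// sumEFin.
Qed.

(** One list serves all families dominated by b, which later makes the truncated generator uniform
    in the configuration. The tail of b outside the list is at most e; the tails of the positive and
    negative parts of c lie in [0, e], so their difference is at most e in absolute value. *)
Lemma rsum_approx (b : I -> R) (C e : R) (k0 : I) :
  (forall k, 0 <= b k) ->
  (forall s, uniq s -> (forall k, k \in s -> D k) -> \sum_(k <- s) b k <= C) ->
  0 < e -> D k0 ->
  exists s : seq I, [/\ uniq s, k0 \in s, (forall k, k \in s -> D k) &
    forall c : I -> R, (forall k, `|c k| <= b k) ->
      `|rsum D c - \sum_(k <- s) c k| <= e].
Proof.
move=> b0 bC e0 Dk0; pose B := (\esum_(k in D) (b k)%:E)%E.
have B0 : (0 <= B)%E by apply: esum_ge0 => k _; rewrite lee_fin.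
have setE (X : set I) : fsets D X -> exists s : seq I,
    [/\ uniq s, (forall k, k \in s -> D k) & X = [set` s]].
  move=> [finX XD]; exists (fset_set X); split; first exact: fset_uniq.
    by move=> k; rewrite in_fset_set// => /set_mem; exact: XD.
  by apply/seteqP; split=> k /=; rewrite in_fset_set ?inE.
have BC : (B <= C%:E)%E.
  apply: ge_ereal_sup => _ [X /setE[s [us sD ->]] <-].
  by rewrite -fsbig_seq// sumEFin lee_fin bC.
have Bfin : B \is a fin_num by rewrite ge0_fin_numE// (le_lt_trans BC)// ltry.
have [_ [X /setE[t [ut tD ->]] <-]] := ub_ereal_sup_adherent e0 Bfin.
rewrite -fsbig_seq// sumEFin => Bt0.
have Bt : (B - e%:E < (\sum_(k <- t) b k)%:E)%E := Bt0.
pose s := undup (k0 :: t).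
have us : uniq s by exact: undup_uniq.
have sD k : k \in s -> D k.
  by rewrite mem_undup inE => /orP[/eqP ->//|]; exact: tD.
exists s; split=> //; first by rewrite mem_undup inE eqxx.
have split_s (h : I -> R) : (forall k, 0 <= h k <= b k) ->
    exists2 r, 0 <= r <= e & (\esum_(k in D) (h k)%:E)%E = (\sum_(k <- s) h k + r)%:E.
  have splitE (g : I -> R) : (forall k, 0 <= g k) ->
      (\esum_(k in D) (g k)%:E = (\sum_(k <- s) g k)%:E +
       \esum_(k in D `&` ~` [set` s]) (g k)%:E)%E.
    move=> g0; rewrite (esumID [set` s]); last by move=> k _; rewrite lee_fin.
    congr (_ + _)%E; rewrite (_ : D `&` _ = [set` s]); last first.
      by apply/seteqP; split=> k /= [] //; split=> //; exact: sD.
    rewrite esum_fset; [|exact: finite_seq|by move=> k _; rewrite lee_fin].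
    by rewrite -fsbig_seq// sumEFin.
  move=> hb; have h0 k : 0 <= h k by have /andP[] := hb k.
  pose r := (\esum_(k in D `&` ~` [set` s]) (h k)%:E)%E.
  have r0 : (0 <= r)%E by apply: esum_ge0 => k _; rewrite lee_fin.
  have rb : (r <= \esum_(k in D `&` ~` [set` s]) (b k)%:E)%E.
    by apply: le_esum => k _; rewrite lee_fin; have /andP[] := hb k.
  have be : (\esum_(k in D `&` ~` [set` s]) (b k)%:E <= e%:E)%E.
    have := Bt; rewrite /B (splitE _ b0) lteBlDr// => /ltW.
    have ts : \sum_(k <- t) b k <= \sum_(k <- s) b k.
      rewrite /s /=; case: ifPn => _; rewrite undup_id//.
      by rewrite big_cons lerDr.
    move=> h1; have : ((\sum_(k <- s) b k)%:E +
        \esum_(k in D `&` ~` [set` s]) (b k)%:E <= (\sum_(k <- s) b k)%:E + e%:E)%E.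
      by apply: le_trans h1 _; rewrite -!EFinD lee_fin lerD2r.
    by rewrite leeD2lE.
  have re : (r <= e%:E)%E by exact: le_trans be.
  have rfin : r \is a fin_num by rewrite ge0_fin_numE// (le_lt_trans re)// ltry.
  exists (fine r); first by rewrite -!lee_fin fineK// r0 re.
  by rewrite (splitE _ h0) -/r EFinD fineK.
move=> c cb.
have [|r1 /andP[r10 r1e] E1] := split_s (fun k => Num.max (c k) 0).
  move=> k; rewrite le_max lexx orbT ge_max b0 andbT.
  exact: le_trans (ler_norm _) (cb k).
have [|r2 /andP[r20 r2e] E2] := split_s (fun k => Num.max (- c k) 0).
  move=> k; rewrite le_max lexx orbT ge_max b0 andbT.
  by apply: le_trans (ler_norm _) _; rewrite normrN.
have -> : rsum D c = \sum_(k <- s) c k + (r1 - r2).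
  rewrite /rsum (_ : (EFin \o c)^\+%E = (fun k => (Num.max (c k) 0)%:E)); last first.
    by apply/funext => k; rewrite funeposE /= EFin_max.
  rewrite (_ : (EFin \o c)^\-%E = (fun k => (Num.max (- c k) 0)%:E)); last first.
    by apply/funext => k; rewrite funenegE /= EFin_max.
  rewrite E1 E2 /=.
  rewrite -[LHS]/(\sum_(k <- s) Num.max (c k) 0 + r1 - (\sum_(k <- s) Num.max (- c k) 0 + r2)).
  have -> : \sum_(k <- s) c k =
      \sum_(k <- s) Num.max (c k) 0 - \sum_(k <- s) Num.max (- c k) 0.
    rewrite -sumrB; apply: eq_bigr => k _.
    by rewrite /Num.max oppr_lt0; case: (ltrgtP (c k) 0) => [_|_|->];
      rewrite !(oppr0, subr0, sub0r, opprK).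
  ring.
by rewrite addrAC subrr add0r ler_norml; lra.
Qed.

End rsum_approx.

Section walk.
Context (R : realType) (S : countType) (p : S -> S -> R).
Hypothesis p_walk : irreducible_symmetric_walk p.

Lemma walk_ge0 i j : 0 <= p i j. Proof. by have [] := p_walk. Qed.

Lemma walk_sym i j : p i j = p j i. Proof. by have [] := p_walk. Qed.

Lemma walk_le1 i t : uniq t -> \sum_(j <- t) p i j <= 1.
Proof.
have [p0 _ p1 _] := p_walk => ut.
by rewrite -lee_fin -(p1 i); apply: esum_seq_le.
Qed.

(** Each site of A contributes at most one row sum as first site and one as second site. *)
Lemma walk_touch (A : {fset S}) (s : seq (S * S)) : uniq s ->
  \sum_(ij <- s) p ij.1 ij.2 * ((ij.1 \in A)%:R + (ij.2 \in A)%:R) <= 2 * #|` A|%:R.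
Proof.
move=> us; have d0 (i : S) : 0 <= (i \in A)%:R :> R by rewrite ler0n.
have cA t : uniq t -> \sum_(i <- t) (i \in A)%:R <= #|` A|%:R :> R.
  move=> ut; rewrite -natr_sum ler_nat.
  have -> : (\sum_(i <- t) (i \in A) = size [seq i <- t | i \in A])%N.
    rewrite size_filter -sum1_count [RHS]big_mkcond.
    by apply: eq_bigr => i _; case: (i \in A).
  apply: uniq_leq_size; first exact: filter_uniq.
  by move=> i; rewrite mem_filter => /andP[].
have h1 := sum_rows_le walk_le1 d0 us.
have uswap : uniq [seq (ij.2, ij.1) | ij <- s].
  by rewrite map_inj_uniq// => -[u v] [c d] [-> ->].
have h2 := sum_rows_le walk_le1 d0 uswap.
have h1' := le_trans h1 (cA _ (undup_uniq _)).
have {h2} h2' := le_trans h2 (cA _ (undup_uniq _)).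
move: h2'; rewrite big_map/= (eq_bigr (fun ij => p ij.1 ij.2 * (ij.2 \in A)%:R)); last first.
  by move=> ij _; rewrite walk_sym.
under [X in _ -> X <= _]eq_bigr do rewrite mulrDr.
by rewrite big_split/= mulr_natl mulr2n => h2; exact: lerD.
Qed.

End walk.

Section generator_approx.
Context (R : realType) (S : countType) (p : S -> S -> R).
Hypothesis p_walk : irreducible_symmetric_walk p.
Local Notation X := (config R S).
Local Notation la := (@lebesgue_measure R).
Local Notation RR := (measurableTypeR R).

Lemma int_unifE (h : RR -> R) : bmf h ->
  \int[@unif R]_u h u = \int[la]_(u in `[0, 1]) h u.
Proof.
move=> bh; rewrite (int_density (la := la) (D := `[0, 1]%classic) (rho := fun=> 1))//.
- by apply: eq_Rintegral => u _; rewrite mulr1.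
- move=> B mB; transitivity (\int[@unif R]_u (\1_B u)%:E)%E.
    by rewrite integral_indic// setIT.
  rewrite integral_unif//; last by apply/measurable_EFinP; exact: measurable_indic.
  rewrite [RHS]integral_mkcondl; apply: eq_integral => u _.
  by rewrite patchE indicE; case: (u \in B).
Qed.

Lemma generatorE (g : X -> R) x : bmf g -> generator p g x =
  rsum (@distinct_pairs S) (fun ij => p ij.1 ij.2 * (exch ij.1 ij.2 g x - g x)).
Proof.
move=> bg; rewrite /generator; congr (rsum _ _); apply/funext => ij.
congr (_ * _); have -> : exch ij.1 ij.2 g x - g x = exch ij.1 ij.2 (fun y => g y - g x) x.
  by rewrite exchB// exch_cst.
have bgx : bmf (fun y => g y - g x) by apply: bmfB.
rewrite /exch int_unifE; last exact: bmf_exchange_u ij.1 ij.2 _ x bgx.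
apply: eq_Rintegral => u _; rewrite int_unifE//.
exact: bmf_exchange_v ij.1 ij.2 _ u x bgx.
Qed.

Definition fin_gen (s : seq (S * S)) (g : X -> R) x : R :=
  \sum_(ij <- s) p ij.1 ij.2 * (exch ij.1 ij.2 g x - g x).

Lemma bmf_fin_gen s g : bmf g -> bmf (fin_gen s g).
Proof.
move=> bg; apply: bmf_sum => ij; apply: bmfZ; apply: bmfB => //.
exact: bmf_exch.
Qed.

(** Pairs outside A do not change g, and those meeting A have total mass at most 2 |A|, so the
    series is dominated uniformly in x. *)
Lemma generator_approx A (g : X -> R) (e : R) a b : bmf g -> local_on A g ->
  0 < e -> a != b ->
  exists s : seq (S * S), [/\ uniq s, (a, b) \in s, (forall ij, ij \in s -> ij.1 != ij.2) &
    forall x, `|generator p g x - fin_gen s g x| <= e].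
Proof.
move=> bg lg e0 ab; have [_ [M gM]] := bg.
have M0 : 0 <= M by apply: le_trans (gM (fun=> 0)).
(* The dominating family: |E_ij g - g| <= 2M on pairs meeting A. A pair inside A is counted twice,
   which is harmless for an upper bound. *)
pose c (ij : S * S) : R := p ij.1 ij.2 * ((ij.1 \in A)%:R + (ij.2 \in A)%:R) * (2 * M).
have p0 := walk_ge0 p_walk.
have c0 ij : 0 <= c ij by rewrite /c !mulr_ge0// addr_ge0// ler0n.
have cC s : uniq s -> (forall ij, ij \in s -> distinct_pairs ij) ->
    \sum_(ij <- s) c ij <= 2 * #|` A|%:R * (2 * M).
  by move=> us _; rewrite -mulr_suml ler_wpM2r ?mulr_ge0//; exact: walk_touch.
have [s [us abs sD H]] := rsum_approx c0 cC e0 (ab : distinct_pairs (a, b)).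
exists s; split=> // x; rewrite generatorE//; apply: H => -[i j] /=.
rewrite normrM ger0_norm// /c/= -mulrA ler_wpM2l//.
have E : `|exch i j g x - g x| <= 2 * M.
  apply: le_trans (ler_normB _ _) _; rewrite mulr2n mulrDl mul1r.
  by apply: lerD => //; exact: exch_norm_le.
have [iA|iA] := boolP (i \in A); last have [jA|jA] := boolP (j \in A).
- by apply: le_trans E _; rewrite ler_peMl ?mulr_ge0// lerDl ler0n.
- by rewrite add0r mul1r.
- by rewrite (exch_out x iA jA lg) subrr normr0 addr0 mul0r.
Qed.

End generator_approx.

(** * Invariance of the product measure *)

Local Opaque exch.

Section kernel_mixture.
Context (R : realType) d (T : measurableType d) d' (T' : measurableType d').
Variables (m : {measure set T -> \bar R}) (k : R.-pker T ~> T').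

Let mix B := (\int[m]_x k x B)%E.

Let mix0 : mix set0 = 0%E.
Proof. by rewrite /mix (eq_integral (cst 0%E)) ?integral0// => x _; rewrite measure0. Qed.

Let mix_ge0 B : (0 <= mix B)%E. Proof. exact: integral_ge0. Qed.

Let mix_sigma_additive : semi_sigma_additive mix.
Proof.
move=> U mU tU mUU; rewrite [X in _ --> X](_ : _ =
  \int[m]_x (\sum_(n <oo) k x (U n)))%E; last first.
  apply: eq_integral => x _.
  by apply/esym/cvg_lim => //; exact/measure_semi_sigma_additive.
apply/cvg_closeP; split.
  by apply: is_cvg_nneseries => n _ _; exact: integral_ge0.
rewrite closeE// integral_nneseries// => n.
exact: measurable_kernel.
Qed.

HB.instance Definition _ := isMeasure.Build _ _ _ mix mix0 mix_ge0 mix_sigma_additive.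

Lemma mixture_exists : exists m' : {measure set T' -> \bar R},
  forall B, m' B = (\int[m]_x k x B)%E.
Proof. by exists (mix : {measure set T' -> \bar R}). Qed.

End kernel_mixture.

(** * Measures carried by a subset *)

Section on_domain.
Context (R : realType) d (T : measurableType d) (D : set T).
Variable m : {measure set T -> \bar R}.
Hypotheses (mD : measurable D) (m1 : m setT = 1%E) (mD1 : m D = 1%E).

Let mfin : (m setT < +oo)%E. Proof. by rewrite m1 ltry. Qed.

Lemma int_on (f : T -> R) : bmf f -> \int[m]_x f x = \int[m]_x (f x * \1_D x).
Proof.
move=> bf; apply/eqP; rewrite -subr_eq0 -intB; auto.
rewrite -normr_le0; have [_ [M fM]] := bf.
have bD : bmf (\1_D : T -> R) by exact: bmf_indic.
have -> : \int[m]_x (f x - f x * \1_D x) = \int[m]_x (f x * (1 - \1_D x)).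
  by apply: eq_Rintegral => x _; rewrite mulrBr mulr1.
have b1 : bmf (fun x => 1 - \1_D x : R) by auto.
apply: le_trans (le_normr_Rintegral _ _) _ => //; first by apply: bmf_integrable; auto.
apply: (@le_trans _ _ (\int[m]_x (M * (1 - \1_D x)))).
  apply: int_le => //; auto.
    split; first by apply: measurableT_comp => //; exact: (bmfM bf b1).1.
    by have [_ [N fN]] := bmfM bf b1; exists N => x; rewrite normr_id.
  move=> x; have D01 : 0 <= 1 - \1_D x :> R.
    by rewrite indicE; case: (x \in D); rewrite ?subrr ?subr0.
  by rewrite normrM (ger0_norm D01) ler_wpM2r.
rewrite intZ// intB// int_cst int_indic//.
by rewrite m1 mD1 mul1r subrr mulr0.
Qed.

(** Semigroup identities and generator bounds hold on [Omega] only; for measures carried by [Omega]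
    this suffices. *)
Lemma eq_int_on (f g : T -> R) : bmf f -> bmf g -> (forall x, D x -> f x = g x) ->
  \int[m]_x f x = \int[m]_x g x.
Proof.
move=> bf bg fg; rewrite (int_on bf) (int_on bg); apply: eq_Rintegral => x _.
rewrite indicE; have [/set_mem Dx|] := boolP (x \in D); last by rewrite !mulr0.
by rewrite fg.
Qed.

Lemma int_norm_le_on (f : T -> R) (M : R) : 0 <= M -> bmf f ->
  (forall x, D x -> `|f x| <= M) -> `|\int[m]_x f x| <= M.
Proof.
move=> M0 bf fM; rewrite int_on//; apply: int_norm_le1 => //.
  by apply: bmfM => //; exact: bmf_indic.
move=> x; rewrite indicE; have [/set_mem Dx|] := boolP (x \in D).
  by rewrite mulr1 fM.
by rewrite mulr0 normr0.
Qed.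

End on_domain.

(** * Growth estimates from small increments *)

Section discrete_gronwall.
Context (R : realType).

Lemma exprD_ge (x h : R) k : 0 <= x -> 0 <= h ->
  x ^+ k.+1 + k.+1%:R * h * x ^+ k <= (x + h) ^+ k.+1.
Proof.
move=> x0 h0; elim: k => [|k IH]; first by rewrite !expr1 expr0 mulr1 mul1r.
rewrite [leRHS]exprS; apply: le_trans (ler_wpM2l (addr_ge0 x0 h0) IH).
rewrite -subr_ge0 [X in 0 <= X](_ : _ = k.+1%:R * h ^+ 2 * x ^+ k).
  by rewrite !mulr_ge0// ?exprn_ge0.
by rewrite (exprS x k.+1) (exprS x k) -(natr1 k.+1); ring.
Qed.

(** Time is cut into n equal steps. The increments form a left Riemann sum of the nondecreasing
    function b s^k, which stays below its integral; [exprD_ge] is this comparison on one step. *)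
Lemma power_growth (phi : R -> R) (k : nat) (b : R) :
  0 <= b -> phi 0 = 0 ->
  (forall e, 0 < e -> exists2 h0, 0 < h0 & forall t h, 0 <= t -> 0 < h < h0 ->
     `|phi (t + h) - phi t| <= h * (b * t ^+ k + e)) ->
  forall t, 0 <= t -> `|phi t| <= b * t ^+ k.+1 / k.+1%:R.
Proof.
move=> b0 phi0 H t; rewrite le_eqVlt => /predU1P[<-|t0].
  by rewrite phi0 normr0 expr0n mulr0 mul0r.
apply/ler_addgt0Pr => e e0.
(* An error rate e/t accumulates to e over the time t. *)
have et : 0 < e / t by rewrite divr_gt0.
have [h0 h00 Hh] := H _ et.
pose n := (Num.truncn (t / h0)).+1.
have nlt : t / h0 < n%:R.
  by have /andP[] : (Num.truncn (t / h0))%:R <= t / h0 < n%:R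
    by apply: truncn_itv; rewrite divr_ge0 ?ltW.
have n0 : 0 < n%:R :> R by rewrite ltr0n.
pose h := t / n%:R.
have hpos : 0 < h by rewrite divr_gt0.
have hh0 : 0 < h < h0.
  by rewrite hpos /h ltr_pdivrMr// -ltr_pdivrMl// mulrC.
have step m : `|phi (m%:R * h)| <=
    b * (m%:R * h) ^+ k.+1 / k.+1%:R + m%:R * h * (e / t).
  elim: m => [|m IH]; first by rewrite !mul0r phi0 normr0 expr0n mulr0 mul0r addr0.
  have mh0 : 0 <= m%:R * h by rewrite mulr_ge0 ?(ltW hpos).
  have -> : m.+1%:R * h = m%:R * h + h by rewrite -natr1 mulrDl mul1r.
  set x := m%:R * h in IH mh0 *.
  have := Hh x h mh0 hh0.
  have := exprD_ge k mh0 (ltW hpos).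
  have k0 : 0 < k.+1%:R :> R by rewrite ltr0n.
  move=> h1 h2.
  have h3 : b * (x ^+ k.+1 / k.+1%:R + h * x ^+ k) <= b * ((x + h) ^+ k.+1 / k.+1%:R).
    apply: ler_wpM2l => //; rewrite ler_pdivlMr// mulrDl divfK ?gt_eqF//.
    by apply: le_trans h1; rewrite lerD2l mulrC mulrA.
  have h4 : `|phi (x + h)| <= `|phi (x + h) - phi x| + `|phi x|.
    by apply: le_trans (ler_normD _ _); rewrite subrK.
  apply: le_trans h4 _; apply: le_trans (lerD h2 IH) _.
  rewrite -[b * (x + h) ^+ _ / _]mulrA.
  have -> : h * (b * x ^+ k + e / t) + (b * x ^+ k.+1 / k.+1%:R + x * (e / t)) =
    b * (x ^+ k.+1 / k.+1%:R + h * x ^+ k) + (x + h) * (e / t) by ring.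
  by rewrite lerD2r.
have := step n; have -> : n%:R * h = t by rewrite /h mulrC divfK// gt_eqF.
by rewrite (mulrC t (e / t)) divfK// gt_eqF.
Qed.

Lemma bin_le_exp2 n k : ('C(n, k) <= 2 ^ n)%N.
Proof.
elim: n k => [|n IH] [|k]; rewrite ?bin0 ?bin0n ?expn_gt0// binS expnS mul2n -addnn.
by rewrite leq_add.
Qed.

End discrete_gronwall.

Local Opaque exch.

(** * The state space has full measure *)

Section omega.
Context (R : realType) (S : countType).
Local Notation X := (config R S).
Local Notation Om := (@Omega R S).
Variables (theta : R) (mu : probability X R).
Hypothesis mu_product : is_product_measure (nu theta) mu.

(** A countable intersection, indexed by the codes of sites; an integer that codes no site
    contributes the whole space. *)
Lemma measurable_Omega : measurable Om.
Proof.
have mi (i : S) : measurable [set x : X | 0 <= x i].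
  rewrite (_ : mkset _ = (fun x : X => x i) @^-1` `[0, +oo[); last first.
    by apply/seteqP; split=> x /=; rewrite in_itv/= ?andbT.
  by rewrite -[_ @^-1` _]setTI; apply: measurable_site => //; exact: measurable_itv.
rewrite (_ : Om = \bigcap_n (if @choice.unpickle S n is Some i then [set x : X | 0 <= x i] else setT)).
  by apply: bigcapT_measurable => n; case: choice.unpickle.
apply/seteqP; split=> x /= Ox; first by move=> n _; case: choice.unpickle => //= i; exact: Ox.
by move=> i; have := Ox (choice.pickle i) Logic.I; rewrite choice.pickleK.
Qed.

Lemma mu_Omega : mu Om = 1%E.
Proof.
suff H : mu (~` Om) = 0%E.
  have := probability_setC mu measurable_Omega; rewrite H => h.
  have fO : mu Om \is a fin_num by apply: fin_num_measure; exact: measurable_Omega.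
  by move: h; rewrite -(fineK fO) -EFinB => -[] h; congr (_%:E); lra.
have mi (i : S) : measurable [set x : X | x i < 0].
  rewrite (_ : mkset _ = (fun x : X => x i) @^-1` `]-oo, 0[); last first.
    by apply/seteqP; split=> x /=; rewrite in_itv/= ?andbT.
  by rewrite -[_ @^-1` _]setTI; apply: measurable_site => //; exact: measurable_itv.
have n0 (i : S) : mu [set x : X | x i < 0] = 0%E.
  have mB : forall k : S, measurable (`]-oo, 0[%classic : set (measurableTypeR R)).
    by move=> _; exact: measurable_itv.
  have := mu_rect mu_product [fset i]%fset mB.
  rewrite big_seq_fset1 /nu (_ : _ `&` _ = set0) ?integral_set0; last first.
    apply/seteqP; split=> z //=; rewrite !in_itv/= andbT => -[].
    by rewrite ltNge => /negP.
  move=> <-; congr (mu _); apply/seteqP; split=> x /=.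
    by move=> h j; rewrite inE => /eqP -> /=; rewrite in_itv.
  by move=> /(_ i); rewrite inE eqxx => /(_ isT) /=; rewrite in_itv.
have : mu.-negligible (\bigcup_n (if @choice.unpickle S n is Some i then [set x : X | x i < 0] else set0)).
  apply: negligible_bigcup => n; case: choice.unpickle => [i|]; last exact: negligible_set0.
  by apply/negligibleP => //; exact: n0.
move=> [N [mN N0 sub]]; apply/eqP; rewrite eq_le measure_ge0 andbT -N0.
apply: le_measure; rewrite ?inE//; first by apply: measurableC; exact: measurable_Omega.
apply: subset_trans sub => x /= /existsNP[i] /negP; rewrite -ltNge => xi.
by exists (choice.pickle i) => //=; rewrite choice.pickleK.
Qed.

End omega.

(** * The defect of invariance at small times *)

Section invariance.
Context (R : realType) (S : countType) (p : S -> S -> R).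
Local Notation X := (config R S).
Local Notation Om := (@Omega R S).
Variables (theta : R) (mu : probability X R) (P : R -> R.-pker X ~> X).
Hypothesis theta0 : 0 < theta.
Hypothesis mu_product : is_product_measure (nu theta) mu.
Hypothesis p_walk : irreducible_symmetric_walk p.
Hypothesis P_process : process_semigroup p P.
Hypothesis S_infinite : infinite_set [set: S].
Local Notation I f := (\int[mu]_x f x)%R.
Implicit Types (A : {fset S}) (f g : X -> R) (x y : X).

Let op t f x : R := \int[P t x]_y f y.

Let mOm : measurable Om := @measurable_Omega R S.

Lemma bmf_op t f : bmf f -> bmf (op t f).
Proof. exact: bmf_kernel. Qed.

Lemma op_Omega t x : 0 <= t -> Om x -> P t x Om = 1%E.
Proof. by have [[H _ _] _] := P_process; exact: H. Qed.

Lemma op0 f x : Om x -> bmf f -> op 0 f x = f x.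
Proof.
move=> Ox bf; have [[_ H _] _] := P_process.
rewrite /op; have -> : \int[P 0 x]_y f y = \int[\d_x : {measure set X -> \bar R}]_y f y.
  by apply: int_eq_measure => B mB; rewrite H.
rewrite /Rintegral integral_dirac//; last by apply/measurable_EFinP; exact: bf.1.
by rewrite diracT mul1e.
Qed.

Lemma opD s t f x : 0 <= s -> 0 <= t -> Om x -> bmf f ->
  op (s + t) f x = op s (op t f) x.
Proof.
move=> s0 t0 Ox bf; have [[_ _ H] _] := P_process.
apply: (blf_ext (F := fun f => op (s + t) f x) (G := fun f => op s (op t f) x)) bf.
- exact: (blf_int1 (kernel_fin (P (s + t)) x)).
- have [ls [Cs bs]] := blf_int1 (kernel_fin (P s) x).
  split=> [a f1 f2 b1 b2|].
    rewrite -[RHS]ls; try exact: bmf_op.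
    apply: eq_Rintegral => y _.
    by have [lt _] := blf_int1 (kernel_fin (P t) y); exact: lt.
  exists Cs => f1 M b1 f1M; apply: bs; first exact: bmf_op.
  by move=> y; apply: int_norm_le1 => //; exact: prob_kernel.
- move=> B mB; rewrite /op int_indic// H//.
  congr fine; apply: eq_integral => y _.
  rewrite int_indic// fineK// ge0_fin_numE//.
  apply: le_lt_trans (kernel_fin (P t) y).
  by apply: le_measure; rewrite ?inE.
Qed.

(** Both the derivative at 0 and the truncation of the generator are uniform over [Omega]; each
    receives half of e. The prescribed pair (a, b) is the one singled out in [harmonic_gap]. *)
Lemma step_approx A g (e : R) a b : bmf g -> local_on A g -> 0 < e -> a != b ->
  exists (s : seq (S * S)) (h0 : R), [/\ uniq s, (a, b) \in s, (forall ij, ij \in s -> ij.1 != ij.2), 0 < h0 &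
    forall (h : R) x, 0 < h < h0 -> Om x ->
      `|(op h g x - g x) - h * fin_gen p s g x| <= h * e].
Proof.
move=> bg lg e0 ab; have e2 : 0 < e / 2 by rewrite divr_gt0.
have [s [us abs sD Hs]] := generator_approx p_walk bg lg e2 ab.
have [_ H] := P_process.
have lfg : local_function g by exists A.
have := H g bg.1 (bmf_bounded bg) lfg (e / 2) e2.
move=> [h0 /= h00 Hh].
exists s, h0; split=> // h x /andP[hpos hh] Ox.
have := Hh h; rewrite /ball_ /= sub0r normrN gtr0_norm// => /(_ hh hpos x Ox).
have := Hs x; set L := generator p g x; set F := fin_gen p s g x.
rewrite -/(op h g x); set D := op h g x - g x => h1 h2.
have -> : D - h * F = h * (D / h - L + (L - F)) by field; rewrite gt_eqF.
rewrite normrM gtr0_norm//; apply: ler_wpM2l; first exact: ltW.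
by apply: le_trans (ler_normD _ _) _; rewrite [e]splitr lerD.
Qed.

Let phi t f := I (op t f).

Let phi_norm_le t f M : 0 <= M -> 0 <= t -> bmf f ->
  (forall x, Om x -> `|f x| <= M) -> `|phi t f| <= M.
Proof.
move=> M0 t0 bf fM; apply: (int_norm_le_on mOm (probability_setT mu) (mu_Omega mu_product)) => //.
  exact: bmf_op.
move=> x Ox; apply: (int_norm_le_on mOm) => //; first exact: prob_kernel.
exact: op_Omega.
Qed.

Let phiD t h f : 0 <= t -> 0 <= h -> bmf f -> phi (t + h) f = phi t (op h f).
Proof.
move=> t0 h0 bf; apply: (eq_int_on mOm (probability_setT mu) (mu_Omega mu_product)).
- exact: bmf_op.
- by apply: bmf_op; exact: bmf_op.
- by move=> x Ox; exact: opD.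
Qed.

Let blf_phi t : blf (phi t).
Proof.
split=> [a f g bf bg|].
  rewrite /phi -intZ; auto; last exact: bmf_op.
  rewrite -intD//; last 2 first.
  - by apply: bmfZ; exact: bmf_op.
  - exact: bmf_op.
  apply: eq_Rintegral => x _.
  by have [l _] := blf_int1 (kernel_fin (P t) x); exact: l.
exists 1 => f M bf fM; rewrite mul1r; apply: int_norm_le1 => //.
- exact: (probability_setT mu).
- exact: bmf_op.
by move=> x; apply: int_norm_le1 => //; exact: prob_kernel.
Qed.

Let phiB t f g : bmf f -> bmf g -> phi t (fun x => f x - g x) = phi t f - phi t g.
Proof.
move=> bf bg; have -> : (fun x => f x - g x) = (fun x => (-1) * g x + f x).
  by apply/funext => x; rewrite mulN1r addrC.
by rewrite (blf_phi t).1// mulN1r addrC.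
Qed.

Let phi_fin_gen t s g : bmf g -> phi t (fin_gen p s g) =
  \sum_(ij <- s) p ij.1 ij.2 * (phi t (exch ij.1 ij.2 g) - phi t g).
Proof.
move=> bg; have b ij : bmf (fun x => p ij.1 ij.2 * (exch ij.1 ij.2 g x - g x)).
  by apply: bmfZ; apply: bmfB => //; exact: bmf_exch.
elim: s => [|ij s IH].
  rewrite big_nil; have -> : fin_gen p [::] g = (fun x => g x - g x).
    by apply/funext => x; rewrite /fin_gen big_nil subrr.
  by rewrite phiB// subrr.
rewrite big_cons -IH -phiB//; last exact: bmf_exch.
rewrite -(blf_phi t).1; last 2 first.
- by apply: bmfB => //; exact: bmf_exch.
- exact: bmf_fin_gen.
by congr (phi t _); apply/funext => x; rewrite /fin_gen big_cons.
Qed.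

(** Supplies the pair that [step_approx] asks for when no particular pair matters. *)
Let two_sites : exists a c : S, a != c.
Proof.
have [C _ Cn] := infinite_set_fset 2 S_infinite.
case: (enum_fset C) (fset_uniq C) Cn => [|a [|c r]]//= /andP[+ _] _.
by rewrite inE negb_or => /andP[ac _]; exists a, c.
Qed.

Let local_exch A g i j : local_on A g -> local_on (i |` (j |` A))%fset (exch i j g).
Proof.
move=> lg; apply: exch_local; rewrite ?inE ?eqxx ?orbT//.
by apply: local_on_sub lg; apply/fsubsetP => k kA; rewrite !inE kA !orbT.
Qed.

(* If g depends on n sites then, E_ij preserving mu, the time derivative of
   mu (P_t g) - mu g is a sum over the pairs meeting these sites of differences
   of the same kind for functions of n + 1 sites; as the kernel p has total
   mass at most 2 n on these pairs, [bound k.+1 n] is the integral of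
   4 n times [bound k n.+1]. *)
Let bound k n (t : R) : R := 2 * (4 * t) ^+ k * 'C((n + k).-1, k)%:R.

Lemma phi_close (k n : nat) A g (t : R) : bmf g -> local_on A g ->
  (forall x, `|g x| <= 1) -> (#|` A| <= n)%N -> 0 <= t ->
  `|phi t g - I g| <= bound k n t.
Proof.
elim: k n A g t => [|k IH] n A g t bg lg g1 An t0.
  rewrite /bound expr0 bin0 !mulr1; apply: le_trans (ler_normB _ _) _.
  rewrite -[2]/(1 + 1); apply: lerD; first by apply: phi_norm_le.
  by apply: int_norm_le1 => //; exact: (probability_setT mu).
(* Chosen so that b s^k equals 4 n times [bound k n.+1 s]: mass 2n for the pairs meeting the sites,
   and two defects for each pair. *)
pose b : R := 4 * n%:R * (2 * 4 ^+ k * 'C(n + k, k)%:R).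
have b0 : 0 <= b by rewrite !mulr_ge0// exprn_ge0.
have phi0 : phi 0 g - I g = 0.
  apply/eqP; rewrite subr_eq0; apply/eqP.
  apply: (eq_int_on mOm (probability_setT mu) (mu_Omega mu_product)) => //.
    exact: bmf_op.
  by move=> x Ox; exact: op0.
have := @power_growth _ (fun t => phi t g - I g) k b b0 phi0 _ t t0.
have -> : b * t ^+ k.+1 / k.+1%:R = bound k.+1 n t.
  rewrite /bound addnS /= /b exprMn (exprS 4).
  have k0 : k.+1%:R != 0 :> R by rewrite pnatr_eq0.
  (* The factor k+1 cancels the denominator produced by integrating s^k. *)
  have E : n%:R * 'C(n + k, k)%:R = k.+1%:R * 'C(n + k, k.+1)%:R :> R.
    by rewrite -!natrM mul_bin_left addnK.
  have -> : 4 * n%:R * (2 * 4 ^+ k * 'C(n + k, k)%:R) * t ^+ k.+1 / k.+1%:R =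
    2 * (4 * 4 ^+ k * t ^+ k.+1) * (n%:R * 'C(n + k, k)%:R / k.+1%:R) by ring.
  by rewrite E [X in _ * X]mulrAC divff// mul1r.
apply=> e e0.
have [a [c ac]] := two_sites.
have [s [h0 [us abs sD h00 Hs]]] := step_approx bg lg e0 ac.
exists h0 => // s0 h s00 hh.
have h0' : 0 <= h by case/andP: hh => /ltW.
have drift : `|phi s0 (fin_gen p s g)| <= b * s0 ^+ k.
  rewrite phi_fin_gen//.
  have bs : 0 <= bound k n.+1 s0 by rewrite /bound !mulr_ge0// exprn_ge0// mulr_ge0.
  apply: (@le_trans _ _ (\sum_(ij <- s) p ij.1 ij.2 *
      ((ij.1 \in A)%:R + (ij.2 \in A)%:R) * (2 * bound k n.+1 s0))).
    apply: le_trans (ler_norm_sum _ _ _) _.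
    rewrite big_seq [leRHS]big_seq; apply: ler_sum => -[i j] /sD /= ij.
    rewrite normrM ger0_norm ?walk_ge0// -mulrA; apply: ler_wpM2l.
      exact: walk_ge0.
    have be : bmf (exch i j g) by exact: bmf_exch.
    have touch : (i \in A) || (j \in A) ->
        `|phi s0 (exch i j g) - phi s0 g| <= 2 * bound k n.+1 s0.
      (* Since E_ij g and g have the same mean, the difference is one of two defects of invariance,
         to which the induction hypothesis applies: as i or j lies in A, both functions depend on at
         most n + 1 sites. *)
      move=> ijA; have -> : phi s0 (exch i j g) - phi s0 g =
          (phi s0 (exch i j g) - I (exch i j g)) - (phi s0 g - I g).
        by rewrite (int_exch_inv theta0 mu_product ij bg) opprB addrA subrK.
      apply: le_trans (ler_normB _ _) _; rewrite mulr2n mulrDl mul1r; apply: lerD.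
        apply: (IH n.+1 (i |` (j |` A))%fset (exch i j g) s0 be (@local_exch A g i j lg) _ _ s00).
          by move=> x; apply: exch_norm_le.
        case/orP: ijA => kA.
          rewrite (_ : i |` _ = j |` A)%fset; last first.
            by apply/fsetUidPr; rewrite fsub1set !inE kA orbT.
          by rewrite cardfsU1 -(add1n n) leq_add// leq_b1.
        rewrite (_ : j |` A = A)%fset; last by apply/fsetUidPr; rewrite fsub1set.
        by rewrite cardfsU1 -(add1n n) leq_add// leq_b1.
      exact: (IH n.+1 A g s0 bg lg g1 (leqW An) s00).
    have [iA|iA] := boolP (i \in A); last have [jA|jA] := boolP (j \in A).
    - apply: le_trans (touch _) _; first by rewrite iA.
      apply: ler_peMl; first exact: mulr_ge0.
      by rewrite -[leLHS]/(true%:R) lerDl ler0n.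
    - by rewrite add0r mul1r touch// jA orbT.
    - rewrite addr0 mul0r; have -> : exch i j g = g.
        by apply/funext => x; exact: exch_out iA jA lg.
      by rewrite subrr normr0.
  rewrite -mulr_suml.
  apply: (@le_trans _ _ (2 * n%:R * (2 * bound k n.+1 s0))).
    apply: ler_wpM2r; first by rewrite mulr_ge0.
    apply: le_trans (walk_touch p_walk A us) _.
    by rewrite ler_wpM2l// ler_nat.
  by rewrite /bound /b addSn/= exprMn le_eqVlt; apply/orP; left; apply/eqP; ring.
have bo : bmf (op h g) by exact: bmf_op.
(* The increment is the remainder of the first-order expansion of P_h g, at most h e on [Omega],
   plus h times the drift. *)
have -> : phi (s0 + h) g - I g - (phi s0 g - I g) =
    phi s0 (fun x => op h g x - g x - h * fin_gen p s g x) + h * phi s0 (fin_gen p s g).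
  have bF : bmf (fin_gen p s g) by exact: bmf_fin_gen.
  rewrite phiB; [|exact: bmfB|exact: bmfZ].
  rewrite phiB// -phiD//.
  have -> : phi s0 (fun x => h * fin_gen p s g x) = h * phi s0 (fin_gen p s g).
    have bz : bmf (fun x => g x - g x) by exact: bmfB.
    have := (blf_phi s0).1 h _ _ bF bz; rewrite phiB// subrr addr0 => <-.
    by congr (phi s0 _); apply/funext => x; rewrite subrr addr0.
  by rewrite subrK opprB addrA subrK.
apply: le_trans (ler_normD _ _) _; rewrite mulrDr addrC; apply: lerD.
  by rewrite normrM ger0_norm// ler_wpM2l.
apply: phi_norm_le => //; first by rewrite mulr_ge0// ltW.
  apply: bmfB; [exact: bmfB|by apply: bmfZ; exact: bmf_fin_gen].
by move=> x Ox; exact: Hs.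
Qed.

Let inv t := forall f, bmf f -> phi t f = I f.

(** For t <= 1/16 one has (4t)^k <= 4^-k, while the binomial coefficient is at most 2^(n+k): the
    defect is at most 2^(n+1) / 2^k for every k. *)
Let phi_small A g t : bmf g -> local_on A g -> (forall x, `|g x| <= 1) ->
  0 <= t <= 16^-1 -> phi t g = I g.
Proof.
move=> bg lg g1 /andP[t0 t16]; apply/eqP; rewrite -subr_eq0 -normr_le0.
apply/ler_addgt0Pr => e e0; rewrite add0r.
pose n := #|` A|; pose c : R := 2 * 2 ^+ n.
have c0 : 0 < c by rewrite mulr_gt0// exprn_gt0.
pose k := (Num.truncn (c / e)).+1.
have klt : c / e < k%:R.
  by have /andP[] : (Num.truncn (c / e))%:R <= c / e < k%:R
    by apply: truncn_itv; rewrite divr_ge0 ?ltW.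
apply: le_trans (phi_close k bg lg g1 (leqnn _) t0) _.
have k2 : k%:R <= 2 ^+ k :> R by rewrite -natrX ler_nat ltnW// ltn_expl.
have kk : 0 < 2 ^+ k :> R by rewrite exprn_gt0.
apply: (@le_trans _ _ (2 * 4^-1 ^+ k * 2 ^+ (n + k))).
  rewrite /bound; apply: ler_pM.
  - by rewrite mulr_ge0// exprn_ge0// mulr_ge0.
  - by rewrite ler0n.
  - rewrite ler_wpM2l//; apply: lerXn2r; rewrite ?nnegrE ?mulr_ge0//; lra.
  - rewrite -natrX ler_nat; apply: leq_trans (bin_le_exp2 _ _) _.
    by rewrite leq_exp2l// leq_pred.
have -> : 2 * 4^-1 ^+ k * 2 ^+ (n + k) = c / 2 ^+ k :> R.
  have -> : (4 : R) = 2 * 2 by ring.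
  rewrite invfM exprMn exprD /c exprVn; field; exact: lt0r_neq0.
rewrite ler_pdivrMr// -ler_pdivrMl// mulrC.
exact: le_trans (ltW klt) k2.
Qed.

Let phi_indic t B : measurable B -> phi t \1_B = fine (\int[mu]_x P t x B)%E.
Proof.
move=> mB; congr fine; apply: eq_integral => x _.
rewrite /op int_indic// fineK// ge0_fin_numE//.
apply: le_lt_trans (kernel_fin (P t) x).
by apply: le_measure; rewrite ?inE.
Qed.

Let mix_fin t B : measurable B -> (\int[mu]_x P t x B)%E \is a fin_num.
Proof.
move=> mB; rewrite ge0_fin_numE; last exact: integral_ge0.
apply: (@le_lt_trans _ _ (\int[mu]_x 1)%E).
  apply: ge0_le_integral => //; first exact: measurable_kernel.
  move=> x _; have <- : P t x setT = 1%E by exact: prob_kernel.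
  by apply: le_measure; rewrite ?inE.
by rewrite integral_cst// mul1e (prob_fin mu).
Qed.

(** The mixture of the kernels [P t x] under mu is a measure. Indicators of rectangles are local and
    bounded by 1, so it agrees with mu on rectangles and hence everywhere. *)
Let inv_small t : 0 <= t <= 16^-1 -> inv t.
Proof.
move=> t16; have [m mE] := mixture_exists mu (P t).
have mmu B : measurable B -> m B = mu B.
  apply: prod_measure_unique.
    rewrite mE -ge0_fin_numE; last exact: integral_ge0.
    exact: mix_fin.
  move=> A C mC; have mr := measurable_rect A mC.
  have lr : local_on A (\1_(rect A C) : X -> R).
    move=> x y xy; rewrite !indicE; congr (nat_of_bool _)%:R.
    by apply/idP/idP => /set_mem h; apply: mem_set => k kA;
      have := h k kA; rewrite xy.
  have r1 x : `|\1_(rect A C) x : R| <= 1.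
    by rewrite indicE; case: (_ \in _); rewrite ?normr1 ?normr0.
  have := phi_small (bmf_indic R mr) lr r1 t16.
  rewrite phi_indic// int_indic// mE => h.
  by rewrite -(fineK (mix_fin t mr)) h fineK//; exact: (fin_num_measure mu _ mr).
move=> f bf; apply: (blf_ext (F := phi t) (G := fun f => I f)) bf => //.
  exact: blf_int1.
by move=> B mB; rewrite phi_indic// int_indic// -mE mmu.
Qed.

Let inv_add s t : 0 <= s -> 0 <= t -> inv s -> inv t -> inv (s + t).
Proof.
move=> s0 t0 ivs ivt f bf; rewrite phiD// ivs; [exact: ivt|exact: bmf_op].
Qed.

Lemma int_op t f : 0 <= t -> bmf f -> I (op t f) = I f.
Proof.
(* Enough steps to make each shorter than 1/16. *)
move=> t0; pose n := (Num.truncn (t * 16)).+1.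
have nlt : t * 16 < n%:R.
  by have /andP[] : (Num.truncn (t * 16))%:R <= t * 16 < n%:R
    by apply: truncn_itv; rewrite mulr_ge0.
have n0 : 0 < n%:R :> R by rewrite ltr0n.
have h0 : 0 <= t / n%:R by rewrite divr_ge0// ltW.
have h16 : 0 <= t / n%:R <= 16^-1.
  by rewrite h0 ler_pdivrMr// mulrC ler_pdivlMr// ltW.
suff H m : inv (m%:R * (t / n%:R)).
  by have := H n f; rewrite mulrC divfK ?gt_eqF.
elim: m => [|m IH]; first by rewrite mul0r; apply: inv_small; rewrite lexx invr_ge0 ler0n.
rewrite -natr1 mulrDl mul1r; apply: inv_add => //; last exact: inv_small.
by rewrite mulr_ge0.
Qed.

Lemma mu_invariant : invariant_measure P mu.
Proof.
move=> t B t0 mB; have := int_op t0 (bmf_indic R mB).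
rewrite -[LHS]/(phi t \1_B) phi_indic// int_indic// => h.
by rewrite -(fineK (mix_fin t mB)) h fineK//; exact: (fin_num_measure mu _ mB).
Qed.

End invariance.

(** * Invariant functions are constant *)

Local Opaque exch.

Section invariant_functions.
Context (R : realType) (S : countType) (p : S -> S -> R).
Local Notation X := (config R S).
Local Notation Om := (@Omega R S).
Variables (theta : R) (mu : probability X R) (P : R -> R.-pker X ~> X).
Hypothesis theta0 : 0 < theta.
Hypothesis mu_product : is_product_measure (nu theta) mu.
Hypothesis p_walk : irreducible_symmetric_walk p.
Hypothesis P_process : process_semigroup p P.
Hypothesis S_infinite : infinite_set [set: S].
Local Notation I f := (\int[mu]_x f x)%R.
Variable f : X -> R.
Hypothesis bf : bmf f.
Hypothesis f_inv : forall t g, 0 <= t -> bmf g ->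
  I (fun x => (\int[P t x]_y g y) * f x) = I (fun x => g x * f x).

(** Weak invariance kills <P_h g - g, f>, so h times the pairing of the truncated generator with f
    is, up to sign, the remainder of the expansion, at most h e. Dividing by h at a single small h
    suffices. *)
Lemma invariant_harmonic (A : {fset S}) g (e : R) a b :
  bmf g -> local_on A g -> 0 < e -> a != b ->
  exists s : seq (S * S), [/\ uniq s, (a, b) \in s, (forall ij, ij \in s -> ij.1 != ij.2) &
    `|\sum_(ij <- s) p ij.1 ij.2 * I (fun x => (exch ij.1 ij.2 g x - g x) * f x)| <= e].
Proof.
move=> bg lg e0 ab; have [_ [N fN]] := bf.
have N0 : 0 <= N by apply: le_trans (fN (fun=> 0)).
have N1 : 0 < N + 1 by rewrite ltr_wpDl.
have eN : 0 < e / (N + 1) by rewrite divr_gt0.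
have [s [h0 [us abs sD h00 Hs]]] := step_approx p_walk P_process bg lg eN ab.
exists s; split=> //.
have bF : bmf (fin_gen p s g) by exact: bmf_fin_gen.
have be ij : bmf (fun x => exch ij.1 ij.2 g x - g x).
  by apply: bmfB => //; exact: bmf_exch.
have -> : \sum_(ij <- s) p ij.1 ij.2 * I (fun x => (exch ij.1 ij.2 g x - g x) * f x) =
    I (fun x => fin_gen p s g x * f x).
  transitivity (I (fun x => \sum_(ij <- s) p ij.1 ij.2 *
      ((exch ij.1 ij.2 g x - g x) * f x))).
    rewrite int_sum//; last by move=> ij; apply: bmfZ; exact: bmfM.
    by apply: eq_bigr => ij _; rewrite intZ//; exact: bmfM.
  apply: eq_Rintegral => x _; rewrite /fin_gen mulr_suml.
  by apply: eq_bigr => ij _; rewrite mulrA.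
pose h := h0 / 2; have hpos : 0 < h by rewrite divr_gt0.
have hh : 0 < h < h0 by rewrite hpos /h ltr_pdivrMr// ltr_pMr// ltr1n.
pose D x := \int[P h x]_y g y - g x - h * fin_gen p s g x.
have bo : bmf (fun x => \int[P h x]_y g y) by exact: bmf_kernel.
have bD : bmf D by apply: bmfB; [exact: bmfB|exact: bmfZ].
have ID : I (fun x => D x * f x) = - (h * I (fun x => fin_gen p s g x * f x)).
  transitivity (I (fun x => (\int[P h x]_y g y) * f x) - I (fun x => g x * f x) -
      h * I (fun x => fin_gen p s g x * f x)).
    rewrite -intZ; auto; rewrite -intB; auto; rewrite -intB; auto.
    by apply: eq_Rintegral => x _; rewrite /D; ring.
  by rewrite f_inv ?ltW// subrr sub0r.
have : `|I (fun x => D x * f x)| <= h * (e / (N + 1)) * N.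
  apply: (int_norm_le_on (@measurable_Omega R S) (probability_setT mu) (mu_Omega mu_product)).
  - by rewrite !mulr_ge0// ?invr_ge0 ltW.
  - exact: bmfM.
  - by move=> x Ox; rewrite normrM ler_pM// Hs.
rewrite ID normrN normrM gtr0_norm// -mulrA ler_pM2l// => /le_trans; apply.
by rewrite mulrAC ler_pdivrMr// ler_wpM2l ?(ltW e0)// lerDl.
Qed.

Lemma invariant_const : I (fun x => (f x - I f) ^+ 2) = 0.
Proof.
apply: (swap_null_const mu_product bf _ S_infinite) => a b.
apply: (irreducible_swap_null mu_product p_walk bf) => {}a {}b ab pab.
apply: (harmonic_swap theta0 mu_product (p := p)) => //.
- exact: walk_ge0.
- exact: walk_sym.
- exact: walk_le1.
- exact: invariant_harmonic.
Qed.

End invariant_functions.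

(** * Stationary Markov processes *)

Section densities.
Context (R : realType) d (T : measurableType d).

Section density.
Variables (mu : probability T R) (m : {measure set T -> \bar R}).
Hypothesis m_le : forall B, measurable B -> (m B <= mu B)%E.

Let mm : set T -> \bar R := m.

Let mm_fin : fin_num_fun mm.
Proof.
move=> B mB; rewrite ge0_fin_numE; last exact: (measure_ge0 m).
apply: le_lt_trans (m_le mB) _; apply: le_lt_trans (prob_fin mu).
by apply: le_measure; rewrite ?inE.
Qed.

HB.instance Definition _ := Measure.on mm.
HB.instance Definition _ := Measure_isFinite.Build _ _ _ mm mm_fin.

(** The Radon-Nikodym derivative is at most 1 almost everywhere because m <= mu; truncating it at 1
    gives a version bounded everywhere. *)
Lemma density_exists : exists f : T -> R, [/\ bmf f, (forall x, 0 <= f x) &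
  forall g, bmf g -> \int[m]_x g x = \int[mu]_x (g x * f x)].
Proof.
have mfin : (m setT < +oo)%E by rewrite -ge0_fin_numE//; exact: (mm_fin measurableT).
have dom : (mm : {finite_measure set T -> \bar R}) `<< mu.
  apply/null_content_dominatesP => B mB muB.
  by apply/eqP; rewrite eq_le measure_ge0 andbT -muB m_le.
have [f [f0 ffin intf fE]] := radon_nikodym_sigma_finite dom.
have mf : measurable_fun [set: T] f := measurable_int _ intf.
pose ff x := fine (f x).
have mff : measurable_fun [set: T] ff.
  by apply: (measurableT_comp (@fine_measurable R _ measurableT)).
have fK x : (ff x)%:E = f x by rewrite fineK.
have ff0 x : 0 <= ff x by rewrite fine_ge0.
(* On [E n] the density exceeds 1 by a fixed amount, so a positive mass there would give m (E n) >
   mu (E n). These sets exhaust {f > 1}. *)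
pose E n := [set x | 1 + n.+1%:R^-1 <= ff x].
have mE n : measurable (E n).
  rewrite (_ : E n = ff @^-1` `[1 + n.+1%:R^-1, +oo[); last first.
    by apply/seteqP; split=> x /=; rewrite in_itv/= ?andbT.
  by rewrite -[_ @^-1` _]setTI; apply: mff.
have muE n : mu (E n) = 0%E.
  apply/eqP; rewrite eq_le measure_ge0 andbT leNgt; apply/negP => mu0.
  have mufin : mu (E n) \is a fin_num by exact: fin_num_measure.
  have : ((1 + n.+1%:R^-1)%:E * mu (E n) <= m (E n))%E.
    rewrite (fE _ (mE n)) -integral_cst//; apply: ge0_le_integral => //.
    - by move=> x _; rewrite lee_fin addr_ge0// invr_ge0.
    - exact: measurable_funTS.
    - by move=> x Ex; rewrite -fK lee_fin.
  move=> /le_trans /(_ (m_le (mE n))).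
  rewrite -(fineK mufin) -EFinM lee_fin leNgt; case/negP.
  rewrite ltr_pMl ?ltrDl ?invr_gt0//.
  by rewrite -lte_fin fineK.
pose h x := Num.min (ff x) 1.
have mh : measurable_fun [set: T] h by exact: measurable_minr.
have h01 x : 0 <= h x <= 1 by rewrite /h le_min ff0 ler01 ge_min lexx orbT.
have bh : bmf h.
  by split=> //; exists 1 => x; have /andP[h0 h1] := h01 x; rewrite ger0_norm.
have mhE B : measurable B -> m B = (\int[mu]_(x in B `&` setT) (h x)%:E)%E.
  move=> mB; rewrite setIT (fE _ mB); apply: ae_eq_integral => //.
  - exact: measurable_funTS.
  - by apply/measurable_EFinP; exact: measurable_funTS.
  have : mu.-negligible (\bigcup_n E n).
    apply: negligible_bigcup => n; apply/negligibleP; [exact: mE|exact: muE].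
  apply: negligibleS => x /= /not_implyP[_ hx].
  have ffx : 1 < ff x.
    rewrite ltNge; apply/negP => f1; apply: hx.
    by rewrite -fK /h min_l.
  have d0 : 0 < ff x - 1 by rewrite subr_gt0.
  exists (Num.truncn (ff x - 1)^-1) => //=.
  rewrite /E/= -lerBrDl -[leRHS]invrK lef_pV2 ?posrE ?invr_gt0 ?ltr0n//.
  have /andP[_ /ltW//] : (Num.truncn (ff x - 1)^-1)%:R <= (ff x - 1)^-1 <
      (Num.truncn (ff x - 1)^-1).+1%:R by apply: truncn_itv; rewrite invr_ge0 ltW.
exists h; split=> // [x|g bg]; first by have /andP[] := h01 x.
by rewrite (int_density (la := mu) (D := setT) (rho := h))// => x _; have /andP[] := h01 x.
Qed.

End density.

Section induced.
Variables (m : {measure set T -> \bar R}) (r : T -> R).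
Hypotheses (mr : measurable_fun [set: T] r) (r0 : forall x, 0 <= r x).

Let ind B := (\int[m]_(x in B) (r x)%:E)%E.

Let ind0 : ind set0 = 0%E. Proof. by rewrite /ind integral_set0. Qed.

Let ind_ge0 B : (0 <= ind B)%E.
Proof. by apply: integral_ge0 => x _; rewrite lee_fin. Qed.

Let ind_sigma_additive : semi_sigma_additive ind.
Proof.
apply: semi_sigma_additive_nng_induced; first exact/measurable_EFinP.
by move=> x; rewrite lee_fin.
Qed.

HB.instance Definition _ := isMeasure.Build _ _ _ ind ind0 ind_ge0 ind_sigma_additive.

Lemma induced_exists : exists m' : {measure set T -> \bar R},
  forall B, m' B = (\int[m]_(x in B) (r x)%:E)%E.
Proof. by exists (ind : {measure set T -> \bar R}). Qed.

End induced.

Lemma int_restr (m m' : {measure set T -> \bar R}) (N : set T) (g : T -> R) :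
  (m setT < +oo)%E -> measurable N -> (forall B, measurable B -> m' B = m (B `&` N)) ->
  bmf g -> \int[m']_x g x = \int[m]_x (g x * \1_N x).
Proof.
move=> mfin mN m'E bg.
have m'fin : (m' setT < +oo)%E.
  by rewrite m'E// setTI; apply: le_lt_trans mfin; apply: le_measure; rewrite ?inE.
apply: (blf_ext (F := fun g => \int[m']_x g x)
  (G := fun g => \int[m]_x (g x * \1_N x))) bg.
- exact: blf_int1.
- by apply: blf_int => //; exact: bmf_indic.
- move=> B mB; rewrite int_indic// m'E// -int_indic//; last exact: measurableI.
  by apply: eq_Rintegral => x _; rewrite indicI.
Qed.

End densities.

Section functionals_kernel.
Context (R : realType) d (T : measurableType d).

Lemma blf_comp d' (T' : measurableType d') (phi : T' -> T) (F : (T' -> R) -> R) :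
  measurable_fun [set: T'] phi -> blf F -> blf (fun g => F (fun x => g (phi x))).
Proof.
move=> mphi [linF [C FC]]; have bphi g : bmf g -> bmf (fun x => g (phi x)).
  by move=> /(bmf_comp mphi).
split=> [a f g bf bg|]; first by rewrite linF//; exact: bphi.
by exists C => f M bf fM; apply: FC => //; exact: bphi.
Qed.

Lemma blf_kernel (k : R.-pker T ~> T) (F : (T -> R) -> R) (h : T -> R) :
  blf F -> bmf h -> blf (fun g => F (fun x => \int[k x]_y (h y * g y))).
Proof.
move=> [linF [C FC]] bh; have bk g : bmf g -> bmf (fun x => \int[k x]_y (h y * g y)).
  by move=> bg; apply: bmf_kernel; exact: bmfM.
split=> [a f g bf bg|].
  rewrite -linF; [|exact: bk|exact: bk]; congr F; apply/funext => x.
  rewrite -intZ; auto; rewrite -intD; auto.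
  by apply: eq_Rintegral => y _; ring.
have [N hN] := bh.2; exists (C * N) => f M bf fM; rewrite -mulrA; apply: FC; first exact: bk.
move=> x; apply: int_norm_le1; [exact: kernel_fin|exact: prob_kernel|exact: bmfM|].
by move=> y; rewrite normrM ler_pM.
Qed.

End functionals_kernel.

(** * Cylinder events of paths *)

Section paths.
Context (R : realType) d (T : measurableType d).
Local Notation W := (@path_space R d T).
Local Notation steps := (seq ({nonneg R} * set T)).

Lemma nonneg_inj (s t : {nonneg R}) : s%:num = t%:num -> s = t.
Proof. exact: val_inj. Qed.

Lemma measurable_time_shift (t : {nonneg R}) : measurable_fun [set: W] (@time_shift R d T t).
Proof. by apply: measurable_coords => s; exact: measurable_coord. Qed.

Definition measurable_steps (l : steps) := forall hB, hB \in l -> measurable hB.2.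

Lemma measurable_steps_cons h B (l : steps) :
  measurable_steps ((h, B) :: l) <-> measurable B /\ measurable_steps l.
Proof.
split=> [ml|[mB ml] hB].
  by split=> [|hB lhB]; [apply: (ml (h, B)); rewrite mem_head|apply: ml; rewrite in_cons lhB orbT].
by rewrite in_cons => /predU1P[->//|]; exact: ml.
Qed.

Lemma measurable_steps_cat (l l' : steps) :
  measurable_steps l -> measurable_steps l' -> measurable_steps (l ++ l').
Proof. by move=> ml ml' hB; rewrite mem_cat => /orP[/ml|/ml']. Qed.

Lemma measurable_fdd_event s (l : steps) :
  measurable_steps l -> measurable (fdd_event s l).
Proof.
elim: l s => [|[h B] l IH] s//= /measurable_steps_cons[mB ml].
apply: measurableI; last exact: IH.
by rewrite -[X in measurable X]setTI; exact: measurable_coord.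
Qed.

Fixpoint last_time (s : {nonneg R}) (l : steps) : {nonneg R} :=
  if l is (h, _) :: l' then last_time (s%:num + h%:num)%:nng l' else s.

Lemma fdd_event_cat s (l l' : steps) :
  fdd_event s (l ++ l') = fdd_event s l `&` fdd_event (last_time s l) l'.
Proof.
elim: l s => [|[h B] l IH] s /=; first by rewrite setTI.
by rewrite IH setIA.
Qed.

Lemma fdd_event_shift s t (l : steps) :
  @time_shift R d T t @^-1` fdd_event s l = fdd_event (s%:num + t%:num)%:nng l.
Proof.
elim: l s => [|[h B] l IH] s //=; rewrite preimage_setI IH.
have -> : (((s%:num + h%:num)%:nng)%:num + t%:num)%:nng =
    (((s%:num + t%:num)%:nng)%:num + h%:num)%:nng :> {nonneg R}.
  by apply: nonneg_inj; rewrite /= addrAC.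
congr setI; apply/seteqP; split=> w /=; rewrite /time_shift;
  set a := (X in w X); set b := (X in _ -> B (w X)).
  by have -> : a = b by apply: nonneg_inj; rewrite /= addrAC.
by have -> : a = b by apply: nonneg_inj; rewrite /= addrAC.
Qed.

Lemma seq_fdd_event (B : {nonneg R} -> set T) s (ts : seq {nonneg R}) :
  path (fun a b : {nonneg R} => a%:num <= b%:num) s ts -> (forall t, measurable (B t)) ->
  exists l : steps, measurable_steps l /\
    fdd_event s l = [set w : W | forall t, t \in ts -> B t (w t)].
Proof.
move=> + mB; elim: ts s => [|t ts IH] s /=.
  by move=> _; exists [::]; split=> //; apply/seteqP; split.
move=> /andP[st /IH[l [ml El]]].
have st0 : 0 <= t%:num - s%:num by rewrite subr_ge0.
exists ((NngNum st0, B t) :: l); split; first exact/measurable_steps_cons.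
have E : (s%:num + (NngNum st0)%:num)%:nng = t.
  by apply: nonneg_inj; rewrite /= addrC subrK.
rewrite /= E El; apply/seteqP; split=> w /=.
  by move=> [Bt h] t'; rewrite in_cons => /predU1P[->|/h].
by move=> h; split=> [|t' tt']; apply: h; rewrite in_cons ?eqxx// tt' orbT.
Qed.

(** Sorting the finitely many times turns a rectangle in path space into a list of increments, the
    form in which the law of the process is given. *)
Lemma rect_fdd_event (A : {fset {nonneg R}}) (B : {nonneg R} -> set T) :
  (forall t, measurable (B t)) ->
  exists l : steps, measurable_steps l /\ rect A B = fdd_event 0%:nng l.
Proof.
move=> mB; pose r (a b : {nonneg R}) := a%:num <= b%:num.
have [|l [ml El]] := @seq_fdd_event B 0%:nng (sort r A) _ mB.
  rewrite path_min_sorted; last by apply/allP => t _; rewrite /r /= ge0.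
  by apply: sort_sorted => a b; exact: le_total.
exists l; split=> //; rewrite El; apply/seteqP; split=> w /= h t.
  by rewrite mem_sort => /h.
by move=> tA; apply: h; rewrite mem_sort.
Qed.

Variable P : R -> R.-pker T ~> T.

(** [fdd_prob] with a function F of the last position in place of 1. The free terminal function
    makes concatenation of lists a composition. *)
Fixpoint fdd_op (l : steps) (F : T -> R) (x : T) : R :=
  if l is (h, B) :: l' then \int[P h%:num x]_y (\1_B y * fdd_op l' F y) else F x.

Lemma bmf_fdd_op (l : steps) F : measurable_steps l -> bmf F -> bmf (fdd_op l F).
Proof.
elim: l => [|[h B] l IH]//= /measurable_steps_cons[mB ml] bF.
by apply: bmf_kernel; apply: bmfM; [exact: bmf_indic|exact: IH].
Qed.

Lemma fdd_op_cat (l l' : steps) F : fdd_op (l ++ l') F = fdd_op l (fdd_op l' F).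
Proof.
by elim: l => [|[h B] l IH]//=; apply/funext => x; rewrite IH.
Qed.

Lemma fdd_opE (l : steps) x : measurable_steps l ->
  fdd_prob P l x = (fdd_op l (fun=> 1) x)%:E.
Proof.
elim: l x => [|[h B] l IH] x //= /measurable_steps_cons[mB ml].
rewrite int_fineK; last 2 first.
- exact: kernel_fin.
- by apply: bmfM; [exact: bmf_indic|exact: bmf_fdd_op].
rewrite integral_mkcond; apply: eq_integral => y _; rewrite patchE indicE.
by case: (y \in B); rewrite ?IH// ?mul1r ?mul0r.
Qed.

Lemma blf_fdd_op (l : steps) F : measurable_steps l -> blf F -> blf (fun g => F (fdd_op l g)).
Proof.
elim: l F => [|[h B] l IH] F //= /measurable_steps_cons[mB ml] bF.
apply: (IH (fun g => F (fun x => \int[P h%:num x]_y (\1_B y * g y)))) => //.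
by apply: blf_kernel => //; exact: bmf_indic.
Qed.

End paths.

Lemma prob_eq_int (R : realType) d d' (T : measurableType d) (T' : measurableType d')
  (m : probability T R) (m' : probability T' R) (B : set T) (B' : set T') :
  measurable B -> measurable B' ->
  \int[m]_x \1_B x = \int[m']_x \1_B' x -> m B = m' B'.
Proof.
move=> mB mB'; rewrite (@int_indic _ _ _ m _ mB) (@int_indic _ _ _ m' _ mB') => E.
rewrite -(fineK (fin_num_measure m _ mB)) E fineK//.
exact: (fin_num_measure m' _ mB').
Qed.

(** * Finite-dimensional identities under stationarity *)

Section stationary_process.
Context (R : realType) d (T : measurableType d).
Local Notation W := (@path_space R d T).
Variables (mu : probability T R) (P : R -> R.-pker T ~> T) (Q : probability W R).
Hypothesis mu_inv : forall t g, 0 <= t -> bmf g ->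
  \int[mu]_x (\int[P t x]_y g y) = \int[mu]_x g x.
Hypothesis Q_law : path_law P mu Q.
Local Notation I f := (\int[mu]_x f x)%R.
Local Notation EQ h := (\int[Q]_w h w)%R.

Lemma int_fdd_event l : measurable_steps l ->
  EQ \1_(fdd_event 0%:nng l) = I (fdd_op P l (fun=> 1)).
Proof.
move=> ml; rewrite int_indic//; last exact: measurable_fdd_event.
by rewrite Q_law//; congr fine; apply: eq_integral => x _; exact: fdd_opE.
Qed.

Lemma bmf_at (t : {nonneg R}) (g : T -> R) : bmf g -> bmf (fun w : W => g (w t)).
Proof. by move=> /(bmf_comp (@measurable_coord {nonneg R} _ T t)). Qed.

(** For g an indicator this is the law of one cylinder, the past and the future being joined by a
    step of length t minus the last past time. Both sides are bounded functionals of g. *)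
Lemma int_past_future l l' (t : {nonneg R}) g :
  measurable_steps l -> measurable_steps l' ->
  (last_time 0%:nng l)%:num <= t%:num -> bmf g ->
  EQ (fun w => g (w t) * \1_(fdd_event 0%:nng l `&` fdd_event t l') w) =
  I (fdd_op P l (fun x => \int[P (t%:num - (last_time 0%:nng l)%:num) x]_y
    (fdd_op P l' (fun=> 1) y * g y))).
Proof.
move=> ml ml' lt; set h := _ - _.
have h0 : 0 <= h by rewrite subr_ge0.
have mE : measurable (fdd_event 0%:nng l `&` fdd_event t l').
  by apply: measurableI; exact: measurable_fdd_event.
have tE : ((last_time 0%:nng l)%:num + (NngNum h0)%:num)%:nng = t.
  by apply: nonneg_inj; rewrite /= addrC subrK.
apply: (blf_ext
  (F := fun g => EQ (fun w => g (w t) * \1_(fdd_event 0%:nng l `&` fdd_event t l') w))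
  (G := fun g => I (fdd_op P l (fun x => \int[P h x]_y (fdd_op P l' (fun=> 1) y * g y))))).
- apply: (blf_comp (@measurable_coord {nonneg R} _ T t)
    (F := fun h => EQ (fun w => h w * \1_(fdd_event 0%:nng l `&` fdd_event t l') w))).
  by apply: blf_int => //; exact: bmf_indic.
- apply: (@blf_kernel R d T (P h) (fun u => I (fdd_op P l u))); last exact: bmf_fdd_op.
  by apply: blf_fdd_op => //; exact: blf_int1.
move=> B mB; transitivity (EQ \1_(fdd_event 0%:nng (l ++ (NngNum h0, B) :: l'))).
  by apply: eq_Rintegral => w _; rewrite fdd_event_cat/= tE setICA [in RHS]indicI.
rewrite int_fdd_event; last first.
  by apply: measurable_steps_cat => //; exact/measurable_steps_cons.
rewrite fdd_op_cat; apply: eq_Rintegral => x _; congr (fdd_op P l _ x).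
by apply/funext => y /=; apply: eq_Rintegral => z _; exact: mulrC.
Qed.

(** With an empty past, only the kernel up to time t precedes the future, and invariance of mu
    removes it. *)
Lemma int_now_future l (t : {nonneg R}) g : measurable_steps l -> bmf g ->
  EQ (fun w => g (w t) * \1_(fdd_event t l) w) = I (fun x => fdd_op P l (fun=> 1) x * g x).
Proof.
move=> ml bg; have := @int_past_future [::] l t g _ ml (ge0 t) bg.
rewrite /= setTI mu_inv ?subr0//; last first.
  by apply: bmfM => //; exact: bmf_fdd_op.
by apply=> hB.
Qed.

Lemma int_at (t : {nonneg R}) g : bmf g -> EQ (fun w => g (w t)) = I g.
Proof.
move=> bg; transitivity (EQ (fun w => g (w t) * \1_(fdd_event t [::]) w)).
  by apply: eq_Rintegral => w _; rewrite /= indicT mulr1.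
rewrite int_now_future//.
by apply: eq_Rintegral => x _; rewrite /= mul1r.
Qed.

Lemma Q_fin_num (C : set W) : measurable C -> Q C \is a fin_num.
Proof. by move=> mC; exact: fin_num_measure. Qed.

Lemma Q_shift (t : {nonneg R}) (C : set W) : measurable C ->
  Q (@time_shift R d T t @^-1` C) = Q C.
Proof.
move=> mC; have [m' m'E] := pushforward_exists Q (@measurable_time_shift R d T t).
rewrite -m'E; apply: (prod_measure_unique (m1 := m') (m2 := Q)) => // [|A B mB].
  by rewrite m'E preimage_setT; exact: prob_fin.
have [l [ml ->]] := rect_fdd_event A mB.
have mF s : measurable (fdd_event s l : set W) by exact: measurable_fdd_event.
rewrite m'E fdd_event_shift; apply: (@prob_eq_int _ _ _ _ _ Q Q) => //.
have H s : EQ \1_(fdd_event s l) = I (fun x => fdd_op P l (fun=> 1) x * 1).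
  rewrite -(int_now_future s ml (bmf_cst _ 1)).
  by apply: eq_Rintegral => w _; rewrite mul1r.
exact: etrans (H _) (esym (H _)).
Qed.

Lemma int_shift (t : {nonneg R}) (h : W -> R) : bmf h ->
  EQ (fun w => h (@time_shift R d T t w)) = EQ h.
Proof.
move=> bh; rewrite -(int_pushforward (m' := Q) _ (@measurable_time_shift R d T t))//.
by move=> B mB; rewrite Q_shift.
Qed.

(** The function f is a bounded version of P(C | X_t = x): the measure B -> Q(C, X_t in B) is
    dominated by the law mu of X_t. *)
Lemma density_at (t : {nonneg R}) (C : set W) : measurable C ->
  exists f : T -> R, [/\ bmf f, (forall x, 0 <= f x) & forall g, bmf g ->
    EQ (fun w => g (w t) * \1_C w) = I (fun x => g x * f x)].
Proof.
move=> mC; have [q qE] := restr_exists Q mC.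
have mt : measurable_fun [set: W] (fun w : W => w t) by exact: measurable_coord.
have [m' m'E] := pushforward_exists q mt.
have qfin : (q setT < +oo)%E.
  by rewrite qE setTI; have := Q_fin_num mC; rewrite ge0_fin_numE.
have mB' B : measurable B -> measurable ((fun w : W => w t) @^-1` B).
  by move=> mB; rewrite -[X in measurable X]setTI; exact: mt.
have [B mB|f [bf f0 fE]] := density_exists (mu := mu) (m := m').
  rewrite m'E qE; apply: (@le_trans _ _ (Q ((fun w : W => w t) @^-1` B))).
    apply: le_measure; [apply/mem_set|apply/mem_set; exact: mB'|exact: subIsetl].
    by apply: measurableI => //; exact: mB'.
  rewrite (@prob_eq_int _ _ _ _ _ Q mu _ B)//; first exact: mB'.
  by rewrite -(int_at t (bmf_indic R mB)).
exists f; split=> // g bg; rewrite -fE//.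
rewrite (int_pushforward (m' := m') qfin mt)//.
by rewrite (int_restr (m := Q) (m' := q) (N := C))//; exact: bmf_at.
Qed.

End stationary_process.

Lemma int_norm_dom (R : realType) d (T : measurableType d) (m : {measure set T -> \bar R})
  (f g : T -> R) : (m setT < +oo)%E -> bmf f -> bmf g -> (forall x, `|f x| <= g x) ->
  `|\int[m]_x f x| <= \int[m]_x g x.
Proof.
move=> mfin bf bg fg; rewrite ler_norml -intN//; apply/andP; split; apply: int_le; auto.
- by move=> x; have := fg x; rewrite ler_norml => /andP[].
- by move=> x; have := fg x; rewrite ler_norml => /andP[].
Qed.

(** The square of K |x| - e/2, divided by e. It turns smallness in mean square into smallness of a
    correlation with a function bounded by K. *)
Lemma am_gm (R : realFieldType) (K e x b : R) : 0 < K -> 0 < e -> `|b| <= K ->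
  `|x * b| <= K ^+ 2 / e * x ^+ 2 + e / 4.
Proof.
move=> K0 e0 bK; apply: (@le_trans _ _ (`|x| * K)); first by rewrite normrM ler_wpM2l.
rewrite -subr_ge0 -(real_normK (num_real x)).
set y := `|x|.
rewrite (_ : _ - _ = (K * y - e / 2) ^+ 2 / e); last by field; rewrite gt_eqF.
by rewrite divr_ge0 ?sqr_ge0 ?ltW.
Qed.

(** * Shift-invariant events are functions of the initial state *)

Section ergodicity.
Context (R : realType) d (T : measurableType d).
Local Notation W := (@path_space R d T).
Local Notation shift := (@time_shift R d T).
Variables (mu : probability T R) (P : R -> R.-pker T ~> T) (Q : probability W R).
Hypothesis mu_inv : forall t g, 0 <= t -> bmf g ->
  \int[mu]_x (\int[P t x]_y g y) = \int[mu]_x g x.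
Hypothesis Q_law : path_law P mu Q.
Local Notation I f := (\int[mu]_x f x)%R.
Local Notation EQ h := (\int[Q]_w h w)%R.

Lemma measurable_shift t (D : set W) : measurable D -> measurable (shift t @^-1` D).
Proof. by move=> mD; rewrite -[X in measurable X]setTI; exact: measurable_time_shift. Qed.

(* Let r be the conditional density of C given X_t. By the Markov property, the
   measures [D |-> Q (C `&` shift_t^-1 D)] and [D |-> E (r (X_0) 1_D)] agree on
   cylinders, hence on all events. *)
Lemma markov_property l (t : {nonneg R}) (D : set W) (f : T -> R) :
  measurable_steps l -> (last_time 0%:nng l)%:num <= t%:num -> measurable D -> bmf f ->
  (forall g, bmf g -> EQ (fun w => g (w 0%:nng) * \1_D w) = I (fun x => g x * f x)) ->
  EQ (fun w => \1_(fdd_event 0%:nng l) w * \1_(shift t @^-1` D) w) =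
  EQ (fun w => \1_(fdd_event 0%:nng l) w * f (w t)).
Proof.
move=> ml lt mD bf fE; set C := fdd_event _ l.
have mC : measurable C by exact: measurable_fdd_event.
have [r [br r0 rE]] := density_at mu_inv Q_law t mC.
have [q qE] := restr_exists Q mC.
have [m1 m1E] := pushforward_exists q (@measurable_time_shift R d T t).
have br0 : bmf (fun w : W => r (w 0%:nng)) by exact: bmf_at.
have [m2 m2E] := induced_exists Q br0.1 (fun w => r0 (w 0%:nng)).
have m1R B : measurable B ->
    m1 B = (EQ (fun w => \1_C w * \1_(shift t @^-1` B) w))%:E.
  move=> mB; have mtB := measurable_shift t mB.
  have mI : measurable (C `&` shift t @^-1` B) by exact: measurableI.
  rewrite m1E qE setIC -(fineK (fin_num_measure Q _ mI)).
  by rewrite -(@int_indic _ _ _ Q _ mI) indicI.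
have m2R B : measurable B -> m2 B = (EQ (fun w => r (w 0%:nng) * \1_B w))%:E.
  move=> mB; rewrite m2E int_fineK//; last by apply: bmfM => //; exact: bmf_indic.
  rewrite integral_mkcond; apply: eq_integral => w _; rewrite patchE indicE.
  by case: (w \in B); rewrite ?mulr1 ?mulr0.
have : m1 D = m2 D.
  apply: (prod_measure_unique (m1 := m1) (m2 := m2)) => // [|A B mB].
    by rewrite m1R// ltry.
  have [l' [ml' ->]] := rect_fdd_event A mB.
  have mF : measurable (fdd_event 0%:nng l' : set W) by exact: measurable_fdd_event.
  rewrite m1R// m2R//; congr (_%:E).
  have bu : bmf (fdd_op P l' (fun=> 1)) by exact: bmf_fdd_op.
  rewrite (int_now_future mu_inv Q_law 0%:nng ml' br) -(rE _ bu).
  have := int_past_future Q_law ml (l' := [::]) _ lt bu.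
  rewrite /= -/C setIT => ->; last by move=> hB.
  transitivity (EQ (fun w => (fun=> 1) (w t) * \1_(C `&` fdd_event t l') w)).
    apply: eq_Rintegral => w _; rewrite fdd_event_shift indicI mul1r.
    by rewrite (_ : (0%:nng%:num + t%:num)%:nng = t)//; apply: nonneg_inj; rewrite /= add0r.
  rewrite (int_past_future Q_law ml ml' lt (bmf_cst _ 1)).
  apply: eq_Rintegral => x _; congr (fdd_op P l _ x); apply/funext => y.
  by apply: eq_Rintegral => z _; rewrite mulr1 mul1r.
rewrite m1R// m2R// => -[->]; rewrite fE//.
transitivity (I (fun x => f x * r x)).
  by apply: eq_Rintegral => x _; exact: mulrC.
by rewrite -rE//; apply: eq_Rintegral => w _; exact: mulrC.
Qed.

Variable A : set W.
Hypothesis mA : measurable A.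
Hypothesis A_inv : forall t, Q ((shift t @^-1` A) `+` A) = 0%E.

(** The squared difference of the two indicators is the indicator of the symmetric difference, a
    null event. *)
Lemma int_shift_invariant t h : bmf h ->
  EQ (fun w => \1_(shift t @^-1` A) w * h w) = EQ (fun w => \1_A w * h w).
Proof.
move=> bh; have mtA := measurable_shift t mA.
have b1 : bmf (\1_A : W -> R) by exact: bmf_indic.
have b2 : bmf (\1_(shift t @^-1` A) : W -> R) by exact: bmf_indic.
apply/eqP; rewrite -subr_eq0 -intB; auto; apply/eqP.
rewrite -[RHS](@int_null_mul _ _ _ Q (fun w => \1_(shift t @^-1` A) w - \1_A w) h)//; last 2 first.
- exact: bmfB.
- transitivity (EQ \1_((shift t @^-1` A) `+` A)).
    apply: eq_Rintegral => w _; rewrite !indicE /setY in_setU !in_setD.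
    by case: (w \in A); case: (w \in _ @^-1` A);
      rewrite /= ?subrr ?subr0 ?sub0r ?sqrrN ?expr1n ?expr0n.
  rewrite (@int_indic _ _ _ Q); last by apply: measurableU; exact: measurableD.
  by rewrite A_inv.
by apply: eq_Rintegral => w _; rewrite mulrBl.
Qed.

Variable f : T -> R.
Hypothesis bf : bmf f.
Hypothesis fE : forall g, bmf g ->
  EQ (fun w => g (w 0%:nng) * \1_A w) = I (fun x => g x * f x).

Let gap (t : {nonneg R}) w := \1_A w - f (w t).

Let bgap t : bmf (gap t).
Proof. by apply: bmfB; [exact: bmf_indic|exact: bmf_at]. Qed.

Let gap_bound : exists2 K, 0 < K & forall t w, `|gap t w| <= K.
Proof.
have [_ [M fM]] := bf; exists (1 + `|M|); first by rewrite ltr_wpDr.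
move=> t w; apply: le_trans (ler_normB _ _) _; apply: lerD.
  by rewrite indicE; case: (_ \in _); rewrite ?normr1 ?normr0.
by apply: le_trans (fM _) _; exact: ler_norm.
Qed.

Let vanishing h := forall e : R, 0 < e -> exists t0 : R, forall t : {nonneg R},
  t0 <= t%:num -> `|EQ (fun w => h w * gap t w)| <= e.

(** For a cylinder h and t beyond its last time the correlation is exactly zero: A may be replaced
    by its shift by t, and then the Markov property applies. Mean-square limits preserve smallness
    for large t since [gap t] is bounded uniformly in t. *)
Lemma gap_vanishing h : bmf h -> vanishing h.
Proof.
have mx (t1 t2 : R) t : Num.max t1 t2 <= t -> t1 <= t /\ t2 <= t.
  by rewrite ge_max => /andP[].
move: h; apply: (rect_approximation (m := Q)).
- move=> C B mB e e0; have [l [ml ->]] := rect_fdd_event C mB.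
  exists (last_time 0%:nng l)%:num => t lt.
  have b1 : bmf (\1_(fdd_event 0%:nng l) : W -> R).
    by apply: bmf_indic; exact: measurable_fdd_event.
  have b2 : bmf (\1_A : W -> R) by exact: bmf_indic.
  have b3 : bmf (fun w : W => f (w t)) by exact: bmf_at.
  rewrite [X in `|X|](_ : _ = 0) ?normr0 ?ltW//.
  transitivity (EQ (fun w => \1_(fdd_event 0%:nng l) w * \1_A w) -
      EQ (fun w => \1_(fdd_event 0%:nng l) w * f (w t))).
    by rewrite -intB; auto; apply: eq_Rintegral => w _; exact: mulrBr.
  rewrite -(markov_property ml lt mA bf fE); apply/eqP; rewrite subr_eq0; apply/eqP.
  transitivity (EQ (fun w => \1_A w * \1_(fdd_event 0%:nng l) w)).
    by apply: eq_Rintegral => w _; exact: mulrC.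
  by rewrite -(int_shift_invariant t b1); apply: eq_Rintegral => w _; exact: mulrC.
- move=> c g h bg bh vg vh e e0.
  have c0 : 0 < 2 * (`|c| + 1) by rewrite mulr_gt0// ltr_wpDl.
  have [t1 H1] := vg _ (divr_gt0 e0 c0).
  have [t2 H2] := vh _ (divr_gt0 e0 (ltr0n R 2)).
  exists (Num.max t1 t2) => t /mx[/H1 {}H1 /H2 {}H2].
  have -> : EQ (fun w => (c * g w + h w) * gap t w) =
      c * EQ (fun w => g w * gap t w) + EQ (fun w => h w * gap t w).
    rewrite -intZ; auto; rewrite -intD; auto.
    by apply: eq_Rintegral => w _; rewrite mulrDl mulrA.
  move: H1 H2; set x := EQ (fun w => g w * _) => H1 H2.
  apply: le_trans (ler_normD _ _) _; rewrite [leRHS](splitr e) lerD//.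
  rewrite normrM; apply: (@le_trans _ _ (`|c| * (e / (2 * (`|c| + 1))))).
    by rewrite ler_wpM2l.
  rewrite mulrA ler_pdivrMr// (_ : e / 2 * _ = e * (`|c| + 1)); last by field.
  by rewrite mulrC ler_pM2l// lerDl.
- move=> h bh Hh e e0; have [K K0 gK] := gap_bound.
  pose s := K ^+ 2 / e; have s0 : 0 < s by rewrite divr_gt0// exprn_gt0.
  (* With this tolerance the squared term of [am_gm] contributes e/4; its constant adds e/4 and g
     adds e/2. *)
  have [g [bg vg hg]] := Hh _ (divr_gt0 (divr_gt0 e0 (ltr0n R 4)) s0).
  have [t0 H0] := vg _ (divr_gt0 e0 (ltr0n R 2)).
  exists t0 => t /H0{}H0.
  have H1 : `|EQ (fun w => (h w - g w) * gap t w)| <=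
      EQ (fun w => s * (h w - g w) ^+ 2 + e / 4).
    by apply: int_norm_dom; auto => w; exact: am_gm.
  have b2 : bmf (fun w => (h w - g w) ^+ 2) by auto.
  rewrite intD in H1; auto.
  rewrite (@int_cst1 _ _ _ Q) in H1; auto; last exact: (probability_setT Q).
  have H2 : s * EQ (fun w => (h w - g w) ^+ 2) <= e / 4.
    by rewrite -ler_pdivlMl// mulrC.
  have -> : EQ (fun w => h w * gap t w) =
      EQ (fun w => (h w - g w) * gap t w) + EQ (fun w => g w * gap t w).
    rewrite -intD; auto.
    by apply: eq_Rintegral => w _; rewrite mulrBl subrK.
  apply: le_trans (ler_normD _ _) _; rewrite [leRHS](splitr e) lerD//.
  apply: le_trans H1 _; rewrite (_ : e / 2 = e / 4 + e / 4); last by field.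
  by rewrite lerD2r intZ.
Qed.

(** Take 1_A itself as test function. By invariance of A and stationarity, E(1_A f(X_t)) = E(1_A
    f(X_0)) = mu(f^2) for every t, so a quantity independent of t is below every e. *)
Lemma Q_invariant_event : fine (Q A) = I (fun x => f x ^+ 2).
Proof.
have b1 : bmf (\1_A : W -> R) by exact: bmf_indic.
apply/eqP; rewrite -subr_eq0 -normr_le0; apply/ler_addgt0Pr => e e0; rewrite add0r.
have [t0 H] := gap_vanishing b1 e0.
have t00 : 0 <= Num.max 0 t0 by rewrite le_max lexx.
pose t := NngNum t00.
have {H} := H t; rewrite /= le_max lexx orbT => /(_ isT).
rewrite [X in `|X| <= _ -> _](_ : _ = fine (Q A) - I (fun x => f x ^+ 2))//.
have bft : bmf (fun w : W => f (w t)) by exact: bmf_at.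
transitivity (EQ \1_A - EQ (fun w => \1_A w * f (w t))).
  rewrite -intB; auto; apply: eq_Rintegral => w _; rewrite /gap mulrBr indicE.
  by case: (w \in A); rewrite ?mulr1 ?mulr0.
rewrite (@int_indic _ _ _ Q _ mA); congr (_ - _).
rewrite -(int_shift_invariant t bft).
have b0 : bmf (fun w : W => f (w 0%:nng) * \1_A w) by apply: bmfM => //; exact: bmf_at.
transitivity (I (fun x => f x * f x)); last by apply: eq_Rintegral => x _; rewrite expr2.
rewrite -fE// -(int_shift mu_inv Q_law t b0); apply: eq_Rintegral => w _; rewrite mulrC.
rewrite /time_shift (_ : (0%:nng%:num + t%:num)%:nng = t)//.
by apply: nonneg_inj; rewrite /= add0r.
Qed.

(** The squared distance of 1_A and f(X_0) is Q(A) - 2 mu(f^2) + mu(f^2) = 0. *)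
Lemma indic_eq_density h : bmf h ->
  EQ (fun w => \1_A w * h w) = EQ (fun w => f (w 0%:nng) * h w).
Proof.
move=> bh; have b1 : bmf (\1_A : W -> R) by exact: bmf_indic.
have b0 : bmf (fun w : W => f (w 0%:nng)) by exact: bmf_at.
apply/eqP; rewrite -subr_eq0 -intB; auto; apply/eqP.
transitivity (EQ (fun w => gap 0%:nng w * h w)).
  by apply: eq_Rintegral => w _; rewrite mulrBl.
apply: int_null_mul => //.
transitivity (EQ \1_A - 2 * EQ (fun w => f (w 0%:nng) * \1_A w) +
    EQ (fun w => f (w 0%:nng) ^+ 2)).
  rewrite -intZ; auto; rewrite -intB; auto; rewrite -intD; auto.
  apply: eq_Rintegral => w _; rewrite /gap indicE; case: (w \in A); rewrite /=; ring.
rewrite fE// (int_at mu_inv Q_law 0%:nng (bmfX 2 bf)) (@int_indic _ _ _ Q _ mA).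
have -> : I (fun x => f x * f x) = I (fun x => f x ^+ 2).
  by apply: eq_Rintegral => x _; rewrite expr2.
by rewrite Q_invariant_event; rewrite -addrA (_ : forall z : R, z + (- (2 * z) + z) = 0)// => z; ring.
Qed.

(** The left side is E(g(X_s) f(X_0)), with f(X_0) = 1_A almost surely. Replacing A by its shift by
    s and using stationarity gives E(g(X_0) 1_A), which is the right side. *)
Lemma density_invariant (s : {nonneg R}) g : bmf g ->
  I (fun x => (\int[P s%:num x]_y g y) * f x) = I (fun x => g x * f x).
Proof.
move=> bg.
have bs : bmf (fun w : W => g (w s)) by exact: bmf_at.
have opT h x : fdd_op P [:: (s, setT)] h x = \int[P s%:num x]_y h y.
  by rewrite /=; apply: eq_Rintegral => y _; rewrite indicT mul1r.
have mT : measurable_steps [:: (s, [set: T])] by apply/measurable_steps_cons.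
have E : EQ (fun w => g (w s) * f (w 0%:nng)) = I (fun x => (\int[P s%:num x]_y g y) * f x).
  transitivity (I (fun x => fdd_op P [:: (s, setT)] g x * f x)); last first.
    by apply: eq_Rintegral => x _; rewrite opT.
  apply: (blf_ext (F := fun g => EQ (fun w => g (w s) * f (w 0%:nng)))
    (G := fun g => I (fun x => fdd_op P [:: (s, setT)] g x * f x))) bg.
  - apply: (@blf_comp _ _ _ _ W (fun w => w s)
      (fun h => EQ (fun w => h w * f (w 0%:nng)))); first exact: measurable_coord.
    by apply: blf_int => //; exact: bmf_at.
  - by apply: (@blf_fdd_op _ _ _ P _ (fun u => I (fun x => u x * f x))) => //; exact: blf_int.
  - move=> B mB; have ml : measurable_steps [:: (s, B)].
      by apply/measurable_steps_cons.
    transitivity (EQ (fun w => f (w 0%:nng) * \1_(fdd_event 0%:nng [:: (s, B)]) w)).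
      apply: eq_Rintegral => w _; rewrite /= setIT mulrC; congr (_ * _).
      rewrite !indicE; congr (nat_of_bool _)%:R.
      rewrite (_ : (0%:nng%:num + s%:num)%:nng = s)//.
      by apply: nonneg_inj; rewrite /= add0r.
    rewrite (int_now_future mu_inv Q_law 0%:nng ml bf); apply: eq_Rintegral => x _.
    rewrite opT /=; congr (_ * _).
    by apply: eq_Rintegral => y _; rewrite mulr1.
have {}E : EQ (fun w => f (w 0%:nng) * g (w s)) = I (fun x => (\int[P s%:num x]_y g y) * f x).
  by rewrite -E; apply: eq_Rintegral => w _; exact: mulrC.
rewrite -E -(indic_eq_density bs) -(int_shift_invariant s bs) -fE//.
have b0 : bmf (fun w : W => g (w 0%:nng) * \1_A w).
  by apply: bmfM; [exact: bmf_at|exact: bmf_indic].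
rewrite -(int_shift mu_inv Q_law s b0); apply: eq_Rintegral => w _; rewrite mulrC.
rewrite /time_shift (_ : (0%:nng%:num + s%:num)%:nng = s)//.
by apply: nonneg_inj; rewrite /= add0r.
Qed.

End ergodicity.

(** The number a = Q(A) is both the mean of f and the mean of f^2, so the variance of f is a - a^2;
    it vanishes only for a = 0 or a = 1. *)
Lemma shift_ergodic_const (R : realType) d (T : measurableType d) (mu : probability T R)
  (P : R -> R.-pker T ~> T) (Q : probability (@path_space R d T) R) :
  (forall t g, 0 <= t -> bmf g -> \int[mu]_x (\int[P t x]_y g y) = \int[mu]_x g x) ->
  path_law P mu Q ->
  (forall f, bmf f -> (forall t g, 0 <= t -> bmf g ->
      \int[mu]_x ((\int[P t x]_y g y) * f x) = \int[mu]_x (g x * f x)) ->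
    \int[mu]_x ((f x - \int[mu]_x f x) ^+ 2) = 0) ->
  shift_ergodic Q.
Proof.
move=> mu_inv Q_law const A mA A_inv.
have [f [bf f0 fE]] := density_at mu_inv Q_law 0%:nng mA.
have /(const f bf) : forall t g, 0 <= t -> bmf g ->
    \int[mu]_x ((\int[P t x]_y g y) * f x) = \int[mu]_x (g x * f x).
  by move=> t g t0 bg; exact: (density_invariant mu_inv Q_law mA A_inv bf fE (NngNum t0) bg).
have QA2 := Q_invariant_event mu_inv Q_law mA A_inv bf fE.
have QA1 : fine (Q A) = \int[mu]_x f x.
  transitivity (\int[mu]_x ((fun=> 1) x * f x)).
    rewrite -(fE _ (bmf_cst _ 1)) -(@int_indic _ _ _ Q _ mA).
    by apply: eq_Rintegral => w _; rewrite mul1r.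
  by apply: eq_Rintegral => x _; rewrite mul1r.
rewrite -QA1; set a := fine (Q A) in QA1 QA2 *.
rewrite (_ : \int[mu]_x _ = \int[mu]_x (f x ^+ 2) - 2 * a * \int[mu]_x f x + \int[mu]_x (a ^+ 2)); last first.
  rewrite -intZ; auto; rewrite -intB; auto; rewrite -intD; auto.
  by apply: eq_Rintegral => x _; ring.
rewrite (@int_cst1 _ _ _ mu _ (probability_setT mu)) -QA2 -QA1 => H.
have /eqP : a * (a - 1) = 0 by rewrite -oppr0 -H; ring.
rewrite mulf_eq0 subr_eq0 => /orP[] /eqP aE; [left|right];
  by rewrite -(fineK (fin_num_measure Q _ mA)) -/a aE.
Qed.

Theorem proposition3p1 (R : realType) (S : countType) (p : S -> S -> R)
    (P : R -> R.-pker (config R S) ~> (config R S))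
    (Pdual : R -> R.-pker (fconfig S) ~> (fconfig S))
    (S_infinite : infinite_set [set: S])
    (p_walk : irreducible_symmetric_walk p)
    (P_process : process_semigroup p P)
    (Pdual_process : dual_semigroup p Pdual)
    (Pdual_vanishes : forall xi xi' : fconfig S, xi != [fsfun] -> xi' != [fsfun] ->
      Pdual t xi [set xi'] @[t --> +oo%R] --> 0%E)
    (theta : R) (theta_gt0 : 0 < theta)
    (mu : probability (config R S) R)
    (mu_product : is_product_measure (nu theta) mu) :
  ergodic_measure P mu.
Proof.
split; first exact: (mu_invariant theta_gt0 mu_product p_walk P_process S_infinite).
move=> Q Q_law; apply: (shift_ergodic_const _ Q_law) => [t g t0 bg|f bf f_inv].
  exact: (int_op theta_gt0 mu_product p_walk P_process S_infinite t0 bg).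
exact: (invariant_const theta_gt0 mu_product p_walk P_process S_infinite bf f_inv).
Qed.
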